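(* Let $d\in\{1,2\}$, $\rho_1:=1$, $\rho_2:=\frac12$, and let $\mu_\ast>0$ be a constant. Let $\alpha,\mu,p,q$ satisfy $$-\infty<\alpha\le0,\qquad 0\le\mu\le\mu_\ast,\qquad 1<p<\infty,\qquad 1<q\le\infty.$$ Then for all $t\in[0,1]$ and all $f\in\mathcal B^{\alpha,\mu}_{p,q}$, $$\|\mathcal G_tf\|_{\mathcal B^{\alpha+\rho_d,\mu}_{p,q}}\le C\,\|f\|_{\mathcal B^{\alpha,\mu}_{p,q}},$$ where the constant $C$ depends only on $p$, $q$ and $\mu_\ast$.
   Context: Wave operator: $\mathcal G_tf=G_t*f$, where $G_t(x)=\frac12\mathbf 1_{|x|<t}$ if $d=1$ and $G_t(x)=\frac1{2\pi}(t^2-|x|^2)^{-1/2}\mathbf 1_{|x|<t}$ if $d=2$. Weighted Besov spaces: $\|f\|_{L^p_\mu}:=(\int_{\mathbb R^d}|f(x)|^pe^{-\mu|x|}dx)^{1/p}$. Fix an integer $L\ge1$ and $\varphi_0\in C_c^\infty(\mathbb R^d)$ with $\int\varphi_0\ne0$ such that $\varphi(x):=\varphi_0(x)-2^{-d}\varphi_0(x/2)$ satisfies $\int x^r\varphi(x)dx=0$ for all multi-indices $|r|\le L$; put $\varphi_j(x):=2^{dj}\varphi(2^jx)$ for $j\ge1$. For $s\le1$, $1<p<\infty$, $1<q\le\infty$, $\mathcal B^{s,\mu}_{p,q}$ is the completion of $C_c^\infty(\mathbb R^d)$ for the norm $\|f\|_{\mathcal B^{s,\mu}_{p,q}}:=\big(\sum_{j\ge0}2^{jsq}\|\varphi_j*f\|^q_{L^p_\mu}\big)^{1/q}$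 (supremum over $j$ of $2^{js}\|\varphi_j*f\|_{L^p_\mu}$ if $q=\infty$). Different admissible choices of $\varphi_0$ give equivalent norms, uniformly over $\mu\in[0,\mu_\ast]$. *)

(* Defs.v *)
From HB Require Import structures.
From mathcomp Require Import all_boot all_order all_algebra.
From mathcomp Require Import all_classical all_reals all_analysis.

Set Implicit Arguments.
Unset Strict Implicit.
Unset Printing Implicit Defensive.

Import Order.TTheory GRing.Theory Num.Theory.
Import numFieldNormedType.Exports.

Local Open Scope classical_set_scope.
Local Open Scope ring_scope.

(** R^d is ['rV[R]_d]. The norm that the library puts on it is the sup norm, so
    the Euclidean norm is introduced separately; both give the same topology
    and the same notion of differentiability. *)
Section euclidean_space.
Context {R : realType} {d : nat}.
Implicit Types f g : 'rV[R]_d -> R.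

Definition enorm (x : 'rV[R]_d) : R := Num.sqrt (\sum_(i < d) x 0 i ^+ 2).

(** Lebesgue integral on R^d, through the identifications R^1 = R and
    R^2 = R x R. Only d = 1 and d = 2 are meaningful. *)
Definition integral_Rd (F : 'rV[R]_d -> \bar R) : \bar R :=
  match d with
  | 1 => (\int[lebesgue_measure]_(x in [set: R]) F (\row__ x)%R)%E
  | 2 => (\int[(lebesgue_measure \x lebesgue_measure)%E]_(z in [set: R * R])
            F (\row_i (if i == 0%N :> nat then z.1 else z.2))%R)%E
  | _ => 0%E
  end.

Definition Rintegral_Rd f : R := fine (integral_Rd (EFin \o f)).

Definition convolution g f : 'rV[R]_d -> R :=
  fun x => Rintegral_Rd (fun y => g (x - y) * f y).

Definition partials (s : seq 'I_d) f : 'rV[R]_d -> R :=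
  foldr (fun i (g : 'rV[R]_d -> R) => 'D_(delta_mx 0 i) g) f s.

Definition smooth f := forall (s : seq 'I_d) (x : 'rV[R]_d),
  differentiable (partials s f) x.

(** The space C_c^oo(R^d). *)
Definition test_function : set ('rV[R]_d -> R) :=
  [set f | smooth f /\ compact (closure [set x | f x != 0])].

End euclidean_space.

(** Metric completion of a space [D] of vectors for a norm [N]: its elements are
    the classes of [N]-Cauchy sequences of elements of [D], two sequences being
    identified when their difference tends to 0. *)
Section completion.
Context {R : realType} {V : zmodType} (D : set V).
Implicit Types (N : V -> \bar R) (u v : nat -> V) (f : set (nat -> V)).

Definition cauchy_seq N : set (nat -> V) :=
  [set u | (forall n, D (u n)) /\
    forall e : R, 0 < e ->
      exists n0 : nat, forall m n, (n0 <= m)%N -> (n0 <= n)%N ->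
        (N (u m - u n)%R < e%:E)%E].

Definition cauchy_class N u : set (nat -> V) :=
  [set v | [/\ cauchy_seq N u, cauchy_seq N v &
               N (u n - v n) @[n --> \oo] --> 0%E]].

Definition completion N : set (set (nat -> V)) :=
  [set cauchy_class N u | u in cauchy_seq N].

(** The norm of a class is computed on an arbitrary representative. *)
Definition completion_norm N f : \bar R :=
  limn (fun n => N (xget (fun=> 0) f n)).

(** Extension by continuity of an operator [T] defined on [D], with values in
    the completion for [N]. The extended value at [f] is the class of
    [T (u n)] for *every* representative [u] of [f]: whenever it belongs to
    [completion N], each [T \o u] is a Cauchy sequence in [D] and all of them
    are equivalent. *)
Definition completion_ext N (T : V -> V) f : set (nat -> V) :=
  \bigcap_(u in f) cauchy_class N (T \o u).

End completion.

Section besov.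
Context {R : realType} {d : nat}.
Implicit Types (f : 'rV[R]_d -> R) (s mu p : R) (q : \bar R).

Definition weighted_Lp_norm mu p f : \bar R :=
  (integral_Rd (fun x => (`|f x| `^ p * expR (- (mu * enorm x)))%:E)
     `^ p^-1)%E.

Definition mother (phi0 : 'rV[R]_d -> R) : 'rV[R]_d -> R :=
  fun x => phi0 x - (2 ^- d) * phi0 (2^-1 *: x).

Definition admissible (L : nat) (phi0 : 'rV[R]_d -> R) : Prop :=
  [/\ test_function phi0,
      Rintegral_Rd phi0 != 0 &
      forall r : 'I_d -> nat, (\sum_(i < d) r i <= L)%N ->
        Rintegral_Rd (fun x => (\prod_(i < d) x 0 i ^+ r i) * mother phi0 x)
          = 0].

Definition block (phi0 : 'rV[R]_d -> R) (j : nat) : 'rV[R]_d -> R :=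
  if j is 0 then phi0
  else fun x => 2 ^+ (d * j) * mother phi0 (2 ^+ j *: x).

Definition besov_norm (phi0 : 'rV[R]_d -> R) s mu p q f : \bar R :=
  let a j := weighted_Lp_norm mu p (convolution (block phi0 j) f) in
  match q with
  | q%:E => ((\sum_(0 <= j <oo) ((2 `^ (j%:R * s * q))%:E * (a j `^ q)))
               `^ q^-1)%E
  | +oo%E => ereal_sup [set ((2 `^ (j%:R * s))%:E * a j)%E | j in [set: nat]]
  | -oo%E => 0%E
  end.

Definition besov (phi0 : 'rV[R]_d -> R) s mu p q : set (set (nat -> 'rV[R]_d -> R)) :=
  completion test_function (besov_norm phi0 s mu p q).

Definition besov_space_norm (phi0 : 'rV[R]_d -> R) s mu p q (f : set (nat -> 'rV[R]_d -> R)) :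
    \bar R :=
  completion_norm (besov_norm phi0 s mu p q) f.

End besov.

Section wave.
Context {R : realType} {d : nat}.

(** Fundamental solution of the wave equation; only d = 1 and d = 2 are
    meaningful. *)
Definition wave_kernel (t : R) : 'rV[R]_d -> R := fun x =>
  if enorm x < t then
    match d with
    | 1 => 2^-1
    | 2 => (2 * pi)^-1 * (Num.sqrt (t ^+ 2 - enorm x ^+ 2))^-1
    | _ => 0
    end
  else 0.

(** The operator f |-> G_t * f, extended by continuity from C_c^oo to
    classes of Cauchy sequences, with values in B^{s,mu}_{p,q}. *)
Definition wave_op (phi0 : 'rV[R]_d -> R) (s mu p : R) (q : \bar R) (t : R)
    (f : set (nat -> 'rV[R]_d -> R)) : set (nat -> 'rV[R]_d -> R) :=
  completion_ext test_function (besov_norm phi0 s mu p q)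
    (convolution (wave_kernel t)) f.

Definition rho : R := if d == 1%N then 1 else 2^-1.

End wave.

Arguments rho : clear implicits.

(* Main.v *)
Require Import Defs.
From HB Require Import structures.
From mathcomp Require Import all_boot all_order all_algebra.
From mathcomp Require Import all_classical all_reals all_analysis.
From mathcomp Require Import measurable_realfun.
From mathcomp Require Import ring lra.

Set Implicit Arguments.
Unset Strict Implicit.
Unset Printing Implicit Defensive.

Import Order.TTheory GRing.Theory Num.Theory.
Import numFieldNormedType.Exports.

Local Open Scope classical_set_scope.
Local Open Scope ring_scope.

(** Write [S_j] for convolution with [2^{dj} phi0(2^j .) / int phi0], so that the
    blocks are multiples of [S_j - S_{j-1}], and let [a_j] be the j-th block of [f]
    and [G] the wave kernel. The j-th block of [G * f] is
    [G * a_j = G * (a_j - S_j S_j a_j) + G * block_j * (S_j S_j f)]. The kernel [G] has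
    an L^1 modulus of continuity [O(h^rho)], so [1 - S_j] gains [2^{-j rho}] in the
    first term. In the second one, [S_j S_j f] telescopes into a sum over [k <= j] of
    [(S_k + S_{k-1}) a_k], and the kernel [block_j * S_k] has zero mean, support in
    a ball of radius [O(2^-k)] and, because the moments of [block_j] of order at most 1
    vanish, mass [O(4^{-(j-k)})]; hence the gain [2^{-k rho} 4^{-(j-k)} <= 2^{-j rho} 2^{-(j-k)}].
    Only frequencies [k <= j] occur, so [alpha <= 0] makes the weights [2^{j alpha}]
    harmless, uniformly in [alpha], and Schur's test sums the geometric weights.

    The modulus of [G] comes from the layer-cake formula: the superlevel sets of [G] are
    differences of balls, with area [O(l^-2)] at level [l] if [d = 2], and translating
    a ball by [h] changes it by a set of measure [O(h)]; integrating [min(h, l^-2)] over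
    [l > 0] gives [h^{1/2}]. The estimate holds on test functions and passes to the
    completions. *)

(** * Extension of an operator to completions *)

(** The blocks are compactly supported in space, not in frequency, so distinct scales are decoupled
    only through vanishing moments. Frequencies k > j in block j would carry the weight
    2^{(k-j)|alpha|}, which moments of order at most [L] cannot pay for when [alpha] is very
    negative; hence block j is cut at its own scale by S_j instead of expanding f over all k. The
    square S_j S_j is used because S_k S_k - S_{k-1} S_{k-1} = (S_k + S_{k-1}) (S_k - S_{k-1}):
    every telescoped term keeps a smooth filter beside a_k, on which block_j can act. A vanishing
    mean of block_j alone would give the mass 2^{-(j-k)}, which for rho = 1 is entirely spent on
    replacing 2^{-k} by 2^{-j}; the first moments provide the second factor 2^{-(j-k)}, which makes
    the sum over k converge. All kernels live in balls of bounded radius, since t and the scales are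
    at most 1, so the weight exp (- mu |x|) costs a factor controlled by [mu_star]. *)

Section completion_ext.
Local Open Scope ereal_scope.
Context {R : realType} {V : zmodType} (D : set V).
Implicit Types (N : V -> \bar R) (u v : nat -> V).

(** The values are extended reals because a Besov norm may be infinite. The laws for opposites and
    sums are restricted to [D], where the blocks are convergent integrals and measurable
    functions. *)
Record seminorm_on N : Prop := {
  sn_ge0 : forall x, 0 <= N x;
  sn_0 : N 0%R = 0;
  sn_opp : forall x, D x -> N (- x)%R = N x;
  sn_triangle : forall x y, D x -> D y -> N (x + y)%R <= N x + N y }.

Hypothesis DB : forall x y, D x -> D y -> D (x - y)%R.

Let sn_dist N x y : seminorm_on N -> D x -> D y -> N (x - y)%R = N (y - x)%R.
Proof. by move=> sN Dx Dy; rewrite -(sn_opp sN (DB Dx Dy)) opprB. Qed.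

Let sn_triB N x y z : seminorm_on N -> D x -> D y -> D z ->
  N (x - z)%R <= N (x - y)%R + N (y - z)%R.
Proof.
move=> sN Dx Dy Dz; have -> : (x - z = (x - y) + (y - z))%R by rewrite addrA subrK.
by apply: sn_triangle => //; apply: DB.
Qed.

Let sn_leD N x y : seminorm_on N -> D x -> D y -> N x <= N y + N (x - y)%R.
Proof.
move=> sN Dx Dy; have {1}-> : (x = y + (x - y))%R by rewrite addrC subrK.
by apply: sn_triangle => //; apply: DB.
Qed.

(** Either the norms are eventually infinite, or they form a real Cauchy sequence. *)
Lemma cauchy_seq_norm_cvg N u : seminorm_on N -> cauchy_seq D N u ->
  cvgn (N \o u).
Proof.
move=> sN [Du Cu].
have [n0 n0P] := Cu 1%R ltr01.
have [Noo|Nfin] := eqVneq (N (u n0)) +oo.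
  apply/cvg_ex; exists +oo; apply: cvg_near_cst; exists n0 => // n /= n0n.
  have := sn_leD sN (Du n0) (Du n); rewrite Noo leye_eq => /eqP h.
  apply/eqP; rewrite -leye_eq -h.
  have := n0P _ _ (leqnn n0) n0n.
  by case: (N (u n)) h (sn_ge0 sN (u n)) => //= r h _; move: h; case: (N (_ - _)%R).
have fin n : (n0 <= n)%N -> N (u n) \is a fin_num.
  move=> n0n; rewrite ge0_fin_numE ?(sn_ge0 sN)//.
  apply: (le_lt_trans (sn_leD sN (Du n) (Du n0))).
  apply: lte_add_pinfty; first by rewrite ltey.
  by apply: (lt_trans (n0P _ _ n0n (leqnn _))); rewrite ltry.
have cf : cvgn (fine \o N \o u).
  apply/cauchy_cvgP/cauchy_ballP => e e0.
  have [n1 n1P] := Cu _ e0.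
  rewrite near_map2; exists ([set n | (maxn n0 n1 <= n)%N], [set n | (maxn n0 n1 <= n)%N]).
    by split => /=; exists (maxn n0 n1).
  move=> [m n] /= [hm hn].
  have [m0 m1] := (leq_trans (leq_maxl n0 n1) hm, leq_trans (leq_maxr n0 n1) hm).
  have [n0' n1'] := (leq_trans (leq_maxl n0 n1) hn, leq_trans (leq_maxr n0 n1) hn).
  rewrite /ball/= ltr_distl ltrBlDr.
  rewrite -!lte_fin !EFinD !fineK ?fin//.
  have key a b : (n0 <= a)%N -> (n1 <= a)%N -> (n0 <= b)%N -> (n1 <= b)%N ->
      N (u a) < N (u b) + e%:E.
    move=> a0 a1 b0 b1; apply: (le_lt_trans (sn_leD sN (Du a) (Du b))).
    by rewrite lteD2lE ?fin//; apply: n1P.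
  by apply/andP; split; apply: key.
apply/cvg_ex; exists (limn (fine \o N \o u))%:E.
apply/fine_cvgP; split; first by exists n0.
exact: cf.
Qed.

(** Additivity turns the bound on [T] into continuity: Cauchy sequences go to Cauchy sequences and
    equivalent ones to equivalent ones. All the classes intersected in [completion_ext] are then the
    single class of [T \o u0]. *)
Lemma completion_ext_bounded N N' (T : V -> V) (C : R) (f : set (nat -> V)) :
  seminorm_on N -> seminorm_on N' -> (0 < C)%R ->
  (forall x, D x -> D (T x)) ->
  (forall x y, D x -> D y -> T (x - y)%R = (T x - T y)%R) ->
  (forall x, D x -> N' (T x) <= C%:E * N x) ->
  completion D N f ->
  completion D N' (completion_ext D N' T f) /\
  completion_norm N' (completion_ext D N' T f) <= C%:E * completion_norm N f.
Proof.
move=> sN sN' C0 DT TB TN [u0 Cu0 <-{f}].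
set f := cauchy_class D N u0.
have fu0 : f u0.
  split => //; rewrite (_ : (fun n => _) = fun=> 0); first exact: cvg_cst.
  by apply/funext => n; rewrite subrr (sn_0 sN).
have TC u : cauchy_seq D N u -> cauchy_seq D N' (T \o u).
  move=> [Du Cu]; split=> [n|e e0]; first exact: DT.
  have eC0 : (0 < e / C)%R by rewrite divr_gt0.
  have [n0 n0P] := Cu _ eC0; exists n0 => m n mn nn.
  rewrite /= -TB//; apply: (le_lt_trans (TN _ (DB (Du _) (Du _)))).
  have -> : e%:E = C%:E * (e / C)%:E by rewrite -EFinM mulrCA divff ?mulr1 ?gt_eqF.
  by rewrite lte_pmul2l// n0P.
have to0 (a b c : nat -> \bar R) : (forall n, 0 <= a n) -> (forall n, a n <= b n + c n) ->
    b @ \oo --> 0 -> c @ \oo --> 0 -> a @ \oo --> 0.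
  move=> a0 abc b0 c0; apply: (squeeze_cvge (f := cst 0) (h := b \+ c)).
  - by apply: nearW => n; rewrite a0 abc.
  - exact: cvg_cst.
  - by rewrite -(adde0 0); apply: cvgeD.
have Tto0 u v : cauchy_seq D N u -> cauchy_seq D N v ->
    N (u n - v n)%R @[n --> \oo] --> 0 -> N' (T (u n) - T (v n))%R @[n --> \oo] --> 0.
  move=> [Du _] [Dv _] uv.
  apply: (squeeze_cvge (f := cst 0) (h := fun n => C%:E * N (u n - v n)%R)).
  - apply: nearW => n; rewrite (sn_ge0 sN')/= -TB//; apply: TN; exact: DB.
  - exact: cvg_cst.
  - by rewrite -(mule0 C%:E); apply: cvgeZl.
have extE : completion_ext D N' T f = cauchy_class D N' (T \o u0).
  apply/seteqP; split=> [w|w [C1 Cw h] u [_ Cu uu0]].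
    by move/(_ u0 fu0).
  split => //; first exact: TC.
  have [[[Du _] [Dw _]] [Du0 _]] := (TC _ Cu, Cw, TC _ Cu0).
  apply: (to0 _ (fun n => N' (T (u n) - T (u0 n))%R) (fun n => N' (T (u0 n) - w n)%R)) => //.
  - by move=> n; exact: (sn_ge0 sN').
  - by move=> n; exact: (sn_triB sN' (Du n) (Du0 n) (Dw n)).
  - apply: Tto0 => //; by under eq_fun do rewrite (sn_dist sN (Cu.1 _) (Cu0.1 _)).
split; first by exists (T \o u0) => //; exact: TC.
rewrite /completion_norm extE.
(* The two norms are computed on representatives chosen independently, [w] for the image and [v] for
   [f]. They are linked only by [N' (T (v n) - w n)], which tends to 0 and is added to the bound
   before passing to the limit. *)
set w := xget _ _; have wP : cauchy_class D N' (T \o u0) w.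
  apply: (xgetI _ (x := T \o u0)); split; [exact: TC|exact: TC|].
  rewrite (_ : (fun n => _) = fun=> 0); first exact: cvg_cst.
  by apply/funext => n; rewrite subrr (sn_0 sN').
set v := xget _ f; have vP : f v by exact: (xgetI _ fu0).
have [_ Cw w0] := wP; have [_ Cv v0] := vP.
have vw : N' (T (v n) - w n)%R @[n --> \oo] --> 0.
  have [[[Dv _] [Dw _]] [Du0 _]] := (TC _ Cv, Cw, TC _ Cu0).
  apply: (to0 _ (fun n => N' (T (v n) - T (u0 n))%R) (fun n => N' (T (u0 n) - w n)%R)) => //.
  - by move=> n; exact: (sn_ge0 sN').
  - by move=> n; exact: (sn_triB sN' (Dv n) (Du0 n) (Dw n)).
  - apply: Tto0 => //; by under eq_fun do rewrite (sn_dist sN (Cv.1 _) (Cu0.1 _)).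
have cw : cvgn (N' \o w) by exact: cauchy_seq_norm_cvg.
have cv : cvgn (N \o v) by exact: cauchy_seq_norm_cvg.
have -> : C%:E * limn (fun n => N (v n)) = limn (fun n => C%:E * N (v n) + N' (T (v n) - w n)%R).
  apply/esym/cvg_lim => //; rewrite -[X in _ --> X]adde0; apply: cvgeD => //.
    exact: fin_num_adde_defl.
  exact: cvgeZl.
apply: lee_lim => //.
  apply/cvg_ex; exists (C%:E * limn (N \o v) + 0); apply: cvgeD => //.
    exact: fin_num_adde_defl.
  exact: cvgeZl.
apply: nearW => n /=.
have [[Dw _] [Dv _]] := (Cw, Cv).
apply: (le_trans (sn_leD sN' (Dw n) (DT _ (Dv n)))).
by rewrite (sn_dist sN' (Dw n) (DT _ (Dv n))) leeD//; exact: TN.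
Qed.

End completion_ext.

(** * Lebesgue measure on row vectors *)

(** Opaque, so that the sigma-algebra of row vectors is tagged with a display of its own. *)
Definition row_display : measure_display -> measure_display.
Proof. exact. Qed.

Section measurable_row.
Context {R : realType} (n : nat).

Let coords (i : 'I_n) (x : 'rV[R]_n) : measurableTypeR R := x 0 i.

Let row_set0 : g_sigma_preimage coords set0.
Proof. exact: sigma_algebra0. Qed.

Let row_setC A : g_sigma_preimage coords A -> g_sigma_preimage coords (~` A).
Proof. exact: sigma_algebraC. Qed.

Let row_bigcup (F : _^nat) : (forall i, g_sigma_preimage coords (F i)) ->
  g_sigma_preimage coords (\bigcup_i (F i)).
Proof. exact: sigma_algebra_bigcup. Qed.

(** Generated by the coordinates, so that measurability of a map into row vectors is checked
    coordinatewise ([measurable_rowP]); [open_measurable_row] shows that open sets belong to it. *)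
HB.instance Definition _ := @isMeasurable.Build (row_display default_measure_display)
  'rV[R]_n (g_sigma_preimage coords) row_set0 row_setC row_bigcup.

Lemma measurable_coord (i : 'I_n) :
  measurable_fun [set: 'rV[R]_n] (fun x : 'rV[R]_n => x 0 i).
Proof.
move=> _ Y mY; rewrite setTI; apply: sub_sigma_algebra => /=.
rewrite -bigcup_seq/=; exists i => /=; first by rewrite mem_index_enum.
by exists Y => //; rewrite setTI.
Qed.

Lemma measurable_rowP d (T : measurableType d) (f : T -> 'rV[R]_n) :
  (forall i, measurable_fun setT (fun t => f t 0 i)) -> measurable_fun setT f.
Proof.
move=> mf _ A mA; rewrite setTI.
have : g_sigma_preimage (fun i t => coords i (f t)) `<=` measurable.
  apply: smallest_sub; first exact: sigma_algebra_measurable.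
  rewrite -bigcup_seq/=; apply: bigcup_sub => i _ _ [B mB <-].
  exact: mf.
apply; rewrite (g_sigma_preimage_comp coords f); exists A => //.
by rewrite setTI.
Qed.

Lemma measurable_row_affine d (T : measurableType d) (f g : T -> 'rV[R]_n) (a b : R) :
  measurable_fun setT f -> measurable_fun setT g ->
  measurable_fun setT (fun t => a *: f t + b *: g t).
Proof.
move=> mf mg; apply: measurable_rowP => i; under eq_fun do rewrite !mxE.
by apply: measurable_funD; apply: measurable_funM => //;
  apply: (measurableT_comp (measurable_coord i)).
Qed.

End measurable_row.

(** The properties of Lebesgue measure through which the dimensions 1 and 2,
    the only ones in which [integral_Rd] is meaningful, are treated uniformly. *)
Record is_lebesgue {R : realType} n (lam : set 'rV[R]_n -> \bar R) : Prop := {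
  lebesgue_integralE : forall F : 'rV[R]_n -> \bar R, measurable_fun setT F ->
    integral_Rd F = (\int[lam]_x F x)%E;
  lebesgue_affine : forall (c : R) (a : 'rV[R]_n) (A : set 'rV[R]_n), c != 0 ->
    measurable A ->
    (lam [set x | A (c *: x + a)%R] = (`|c| ^- n)%:E * lam A)%E;
  lebesgue_cube : forall r : R, 0 <= r ->
    (lam [set x | forall i, (`|x 0 i| <= r)%R] <= ((2 * r) ^+ n)%:E)%E }.

(** * Lebesgue measure under affine maps *)

Section measures.
Context {R : realType}.
Local Open Scope ereal_scope.
Local Notation leb := (@lebesgue_measure R).

Lemma measurable_cube n (r : R) :
  measurable [set x : 'rV[R]_n | forall i, (`|x 0%R i| <= r)%R].
Proof.
have -> : [set x : 'rV[R]_n | forall i, (`|x 0%R i| <= r)%R] =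
    \bigcap_(i in setT) ((fun x : 'rV[R]_n => x 0%R i) @^-1` `[(- r)%R, r]%classic)%R.
  apply/seteqP; split=> x /= h i.
    by move=> _ /=; rewrite in_itv/= -ler_norml; exact: h.
  by have := h i I; rewrite /= in_itv/= -ler_norml.
apply: fin_bigcap_measurable => [|i _]; first exact: finite_finset.
by rewrite -[X in measurable X]setTI; apply: measurable_coord.
Qed.

(** The nonnegative formula is applied to the positive and negative parts; the identity thus covers
    non-integrable [F], both sides following the same convention for oo - oo. *)
Lemma integral_pushforwardT d1 d2 (X : measurableType d1) (Y : measurableType d2)
    (phi : X -> Y) (mu : {measure set X -> \bar R}) (F : Y -> \bar R) :
  measurable_fun setT phi -> measurable_fun setT F ->
  \int[pushforward mu phi]_y F y = \int[mu]_x F (phi x).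
Proof.
move=> mphi mF; rewrite [LHS]integralE [RHS]integralE.
congr (_ - _).
- rewrite (@ge0_integral_pushforward _ _ X Y R phi mphi mu setT (F^\+))//; last first.
    exact: measurable_funepos.
  by rewrite preimage_setT; apply: eq_integral => x _; rewrite unlock.
- rewrite (@ge0_integral_pushforward _ _ X Y R phi mphi mu setT (F^\-))//; last first.
    exact: measurable_funeneg.
  by rewrite preimage_setT; apply: eq_integral => x _; rewrite unlock.
Qed.

(** For c > 0, c times the left-hand side is a measure in [A] that agrees with Lebesgue measure on
    the intervals ]u, v], which determine it. The case c < 0 follows by reflection. *)
Lemma lebesgue_measure_affine (c a : R) (A : set R) : (c != 0)%R -> measurable A ->
  leb [set x | A (c * x + a)%R] = (`|c|^-1)%:E * leb A.
Proof.
have mphi (k b : R) : measurable_fun [set: R] (fun x : R => k * x + b)%R.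
  by apply: measurable_funD => //; exact: mulrl_measurable.
have pos (k b : R) (B : set R) : (0 < k)%R -> measurable B ->
    leb [set x | B (k * x + b)%R] = (k^-1)%:E * leb B.
  move=> k0 mB.
  have @m0 : {measure set (measurableTypeR R) -> \bar R}.
    pose phi : measurableTypeR R -> measurableTypeR R := (fun x => k * x + b)%R.
    refine (pushforward leb phi : {measure set (measurableTypeR R) -> \bar R}).
    exact: mphi.
  pose m1 : {measure set (measurableTypeR R) -> \bar R} := mscale (NngNum (ltW k0)) m0.
  have -> : leb B = m1 B.
    apply: lebesgue_measure_unique => //= _ [[u v]] _ <- /=.
    rewrite /m1/= /mscale/= /m0/= /pushforward/=.
    have -> : (fun x : R => k * x + b)%R @^-1` `]u, v]%classic =
        `]((u - b) / k), ((v - b) / k)]%classic%R.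
      apply/seteqP; split=> x /=; rewrite !in_itv/= ltr_pdivrMr// ler_pdivlMr//;
        by rewrite ltrBlDr lerBrDr (mulrC x).
    rewrite !lebesgue_measure_itv/= !lte_fin ltr_pM2r ?invr_gt0// ltrD2r.
    case: ifPn => _; last by rewrite mule0.
    rewrite -!EFinD -EFinM; congr (_%:E); field.
    by rewrite gt_eqF.
  by rewrite /m1/= /mscale/= /m0/= /pushforward muleA -EFinM mulVf ?mul1e ?gt_eqF.
move=> c0 mA; have [cpos|cneg] := ltP 0%R c; first by rewrite pos// gtr0_norm.
have {c0}cneg : (c < 0)%R by rewrite lt_neqAle c0.
rewrite ltr0_norm// -(pos _ a) ?oppr_gt0// -[RHS]lebesgue_measureN.
  by rewrite /pushforward/=; congr (leb _); apply/funext => x/=; rewrite mulrNN.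
rewrite -[X in measurable X]setTI; exact: mphi.
Qed.

End measures.

(** * Lebesgue measure in dimensions 1 and 2 *)

Section dim1.
Context {R : realType}.
Local Open Scope ereal_scope.

Definition row1 (x : R) : 'rV[R]_1 := (\row__ x)%R.

Lemma measurable_row1 : measurable_fun setT row1.
Proof.
apply: measurable_rowP => i; under eq_fun do rewrite mxE.
exact: measurable_id.
Qed.

Definition lebesgue1 : set 'rV[R]_1 -> \bar R := pushforward lebesgue_measure row1.

Let lebesgue1_measure : {measure set 'rV[R]_1 -> \bar R}.
Proof.
refine (pushforward lebesgue_measure row1 : {measure set 'rV[R]_1 -> \bar R}).
exact: measurable_row1.
Defined.

HB.instance Definition _ := Measure.copy lebesgue1 lebesgue1_measure.

Lemma is_lebesgue1 : is_lebesgue lebesgue1.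
Proof.
split=> [F mF|c a A c0 mA|r r0].
- by rewrite /lebesgue1 integral_pushforwardT//; exact: measurable_row1.
- rewrite /lebesgue1 /pushforward expr1 -(@lebesgue_measure_affine _ _ (a 0%R 0%R))//.
    congr lebesgue_measure; apply/funext => x /=; congr A; apply/rowP => i.
    by rewrite !mxE ord1.
  rewrite -[X in measurable X]setTI; exact: measurable_row1.
- rewrite /lebesgue1 /pushforward.
  have -> : row1 @^-1` [set x | forall i, (`|x 0 i| <= r)%R] = `[(- r)%R, r]%classic.
    apply/seteqP; split=> x /=; rewrite in_itv/= -ler_norml.
      by move=> /(_ 0%R); rewrite mxE.
    by move=> h i; rewrite mxE.
  rewrite lebesgue_measure_itv/=; case: ifPn => _; last by rewrite lee_fin mulr_ge0.
  by rewrite -EFinD lee_fin expr1 opprK mulr2n mulrDl mul1r.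
Qed.

End dim1.

Section dim2.
Context {R : realType}.
Local Open Scope ereal_scope.
Local Notation leb := (@lebesgue_measure R).

Definition row2 (z : R * R) : 'rV[R]_2 :=
  (\row_i (if i == 0%N :> nat then z.1 else z.2))%R.

Lemma measurable_row2 : measurable_fun setT row2.
Proof.
apply: measurable_rowP => i; under eq_fun do rewrite mxE.
by case: (nat_of_ord i == 0%N); [exact: measurable_fst|exact: measurable_snd].
Qed.

Definition lebesgue2 : set 'rV[R]_2 -> \bar R := pushforward (leb \x leb) row2.

Let lebesgue2_measure : {measure set 'rV[R]_2 -> \bar R}.
Proof.
refine (pushforward (leb \x leb) row2 : {measure set 'rV[R]_2 -> \bar R}).
exact: measurable_row2.
Defined.

HB.instance Definition _ := Measure.copy lebesgue2 lebesgue2_measure.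

(** By uniqueness of the product measure it is enough to look at rectangles, where each coordinate
    contributes a factor |c|^-1. *)
Lemma lebesgue_prod_affine (c a b : R) (A : set (R * R)) : (c != 0)%R -> measurable A ->
  (leb \x leb) [set z | A (c * z.1 + a, c * z.2 + b)%R] =
  (`|c| ^- 2)%:E * (leb \x leb) A.
Proof.
move=> c0 mA.
have mphi : measurable_fun [set: R * R] (fun z : R * R => (c * z.1 + a, c * z.2 + b)%R).
  by apply: measurable_fun_pair; apply: measurable_funD => //; apply: measurable_funM.
have cn : (0 <= `|c| ^+ 2)%R by rewrite exprn_ge0.
have @m0 : {measure set (measurableTypeR R * measurableTypeR R) -> \bar R}.
  pose phi (z : measurableTypeR R * measurableTypeR R) :
    measurableTypeR R * measurableTypeR R := (c * z.1 + a, c * z.2 + b)%R.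
  refine (pushforward (leb \x leb) phi
    : {measure set (measurableTypeR R * measurableTypeR R) -> \bar R}).
  exact: mphi.
pose m1 : {measure set (measurableTypeR R * measurableTypeR R) -> \bar R} := mscale (NngNum cn) m0.
have -> : (leb \x leb) A = m1 A.
  apply: product_measure_unique => // B C mB mC.
  rewrite /m1/= /mscale/= /m0/= /pushforward/=.
  have -> : (fun z : R * R => (c * z.1 + a, c * z.2 + b)%R) @^-1` (B `*` C) =
     [set x | B (c * x + a)%R] `*` [set x | C (c * x + b)%R] by [].
  rewrite product_measure1E//; last 2 first.
  - by rewrite -[X in measurable X]setTI;
      apply: (_ : measurable_fun setT (fun x : R => c * x + a)%R) => //;
      apply: measurable_funD.
  - by rewrite -[X in measurable X]setTI;
      apply: (_ : measurable_fun setT (fun x : R => c * x + b)%R) => //;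
      apply: measurable_funD.
  rewrite [X in _ * (X * _)](lebesgue_measure_affine a c0 mB).
  rewrite [X in _ * (_ * X)](lebesgue_measure_affine b c0 mC).
  rewrite muleACA -EFinM.
  by rewrite [LHS]muleA -EFinM -expr2 exprVn mulfV ?mul1e// expf_neq0 ?normr_eq0.
rewrite /m1/= /mscale/= /m0/= /pushforward muleA -EFinM mulVf ?mul1e//.
by rewrite expf_neq0 ?normr_eq0.
Qed.

Lemma is_lebesgue2 : is_lebesgue lebesgue2.
Proof.
split=> [F mF|c a A c0 mA|r r0].
- by rewrite /lebesgue2 integral_pushforwardT//; exact: measurable_row2.
- rewrite /lebesgue2 /pushforward -(@lebesgue_prod_affine _ (a 0%R 0%R) (a 0%R 1%R))//.
    congr (_ \x _); apply/funext => z /=; congr A; apply/rowP => i.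
    by rewrite !mxE; case: i => [[|[|//]]] /= p; congr (_ + a 0 _)%R; exact: val_inj.
  rewrite -[X in measurable X]setTI; exact: measurable_row2.
- rewrite /lebesgue2 /pushforward.
  have -> : row2 @^-1` [set x | forall i, (`|x 0 i| <= r)%R] = `[(- r)%R, r]%classic `*` `[(- r)%R, r]%classic.
    apply/seteqP; split=> z /=; rewrite !in_itv/= -!ler_norml.
      by move=> h; have := h 0%R; have := h 1%R; rewrite !mxE.
    by move=> [h1 h2] i; rewrite mxE; case: ifP.
  have -> : (leb \x leb) (`[(- r)%R, r]%classic `*` `[(- r)%R, r]%classic) =
      leb `[(- r)%R, r]%classic * leb `[(- r)%R, r]%classic.
    exact: product_measure1E.
  rewrite lebesgue_measure_itv/=; case: ifPn => _; last first.
    by rewrite mul0e lee_fin exprn_ge0// mulr_ge0.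
  by rewrite -EFinD -EFinM lee_fin le_eqVlt; apply/orP; left; apply/eqP; ring.
Qed.

End dim2.

Lemma is_lebesgue_sigma_finite {R : realType} n (lam : {measure set 'rV[R]_n -> \bar R}) :
  is_lebesgue lam -> sigma_finite setT lam.
Proof.
move=> [_ _ cube]; exists (fun k => [set x : 'rV[R]_n | forall i, `|x 0 i| <= k%:R]).
  apply/esym/seteqP; split=> // x _.
  exists (Num.bound (\sum_i `|x 0 i|)) => // i.
  have : 0 <= \sum_i `|x 0 i| by apply: sumr_ge0.
  move=> /archi_boundP /ltW; apply: le_trans.
  by rewrite (bigD1 i)//= lerDl sumr_ge0.
move=> k; split; first exact: measurable_cube.
by apply: (le_lt_trans (cube _ _)); rewrite ?ltry.
Qed.

HB.instance Definition _ (R : realType) := Measure_isSigmaFinite.Build _ _ _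
  (@lebesgue1 R) (is_lebesgue_sigma_finite is_lebesgue1).
HB.instance Definition _ (R : realType) := Measure_isSigmaFinite.Build _ _ _
  (@lebesgue2 R) (is_lebesgue_sigma_finite is_lebesgue2).

(** * Open sets and continuous functions are measurable *)

Section borel_row.
Context {R : realType} (n : nat).

(** An open set is the union of the cubes of the grids of mesh [1/k] that it
    contains, and there are countably many of these cubes. *)
Lemma open_measurable_row (U : set 'rV[R]_n) : open U -> measurable U.
Proof.
move=> oU.
pose cube (k : nat) (v : 'rV[int]_n) : set 'rV[R]_n :=
  [set x | forall i, (v 0 i)%:~R <= k.+1%:R * x 0 i < (v 0 i)%:~R + 1].
pose P (kv : nat * 'rV[int]_n) := cube kv.1 kv.2 `<=` U.
have -> : U = \bigcup_(kv in [set: nat * 'rV[int]_n])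
    (if `[< P kv >] then cube kv.1 kv.2 else set0).
  apply/seteqP; split=> [x Ux|x [kv _]]; last by case: asboolP => // h /h.
  have [e /= e0 eU] := (nbhs_ballP _ _).1 (open_nbhs_nbhs (conj oU Ux)).
  have [k _ /(_ k (leqnn k)) /= ke] := near_infty_natSinv_lt (PosNum e0).
  pose v : 'rV[int]_n := \row_i Num.floor (k.+1%:R * x 0 i).
  have xv : cube k v x.
    by move=> i; rewrite mxE -[X in (_ < _ + X)%R]/(1%:~R) -intrD floor_itv.
  suff kvU : P (k, v) by exists (k, v); [|rewrite asboolT].
  move=> y /= yv; apply: eU; split=> // i j; rewrite (ord1 i) /ball/=.
  apply: (le_lt_trans _ ke).
  rewrite -(@ler_pM2l _ k.+1%:R)// mulfV ?pnatr_eq0//.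
  rewrite -{1}(ger0_norm (ler0n R k.+1)) -normrM mulrBr.
  have := xv j; have := yv j.
  move: (k.+1%:R * x 0 j) (k.+1%:R * y 0 j) ((v 0 j)%:~R : R) => a b c h1 h2.
  by rewrite ler_norml; lra.
apply: countable_bigcupT_measurable => // -[k v] /=.
case: ifP => // _.
have -> : cube k v = \bigcap_(i in setT) ((fun x : 'rV[R]_n => k.+1%:R * x 0 i) @^-1`
    `[(v 0 i)%:~R, (v 0 i)%:~R + 1[%classic).
  apply/seteqP; split=> x /= h i; first by move=> _ /=; rewrite in_itv/=; exact: h.
  by have := h i I; rewrite /= in_itv.
apply: fin_bigcap_measurable => [|i _]; first exact: finite_finset.
rewrite -[X in measurable X]setTI; apply: measurable_funM => //.
exact: measurable_coord.
Qed.

Lemma continuous_measurable_row (f : 'rV[R]_n -> R) : continuous f -> measurable_fun setT f.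
Proof.
move=> cf; apply: (measurability _ (RGenOpens.measurableE R)).
move=> _ [_ [a [b ->] <-]]; rewrite setTI; apply: open_measurable_row.
by move/continuousP : cf; apply; exact: interval_open.
Qed.

End borel_row.

(** * Affine changes of variables in integrals *)

Section change_of_variables.
Context {R : realType} (n : nat) (lam : {measure set 'rV[R]_n -> \bar R}).
Hypothesis lamP : is_lebesgue lam.
Local Open Scope ereal_scope.

Let maffine (c : R) (a : 'rV[R]_n) : measurable_fun setT (fun x : 'rV[R]_n => c *: x + a)%R.
Proof.
under eq_fun do rewrite -[X in (_ + X)%R]scale1r.
by apply: (measurable_row_affine c 1 (f := id) (g := cst a)).
Qed.

Lemma integral_affine (c : R) (a : 'rV[R]_n) (F : 'rV[R]_n -> \bar R) : (c != 0)%R ->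
  measurable_fun setT F -> (forall x, 0 <= F x) ->
  \int[lam]_x F (c *: x + a)%R = (`|c| ^- n)%:E * \int[lam]_x F x.
Proof.
move=> c0 mF F0.
have cn : (0 <= (`|c| ^- n))%R by rewrite invr_ge0 exprn_ge0.
rewrite -(integral_pushforwardT lam (maffine c a))//.
rewrite -(ge0_integral_mscale _ measurableT (NngNum cn))//.
apply: eq_measure_integral => A mA _.
exact: (lebesgue_affine lamP).
Qed.

Lemma integral_shift (a : 'rV[R]_n) (F : 'rV[R]_n -> \bar R) :
  measurable_fun setT F -> (forall x, 0 <= F x) ->
  \int[lam]_x F (x + a)%R = \int[lam]_x F x.
Proof.
move=> mF F0; have := integral_affine a (oner_neq0 R) mF F0.
rewrite normr1 expr1n invr1 mul1e => <-.
by apply: eq_integral => x _; rewrite scale1r.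
Qed.

Lemma integral_reflect (a : 'rV[R]_n) (F : 'rV[R]_n -> \bar R) :
  measurable_fun setT F -> (forall x, 0 <= F x) ->
  \int[lam]_x F (a - x)%R = \int[lam]_x F x.
Proof.
move=> mF F0; have N1 : (-1 != 0 :> R)%R by rewrite oppr_eq0 oner_neq0.
have := integral_affine a N1 mF F0.
rewrite normrN1 expr1n invr1 mul1e => <-.
by apply: eq_integral => x _; rewrite scaleN1r addrC.
Qed.

End change_of_variables.

Lemma lee_poweR {R : realType} (x y : \bar R) (r : R) :
  (0 <= r)%R -> (0 <= x -> x <= y -> x `^ r <= y `^ r)%E.
Proof.
move=> r0 x0 xy; apply: gt0_ler_poweR => //; rewrite in_itv/= leey andbT//.
exact: le_trans xy.
Qed.

(** * Jensen's and Young's inequalities in weighted spaces *)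

Section jensen.
Local Open Scope ereal_scope.
Context d (T : measurableType d) {R : realType} (mu : {measure set T -> \bar R}).

(** Hölder's inequality for the factorization w f = w^{1/q} (w^{1/p} f), with q conjugate to p,
    raised to the power p. It serves both for Lebesgue-type measures in [weighted_young] and for the
    counting measure in [lq_norm_geometric]. *)
Lemma poweR_integral_le (w f : T -> R) (p : R) : (1 < p)%R ->
  measurable_fun setT w -> measurable_fun setT f ->
  (forall x, (0 <= w x)%R) -> (forall x, (0 <= f x)%R) ->
  (\int[mu]_x (w x * f x)%:E) `^ p <=
  (\int[mu]_x (w x)%:E) `^ (p - 1) * \int[mu]_x (w x * f x `^ p)%:E.
Proof.
move=> p1 mw mf w0 f0.
have p0 : (0 < p)%R by rewrite (lt_trans ltr01).
pose q := (p / (p - 1))%R.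
have q0 : (0 < q)%R by rewrite divr_gt0// subr_gt0.
have pq : (q^-1 + p^-1 = 1)%R.
  by rewrite /q invf_div; field; rewrite gt_eqF.
pose F x := (w x `^ q^-1)%R; pose G x := (w x `^ p^-1 * f x)%R.
have mF : measurable_fun setT F.
  exact: (measurableT_comp (measurable_powR _)).
have mG : measurable_fun setT G.
  by apply: measurable_funM => //; exact: (measurableT_comp (measurable_powR _)).
have := hoelder mu mF mG q0 p0 pq.
rewrite Lnorm1.
have -> : \int[mu]_x `|(EFin \o (F \* G)%R) x| = \int[mu]_x (w x * f x)%:E.
  apply: eq_integral => x _ /=; rewrite /F /G mulrA -powRD; last first.
    by rewrite pq oner_eq0.
  by rewrite pq powRr1// ger0_norm// mulr_ge0.
rewrite unlock.
have -> : \int[mu]_x `|(EFin \o F) x| `^ q = \int[mu]_x (w x)%:E.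
  apply: eq_integral => x _ /=; rewrite /F ger0_norm ?powR_ge0//.
  by rewrite -powRrM mulVf ?gt_eqF// powRr1.
have -> : \int[mu]_x `|(EFin \o G) x| `^ p = \int[mu]_x (w x * f x `^ p)%:E.
  apply: eq_integral => x _ /=; rewrite /G ger0_norm ?mulr_ge0 ?powR_ge0//.
  by rewrite powRM ?powR_ge0// -powRrM mulVf ?gt_eqF// powRr1.
have i0 : 0 <= \int[mu]_x (w x)%:E by apply: integral_ge0 => x _; rewrite lee_fin.
have i1 : 0 <= \int[mu]_x (w x * f x `^ p)%:E.
  by apply: integral_ge0 => x _; rewrite lee_fin mulr_ge0 ?powR_ge0.
have i2 : 0 <= \int[mu]_x (w x * f x)%:E.
  by apply: integral_ge0 => x _; rewrite lee_fin mulr_ge0.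
move=> H.
apply: (@le_trans _ _ (((\int[mu]_x (w x)%:E) `^ q^-1 *
    (\int[mu]_x (w x * f x `^ p)%:E) `^ p^-1) `^ p)).
  by apply: lee_poweR => //; exact: ltW.
rewrite poweRM ?poweR_ge0// -!poweRrM mulVf ?gt_eqF// poweRe1//.
by rewrite /q invf_div mulfVK ?gt_eqF.
Qed.

End jensen.

(** * The Euclidean norm *)

Section enorm.
Context {R : realType} (n : nat).
Implicit Types x y : 'rV[R]_n.

Lemma enorm_ge0 x : 0 <= enorm x. Proof. exact: sqrtr_ge0. Qed.

Lemma sqr_enorm x : enorm x ^+ 2 = \sum_(i < n) x 0 i ^+ 2.
Proof. by rewrite sqr_sqrtr// sumr_ge0// => i _; exact: sqr_ge0. Qed.

Lemma ler_enorm_coord x i : `|x 0 i| <= enorm x.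
Proof.
rewrite -(@ler_pXn2r _ 2) ?nnegrE ?enorm_ge0// sqr_enorm real_normK ?num_real//.
by rewrite (bigD1 i)//= lerDl sumr_ge0// => j _; exact: sqr_ge0.
Qed.

Lemma enorm0 : enorm (0 : 'rV[R]_n) = 0.
Proof.
by rewrite /enorm big1 ?sqrtr0// => i _; rewrite mxE expr0n.
Qed.

Lemma enormZ (c : R) x : enorm (c *: x) = `|c| * enorm x.
Proof.
rewrite /enorm -sqrtr_sqr -sqrtrM ?sqr_ge0// mulr_sumr; congr Num.sqrt.
by apply: eq_bigr => i _; rewrite mxE exprMn.
Qed.

Lemma enormN x : enorm (- x) = enorm x.
Proof. by rewrite -scaleN1r enormZ normrN1 mul1r. Qed.

Lemma enorm_eq0 x : (enorm x == 0) = (x == 0).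
Proof.
apply/eqP/eqP => [x0|->]; last exact: enorm0.
apply/rowP => i; rewrite mxE; apply/eqP; rewrite -normr_le0 -x0.
exact: ler_enorm_coord.
Qed.

Lemma ler_enormD x y : enorm (x + y) <= enorm x + enorm y.
Proof.
have [->|x0] := eqVneq x 0; first by rewrite add0r enorm0 add0r.
have [->|y0] := eqVneq y 0; first by rewrite addr0 enorm0 addr0.
have a0 : 0 < enorm x by rewrite lt0r enorm_eq0 x0 enorm_ge0.
have b0 : 0 < enorm y by rewrite lt0r enorm_eq0 y0 enorm_ge0.
rewrite -(@ler_pXn2r _ 2) ?nnegrE ?addr_ge0 ?enorm_ge0//.
set a := enorm x in a0 *; set b := enorm y in b0 *.
(* AM-GM on each coordinate: [2 u v <= (b/a) u^2 + (a/b) v^2] *)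
have amgm i : x 0 i * y 0 i *+ 2 <= b / a * x 0 i ^+ 2 + a / b * y 0 i ^+ 2.
  rewrite -subr_ge0 [leRHS](_ : _ = (a * b)^-1 * (b * x 0 i - a * y 0 i) ^+ 2).
    by rewrite mulr_ge0 ?sqr_ge0// invr_ge0 mulr_ge0// ltW.
  by field; rewrite !gt_eqF.
rewrite sqr_enorm; apply: (@le_trans _ _ (\sum_(i < n) (x 0 i ^+ 2 + y 0 i ^+ 2 +
    (b / a * x 0 i ^+ 2 + a / b * y 0 i ^+ 2)))).
  apply: ler_sum => i _; rewrite mxE sqrrD addrAC; apply: lerD => //.
rewrite !big_split/= -!mulr_sumr -!sqr_enorm -/a -/b.
rewrite le_eqVlt; apply/orP; left; apply/eqP.
by field; rewrite !gt_eqF.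
Qed.

Lemma measurable_enorm : measurable_fun setT (@enorm R n).
Proof.
apply: (measurableT_comp (f := @Num.sqrt R)).
  by apply: continuous_measurable_fun; exact: sqrt_continuous.
apply: measurable_sum => i; apply: measurable_funX; exact: measurable_coord.
Qed.

End enorm.

Section weighted_young.
Local Open Scope ereal_scope.
Context {R : realType} (n : nat) (lam : {sigma_finite_measure set 'rV[R]_n -> \bar R}).
Hypothesis lamP : is_lebesgue lam.

Lemma weighted_Lp_normE (mu p : R) (f : 'rV[R]_n -> R) : measurable_fun setT f ->
  weighted_Lp_norm mu p f =
  (\int[lam]_x (`|f x| `^ p * expR (- (mu * enorm x)))%:E) `^ p^-1.
Proof.
move=> mf; rewrite /weighted_Lp_norm (lebesgue_integralE lamP)//.
apply/measurable_EFinP; apply: measurable_funM.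
  apply: (measurableT_comp (measurable_powR _)); exact: measurableT_comp.
apply: measurableT_comp => //; apply: measurableT_comp => //.
by apply: measurable_funM => //; exact: measurable_enorm.
Qed.

(** Jensen and Tonelli, together with [exp (- mu |x|) <= exp (mu r) exp (- mu |x - s|)]
    for [|s| <= r]. Translates indexed by an arbitrary measure space are needed for
    [smoothing_convolution]. *)
Lemma weighted_young d' (O : measurableType d') (nu : {sigma_finite_measure set O -> \bar R})
    (K : O -> R) (s : O -> 'rV[R]_n) (r mu p : R) (a c : 'rV[R]_n -> R) :
  (1 < p)%R -> (0 <= mu)%R -> (0 <= r)%R ->
  measurable_fun setT K -> measurable_fun setT s ->
  measurable_fun setT a -> measurable_fun setT c ->
  (forall o, (0 <= K o)%R) -> (forall o, K o != 0%R -> (enorm (s o) <= r)%R) ->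
  (forall x, (`|c x|)%:E <= \int[nu]_o (K o * `|a (x - s o)|)%:E) ->
  weighted_Lp_norm mu p c <=
  (expR (mu * r))%:E * (\int[nu]_o (K o)%:E) * weighted_Lp_norm mu p a.
Proof.
move=> p1 mu0 r0 mK ms ma mc K0 Ks cle.
have p0 : (0 < p)%R by rewrite (lt_trans ltr01).
rewrite !weighted_Lp_normE//.
set W := \int[nu]_o (K o)%:E; set A := (X in _ * X `^ _).
have W0 : 0 <= W by apply: integral_ge0 => o _; rewrite lee_fin.
have e0 (x : 'rV[R]_n) : (0 <= expR (- (mu * enorm x)))%R := expR_ge0 _.
have A0 : 0 <= A.
  by apply: integral_ge0 => x _; rewrite lee_fin mulr_ge0 ?powR_ge0.
have msub : measurable_fun setT (fun z : 'rV[R]_n * O => (z.1 - s z.2)%R).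
  under eq_fun do rewrite -[X in (X - _)%R]scale1r -scaleN1r.
  apply: measurable_row_affine => //; exact: measurableT_comp.
have mw : measurable_fun setT (fun x : 'rV[R]_n => expR (- (mu * enorm x))).
  apply: measurableT_comp => //; apply: measurableT_comp => //.
  by apply: measurable_funM => //; exact: measurable_enorm.
have mpow (g : 'rV[R]_n -> R) : measurable_fun setT g ->
    measurable_fun setT (fun x => (`|g x| `^ p)%R).
  by move=> mg; apply: (measurableT_comp (measurable_powR _)); exact: measurableT_comp.
have mws (t : 'rV[R]_n) : measurable_fun setT (fun x : 'rV[R]_n => expR (- (mu * enorm (x + t))))%R.
  apply: (measurableT_comp mw (g := fun x : 'rV[R]_n => (x + t)%R)).
  under eq_fun do rewrite -[X in (X + _)%R]scale1r -[X in (_ + X)%R]scale1r.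
  exact: measurable_row_affine.
pose ga x := (`|a x| `^ p * expR (- (mu * enorm x)))%:E.
have ga0 x : setT x -> 0 <= ga x by move=> _; rewrite lee_fin mulr_ge0 ?powR_ge0.
have mga : measurable_fun setT ga.
  by apply/measurable_EFinP; apply: measurable_funM => //; exact: mpow.
pose F (z : 'rV[R]_n * O) := (K z.2 * `|a (z.1 - s z.2)| `^ p *
  expR (- (mu * enorm z.1)))%R.
have F0 z : (0 <= F z)%R by rewrite !mulr_ge0 ?powR_ge0.
have mF : measurable_fun setT (EFin \o F).
  apply/measurable_EFinP; apply: measurable_funM; last exact: (measurableT_comp mw).
  apply: measurable_funM; first exact: (measurableT_comp mK).
  exact: (measurableT_comp (mpow _ ma)).
(* Jensen in [o] at fixed [x], for the weight [K] of total mass [W]. *)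
have step1 x : (`|c x| `^ p * expR (- (mu * enorm x)))%:E <=
    W `^ (p - 1) * \int[nu]_o (F (x, o))%:E.
  have max : measurable_fun setT (fun o => a (x - s o)%R).
    by apply: (measurableT_comp ma); exact: (measurable_fun_pair2 x msub).
  have -> : \int[nu]_o (F (x, o))%:E =
      (expR (- (mu * enorm x)))%:E * \int[nu]_o (K o * `|a (x - s o)| `^ p)%:E.
    rewrite -ge0_integralZl//.
    - by apply: eq_integral => o _; rewrite -EFinM mulrC.
    - apply/measurable_EFinP; apply: measurable_funM => //.
      by apply: (measurableT_comp (measurable_powR _)); exact: measurableT_comp.
    - by move=> o _; rewrite lee_fin mulr_ge0 ?powR_ge0.
  rewrite muleCA EFinM muleC lee_wpmul2l ?lee_fin//.
  apply: le_trans (poweR_integral_le nu p1 mK _ K0 _) => //; last first.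
    exact: measurableT_comp.
  by rewrite -poweR_EFin; apply: lee_poweR; rewrite ?lee_fin// ltW.
have W1 : 0 <= W `^ (p - 1) := poweR_ge0 _ _.
have step2 : \int[lam]_x (`|c x| `^ p * expR (- (mu * enorm x)))%:E <=
    W `^ (p - 1) * (W * ((expR (mu * r))%:E * A)).
  apply: (@le_trans _ _ (\int[lam]_x (W `^ (p - 1) * \int[nu]_o (F (x, o))%:E))).
    apply: ge0_le_integral => //.
    - by apply/measurable_EFinP; apply: measurable_funM => //; exact: mpow.
    - apply: measurable_funeM; exact: (measurable_fun_fubini_tonelli_F (EFin \o F)).
  rewrite ge0_integralZl//; last 2 first.
  - exact: (measurable_fun_fubini_tonelli_F (EFin \o F)).
  - by move=> x _; apply: integral_ge0 => o _; rewrite lee_fin.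
  apply: lee_wpmul2l => //.
  rewrite (fubini_tonelli (EFin \o F))//=.
  rewrite /W -ge0_integralZr//; last 3 first.
  - exact/measurable_EFinP.
  - by move=> o _; rewrite lee_fin.
  - by rewrite mule_ge0// lee_fin expR_ge0.
  apply: ge0_le_integral => //.
  - by move=> o _; apply: integral_ge0 => x _; rewrite lee_fin.
  - exact: (measurable_fun_fubini_tonelli_G (EFin \o F)).
  - apply: emeasurable_funM => //; exact/measurable_EFinP.
  (* The translation [s o] is controlled by [r] only where [K o] does not vanish. *)
  move=> o _; have [Ko|Ko] := eqVneq (K o) 0%R.
    rewrite integral0_eq ?mule_ge0 ?lee_fin ?expR_ge0// => x _.
    by rewrite /F/= Ko !mul0r.
  have shift : \int[lam]_x (F (x, o))%:E =
      \int[lam]_x (K o * `|a x| `^ p * expR (- (mu * enorm (x + s o))))%:E.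
    rewrite -[RHS](integral_shift lamP (- s o)).
    - by apply: eq_integral => x _; rewrite /F/= subrK.
    - apply/measurable_EFinP; apply: measurable_funM.
        by apply: measurable_funM => //; exact: mpow.
      exact: mws.
    - by move=> x; rewrite lee_fin !mulr_ge0 ?powR_ge0.
  have k0 : (0 <= K o * expR (mu * r))%R by rewrite mulr_ge0// expR_ge0.
  have KA : (K o)%:E * ((expR (mu * r))%:E * A) = \int[lam]_x
      ((K o * expR (mu * r))%:E * (`|a x| `^ p * expR (- (mu * enorm x)))%:E).
    transitivity ((K o * expR (mu * r))%:E * A); first by rewrite EFinM muleA.
    exact: esym (ge0_integralZl_EFin lam measurableT ga0 mga k0).
  rewrite shift KA; apply: ge0_le_integral.
  - exact: measurableT.
  - by move=> x _; rewrite lee_fin !mulr_ge0 ?powR_ge0// expR_ge0.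
  - apply/measurable_EFinP; apply: measurable_funM; last exact: mws.
    by apply: measurable_funM; [exact: measurable_cst|exact: mpow].
  - exact: (measurable_funeM _ mga).
  move=> x _.
  have ex : (expR (- (mu * enorm (x + s o))) <= expR (mu * r) * expR (- (mu * enorm x)))%R.
    rewrite -expRD ler_expR.
    have h := ler_enormD (x + s o) (- s o); rewrite addrK enormN in h.
    move: (enorm x) (enorm (x + s o)) (enorm (s o)) h (Ks o Ko) => u v w h hw.
    have h' : (0 <= r + v - u)%R by lra.
    by have := mulr_ge0 mu0 h'; lra.
  have Kp : (0 <= K o * `|a x| `^ p)%R by rewrite mulr_ge0// powR_ge0.
  have := ler_wpM2l Kp ex; rewrite -lee_fin => /le_trans; apply.
  rewrite -EFinM le_eqVlt; apply/orP; left; apply/eqP; congr (_%:E).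
  by move: (expR _) (expR _) (_ `^ _)%R => u v w; ring.
apply: (@le_trans _ _ ((W `^ (p - 1) * (W * ((expR (mu * r))%:E * A))) `^ p^-1)).
  apply: lee_poweR step2; first by rewrite invr_ge0 ltW.
  by apply: integral_ge0 => x _; rewrite lee_fin mulr_ge0 ?powR_ge0.
rewrite muleA.
have -> : W `^ (p - 1) * W = W `^ p.
  rewrite -{2}[W]poweRe1// -poweRD ?subrK//.
  by apply/implyP; rewrite subrK gt_eqF.
rewrite !poweRM ?mule_ge0 ?poweR_ge0 ?lee_fin ?expR_ge0//.
rewrite -poweRrM divff ?gt_eqF// poweRe1// muleA (muleC W).
(* The root has turned W^p into W and the exponential into exp (mu r / p), which is enlarged to exp
   (mu r). *)
apply: lee_wpmul2r; first exact: poweR_ge0.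
apply: lee_wpmul2r => //.
rewrite poweR_EFin lee_fin -expRM ler_expR.
by rewrite ler_piMr ?mulr_ge0// invf_le1// ltW.
Qed.

End weighted_young.

(** * Weighted sequence spaces *)

Section lq_norm.
Local Open Scope ereal_scope.
Context {R : realType}.
Implicit Types (x y : nat -> \bar R) (q : \bar R).

Definition lq_norm q x : \bar R :=
  match q with
  | q%:E => (\sum_(0 <= j <oo) (x j) `^ q) `^ q^-1
  | +oo%E => ereal_sup [set x j | j in [set: nat]]
  | -oo%E => 0
  end.

Lemma lq_norm_ge0 q x : (forall j, 0 <= x j) -> 0 <= lq_norm q x.
Proof.
move=> x0; case: q => [q| |] //=; first exact: poweR_ge0.
by apply: le_trans (x0 0%N) _; apply: ereal_sup_ubound; exists 0%N.
Qed.

Lemma lq_norm0 q : 1 < q -> lq_norm q (fun=> 0) = 0.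
Proof.
case: q => [q| |] //= q1; last first.
  apply/eqP; rewrite eq_le; apply/andP; split.
    by apply: ge_ereal_sup => _ [j _ <-].
  by apply: ereal_sup_ubound; exists 0%N.
rewrite lte_fin in q1; have q0 : (0 < q)%R := lt_trans ltr01 q1.
rewrite eseries0 ?poweR0r ?gt_eqF ?invr_gt0// => j _ _.
by rewrite powR0 ?gt_eqF.
Qed.

Lemma lq_norm_le q x y : 1 < q -> (forall j, 0 <= x j) -> (forall j, x j <= y j) ->
  lq_norm q x <= lq_norm q y.
Proof.
move=> + x0 xy; have y0 j : 0 <= y j := le_trans (x0 j) (xy j).
case: q => [q| |] //= q1; last first.
  apply: ge_ereal_sup => _ [j _ <-]; apply: le_trans (xy j) _.
  by apply: ereal_sup_ubound; exists j.
rewrite lte_fin in q1; have q0 : (0 < q)%R := lt_trans ltr01 q1.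
apply: lee_poweR; first by rewrite invr_ge0 ltW.
  by apply: nneseries_ge0 => *; exact: poweR_ge0.
apply: lee_nneseries => [*|j _]; first exact: poweR_ge0.
by apply: lee_poweR => //; exact: ltW.
Qed.

(** Disposes of sequences with an infinite term, so that Hölder's and Minkowski's inequalities for
    real-valued functions on the counting measure apply to the others. *)
Lemma lq_norm_infty q x j : 1 < q -> (forall j, 0 <= x j) -> x j = +oo ->
  lq_norm q x = +oo.
Proof.
move=> + x0 xj; case: q => [q| |] //= q1; last first.
  by apply/eqP; rewrite -leye_eq -xj; apply: ereal_sup_ubound; exists j.
rewrite lte_fin in q1; have q0 : (0 < q)%R := lt_trans ltr01 q1.
rewrite (nneseries_pinfty _ _ (k := j))//.
- by rewrite poweRyr// invr_neq0// gt_eqF.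
- by move=> n _; exact: poweR_ge0.
- by rewrite xj poweRyr// gt_eqF.
Qed.

Lemma lq_normZ q (c : R) x : 1 < q -> (0 <= c)%R -> (forall j, 0 <= x j) ->
  lq_norm q (fun j => c%:E * x j) = c%:E * lq_norm q x.
Proof.
move=> + c0 x0; case: q => [q| |] //= q1; last first.
  rewrite -ereal_supZl//; last by apply/set0P; exists (x 0%N); exists 0%N.
  by congr ereal_sup; rewrite image_comp.
rewrite lte_fin in q1; have q0 : (0 < q)%R := lt_trans ltr01 q1.
under eq_eseriesr do rewrite poweRM// poweR_EFin.
rewrite nneseriesZl; last by move=> *; exact: poweR_ge0.
rewrite poweRM ?lee_fin ?powR_ge0//; last first.
  by apply: nneseries_ge0 => *; exact: poweR_ge0.
by rewrite poweR_EFin -powRrM divff ?gt_eqF// powRr1.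
Qed.

Lemma lq_norm_triangle q x y : 1 < q -> (forall j, 0 <= x j) -> (forall j, 0 <= y j) ->
  lq_norm q (fun j => x j + y j) <= lq_norm q x + lq_norm q y.
Proof.
move=> q1 x0 y0.
have [[j xj]|xfin] := pselect (exists j, x j = +oo).
  by rewrite (lq_norm_infty q1 x0 xj) addye ?leey// gt_eqF// (lt_le_trans _ (lq_norm_ge0 _ y0)).
have [[j yj]|yfin] := pselect (exists j, y j = +oo).
  by rewrite (lq_norm_infty q1 y0 yj) addey ?leey// gt_eqF// (lt_le_trans _ (lq_norm_ge0 _ x0)).
have fx j : x j \is a fin_num.
  by rewrite ge0_fin_numE// ltey; apply/eqP => h; apply: xfin; exists j.
have fy j : y j \is a fin_num.
  by rewrite ge0_fin_numE// ltey; apply/eqP => h; apply: yfin; exists j.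
case: q q1 => [q| |] //= q1; last first.
  apply: ge_ereal_sup => _ [j _ <-].
  by apply: leeD; apply: ereal_sup_ubound; exists j.
rewrite lte_fin in q1; have q0 : (0 < q)%R := lt_trans ltr01 q1.
have := @minkowski_EFin _ _ R counting (fine \o x) (fine \o y) q _ _ (ltW q1).
move=> /(_ (fun _ _ _ => I) (fun _ _ _ => I)).
rewrite !Lnorm_counting//.
rewrite (_ : \sum_(k <oo) _ = \sum_(0 <= j <oo) (x j + y j) `^ q); last first.
  apply: eq_eseriesr => j _.
  rewrite (_ : (EFin \o _) j = x j + y j) ?gee0_abs ?adde_ge0//.
  by rewrite /= EFinD !fineK.
have E (z : nat -> \bar R) : (forall j, 0 <= z j) -> (forall j, z j \is a fin_num) ->
    \sum_(k <oo) `|(EFin \o (fine \o z)) k| `^ q = \sum_(0 <= j <oo) (z j) `^ q.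
  by move=> z0 fz; apply: eq_eseriesr => j _;
    rewrite (_ : (EFin \o _) j = z j) ?gee0_abs//= fineK.
by rewrite !E.
Qed.

Definition geometric_weight (j k : nat) : R := if (k <= j)%N then (2 ^- (j - k))%R else 0%R.

Lemma geometric_weight_ge0 j k : (0 <= geometric_weight j k)%R.
Proof. by rewrite /geometric_weight; case: ifP. Qed.

Let sum_half (n : nat) : \sum_(0 <= i < n) ((2 ^- i)%R)%:E <= 2%:E :> \bar R.
Proof.
rewrite sumEFin lee_fin.
suff -> : (\sum_(0 <= i < n) 2 ^- i = 2 - 2 * 2 ^- n :> R)%R.
  by rewrite gerBl mulr_ge0.
elim: n => [|n IH]; first by rewrite big_geq// expr0 invr1 mulr1 subrr.
rewrite big_nat_recr//= IH exprS invfM; field.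
by rewrite expf_neq0.
Qed.

Lemma sum_geometric_weight_row j : \sum_(0 <= k <oo) (geometric_weight j k)%:E <= 2%:E.
Proof.
rewrite (nneseries_split _ j.+1)%N; last by move=> k _; rewrite lee_fin geometric_weight_ge0.
rewrite add0n [X in _ + X]eseries0 ?adde0; last first.
  by move=> k kj _; rewrite /geometric_weight leqNgt kj.
apply: le_trans (sum_half j.+1).
rewrite big_nat_rev/=; rewrite le_eqVlt; apply/orP; left; apply/eqP.
apply: eq_big_nat => k /andP[_ kj]; rewrite /geometric_weight add0n subSS leq_subr subKn//.
Qed.

Lemma sum_geometric_weight_col k : \sum_(0 <= j <oo) (geometric_weight j k)%:E <= 2%:E.
Proof.
rewrite (nneseries_split _ k)%N; last by move=> j _; rewrite lee_fin geometric_weight_ge0.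
rewrite big_nat_cond big1 ?add0e ?add0n; last first.
  by move=> j /andP[/andP[_ jk] _]; rewrite /geometric_weight leqNgt jk.
rewrite -nneseries_addn; last by move=> j; rewrite lee_fin geometric_weight_ge0.
apply: lime_le; first by apply: is_cvg_nneseries => *; rewrite lee_fin geometric_weight_ge0.
apply: nearW => n; apply: le_trans (sum_half n).
by apply: lee_sum => j _; rewrite /geometric_weight leq_addl addnK.
Qed.

(** Schur's test: the rows and the columns of the weights both sum to at most 2. *)
Lemma lq_norm_geometric q x y : 1 < q -> (forall j, 0 <= x j) -> (forall j, 0 <= y j) ->
  (forall j, x j <= \sum_(0 <= k <oo) (geometric_weight j k)%:E * y k) ->
  lq_norm q x <= 2%:E * lq_norm q y.
Proof.
move=> q1 x0 y0 xy.
have [[j yj]|yfin] := pselect (exists j, y j = +oo).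
  by rewrite (lq_norm_infty q1 y0 yj) gt0_muley ?lte_fin// leey.
have fy j : y j \is a fin_num.
  by rewrite ge0_fin_numE// ltey; apply/eqP => h; apply: yfin; exists j.
have w0 j k : 0 <= (geometric_weight j k)%:E :> \bar R.
  by rewrite lee_fin geometric_weight_ge0.
case: q q1 => [q| |] //= q1; last first.
  set s := ereal_sup [set y j | j in _]; have ys k : y k <= s by apply: ereal_sup_ubound; exists k.
  apply: ge_ereal_sup => _ [j _ <-]; apply: le_trans (xy j) _.
  have [soo|sfin] := eqVneq s +oo; first by rewrite soo gt0_muley ?lte_fin// leey.
  have sf : s \is a fin_num by rewrite ge0_fin_numE ?ltey// (le_trans (y0 0%N)).
  apply: (@le_trans _ _ (\sum_(0 <= k <oo) (fine s)%:E * (geometric_weight j k)%:E)).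
    apply: lee_nneseries => [k *|k _]; first exact: mule_ge0.
    by rewrite muleC; apply: lee_wpmul2r => //; rewrite fineK.
  rewrite nneseriesZl// fineK// muleC lee_wpmul2r ?sum_geometric_weight_row//.
  exact: le_trans (ys 0%N).
rewrite lte_fin in q1; have q0 : (0 < q)%R := lt_trans ltr01 q1.
(* Jensen for the weights of row j, whose sum is at most 2, gives the factor 2^{q-1}. Exchanging the
   sums over j and k below uses the columns and gives the last factor 2. *)
have jensen j : (x j) `^ q <=
    (2 `^ (q - 1))%:E * \sum_(0 <= k <oo) (geometric_weight j k)%:E * (y k) `^ q.
  have S0 : 0 <= \sum_(0 <= k <oo) (geometric_weight j k)%:E * y k.
    by apply: nneseries_ge0 => k _ _; exact: mule_ge0.
  have S1 : 0 <= \sum_(0 <= k <oo) (geometric_weight j k)%:E * (y k) `^ q.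
    by apply: nneseries_ge0 => k _ _; rewrite mule_ge0// poweR_ge0.
  apply: (@le_trans _ _ ((\sum_(0 <= k <oo) (geometric_weight j k)%:E * y k) `^ q)).
    by apply: lee_poweR (x0 j) (xy j); exact: ltW.
  have := @poweR_integral_le _ _ R counting (geometric_weight j) (fine \o y) q q1
    (fun _ _ _ => I) (fun _ _ _ => I) (geometric_weight_ge0 j) (fun k => fine_ge0 (y0 k)).
  rewrite !ge0_integral_count//; last 2 first.
  - by move=> k; rewrite lee_fin mulr_ge0 ?geometric_weight_ge0// powR_ge0.
  - by move=> k; rewrite lee_fin; apply: mulr_ge0; [exact: geometric_weight_ge0|exact: (fine_ge0 (y0 k))].
  rewrite (_ : \sum_(k <oo) (geometric_weight j k * (fine \o y) k)%:E =
      \sum_(0 <= k <oo) (geometric_weight j k)%:E * y k); last first.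
    by apply: eq_eseriesr => k _; rewrite EFinM fineK.
  rewrite (_ : \sum_(k <oo) (geometric_weight j k * (fine \o y) k `^ q)%:E =
      \sum_(0 <= k <oo) (geometric_weight j k)%:E * (y k) `^ q); last first.
    by apply: eq_eseriesr => k _; rewrite EFinM -poweR_EFin fineK.
  move=> /le_trans; apply; apply: lee_wpmul2r => //.
  rewrite -poweR_EFin; apply: lee_poweR.
  - by rewrite subr_ge0 ltW.
  - exact: nneseries_ge0.
  - exact: sum_geometric_weight_row.
have Sy0 : 0 <= \sum_(0 <= k <oo) y k `^ q.
  by apply: nneseries_ge0 => *; exact: poweR_ge0.
have total : \sum_(0 <= j <oo) (x j) `^ q <= (2 `^ q)%:E * \sum_(0 <= k <oo) (y k) `^ q.
  apply: (@le_trans _ _ (\sum_(0 <= j <oo) ((2 `^ (q - 1))%:E *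
      \sum_(0 <= k <oo) (geometric_weight j k)%:E * (y k) `^ q))).
    by apply: lee_nneseries => *; [exact: poweR_ge0|exact: jensen].
  rewrite nneseriesZl; last first.
    by move=> j _; apply: nneseries_ge0 => k _ _; rewrite mule_ge0// poweR_ge0.
  rewrite nneseries_interchange; last by move=> j k; rewrite mule_ge0// poweR_ge0.
  have -> : (2 `^ q)%:E = (2 `^ (q - 1))%:E * 2%:E :> \bar R.
    rewrite -EFinM -{3}(powRr1 (ler0n R 2)) -powRD ?subrK//.
    by rewrite pnatr_eq0 implybT.
  rewrite -muleA lee_wpmul2l ?lee_fin ?powR_ge0//.
  rewrite -nneseriesZl; last by move=> *; exact: poweR_ge0.
  apply: lee_nneseries => [k _ _|k _].
    by apply: nneseries_ge0 => j _ _; rewrite mule_ge0// poweR_ge0.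
  have [yk|yk] := eqVneq (y k) 0.
    by rewrite yk poweR0r ?gt_eqF// mule0 eseries0// => j _ _; rewrite mule0.
  rewrite -(fineK (fy k)) poweR_EFin.
  under eq_eseriesr do rewrite muleC.
  rewrite nneseriesZl// muleC lee_wpmul2r ?sum_geometric_weight_col//.
  by rewrite lee_fin powR_ge0.
have -> : 2%:E * (\sum_(0 <= j <oo) y j `^ q) `^ q^-1 =
    ((2 `^ q)%:E * \sum_(0 <= k <oo) (y k) `^ q) `^ q^-1.
  rewrite poweRM ?lee_fin ?powR_ge0// poweR_EFin -powRrM divff ?gt_eqF//.
  by rewrite powRr1.
apply: lee_poweR total; first by rewrite invr_ge0 ltW.
by apply: nneseries_ge0 => *; exact: poweR_ge0.
Qed.

End lq_norm.

(** * Convolution *)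

Section dominated.
Context d1 (S : measurableType d1) {R : realType} (m1 : {measure set S -> \bar R}).

Lemma integrable_dominated (F G : S -> R) : measurable_fun setT F ->
  (forall x, `|F x| <= G x) -> m1.-integrable setT (EFin \o G) ->
  m1.-integrable setT (EFin \o F).
Proof.
move=> mF FG iG; apply: (le_integrable measurableT) iG; first exact/measurable_EFinP.
by move=> x _ /=; rewrite lee_fin (le_trans (FG x))// ler_norm.
Qed.

End dominated.

Lemma measurable_abs_EFin d (T : measurableType d) {R : realType} (u : T -> R) :
  measurable_fun setT u -> measurable_fun setT (fun x => `|(u x)%:E|)%E.
Proof. by move=> mu; do 2 apply: measurableT_comp => //. Qed.

(** [m1 \x m2] has no canonical sigma-finite structure in the library. *)
Section sigma_finite_product.
Context d1 d2 (S : measurableType d1) (T : measurableType d2) {R : realType}.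
Variables (m1 : {sigma_finite_measure set S -> \bar R})
          (m2 : {sigma_finite_measure set T -> \bar R}).

Definition sigma_finite_product : set (S * T) -> \bar R := (m1 \x m2)%E.

Lemma sigma_finite_productT : sigma_finite setT sigma_finite_product.
Proof.
have /sigma_finiteP[F [TF ndF Foo]] := sigma_finiteT m1.
have /sigma_finiteP[G [TG ndG Goo]] := sigma_finiteT m2.
exists (fun k => F k `*` G k).
  rewrite -setXTT TF TG predeqE => -[x y]; split.
    move=> [/= [i _ Fix] [j _ Gjy]]; exists (maxn i j) => //; split.
      by move: x Fix; exact/subsetPset/ndF/leq_maxl.
    by move: y Gjy; exact/subsetPset/ndG/leq_maxr.
  by move=> [i _ []/= ? ?]; split; exists i.
move=> k; have [? ?] := Foo k; have [? ?] := Goo k; split; first exact: measurableX.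
by rewrite /sigma_finite_product product_measure1E// lte_mul_pinfty// ge0_fin_numE.
Qed.

HB.instance Definition _ := Measure.copy sigma_finite_product
  ((m1 \x m2)%E : {measure set (S * T) -> \bar R}).
HB.instance Definition _ := Measure_isSigmaFinite.Build _ _ _
  sigma_finite_product sigma_finite_productT.

End sigma_finite_product.

Section real_integrals.
Context d1 d2 (S : measurableType d1) (T : measurableType d2) {R : realType}.
Variables (m1 : {sigma_finite_measure set S -> \bar R})
          (m2 : {sigma_finite_measure set T -> \bar R}).

Lemma integrable_tensor (g : S -> R) (h : T -> R) :
  m1.-integrable setT (EFin \o g) -> m2.-integrable setT (EFin \o h) ->
  (m1 \x m2)%E.-integrable setT (EFin \o (fun z => g z.1 * h z.2)).
Proof.
move=> /integrableP[/measurable_EFinP mg ig] /integrableP[/measurable_EFinP mh ih].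
apply/integrable12ltyP.
  apply/measurable_EFinP; apply: measurable_funM.
    exact: (measurableT_comp mg).
  exact: (measurableT_comp mh).
have E x : (\int[m2]_y `|(EFin \o (fun z => g z.1 * h z.2)%R) (x, y)| =
    `|(g x)%:E| * \int[m2]_y `|(EFin \o h) y|)%E.
  rewrite -ge0_integralZl//; last by apply: measurableT_comp => //; exact/measurable_EFinP.
  by apply: eq_integral => y _ /=; rewrite normrM.
under eq_integral do rewrite E.
rewrite ge0_integralZr//; last 2 first.
- by apply: measurableT_comp => //; exact/measurable_EFinP.
- exact: integral_ge0.
by rewrite lte_mul_pinfty ?integral_ge0// ge0_fin_numE ?integral_ge0.
Qed.

(** A real integral is [fine] of an extended one, hence 0 when the latter is infinite. Integrability
    of every section, not of almost every one, makes all inner integrals genuine. *)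
Lemma Rintegral_fubini (F : S * T -> R) :
  (m1 \x m2)%E.-integrable setT (EFin \o F) ->
  (forall x, m2.-integrable setT (EFin \o (fun y => F (x, y)))) ->
  (forall y, m1.-integrable setT (EFin \o (fun x => F (x, y)))) ->
  \int[m1]_x (\int[m2]_y F (x, y)) = \int[m2]_y (\int[m1]_x F (x, y)).
Proof.
move=> iF i2 i1; rewrite /Rintegral; congr fine.
transitivity (\int[m1]_x \int[m2]_y (F (x, y))%:E)%E.
  by apply: eq_integral => x _; rewrite /= fineK//; exact: (integrable_fin_num measurableT (i2 x)).
rewrite (Fubini iF); apply: eq_integral => y _.
by rewrite /= fineK//; exact: (integrable_fin_num measurableT (i1 y)).
Qed.

Lemma measurable_Rintegral (F : S * T -> R) : measurable_fun setT F ->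
  measurable_fun setT (fun x => \int[m2]_y F (x, y)).
Proof.
move=> mF; have mF' : measurable_fun setT (EFin \o F) by exact/measurable_EFinP.
have mp : measurable_fun setT (fun x => \int[m2]_y ((EFin \o F)^\+ (x, y)))%E.
  apply: (measurable_fun_fubini_tonelli_F ((EFin \o F)^\+)%E) => //.
  exact: measurable_funepos.
have mn : measurable_fun setT (fun x => \int[m2]_y ((EFin \o F)^\- (x, y)))%E.
  apply: (measurable_fun_fubini_tonelli_F ((EFin \o F)^\-)%E) => //.
  exact: measurable_funeneg.
pose G x := (\int[m2]_y ((EFin \o F)^\+ (x, y)) - \int[m2]_y ((EFin \o F)^\- (x, y)))%E.
have mG : measurable_fun setT (fine \o G).
  apply: measurableT_comp; first exact: fine_measurable.
  exact: (emeasurable_funB mp mn).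
apply: eq_measurable_fun mG => x _.
rewrite /Rintegral/= [in RHS]integralE; congr (fine (_ - _)%E);
  by apply: eq_integral => y _; rewrite unlock.
Qed.

End real_integrals.

Section convolution.
Context {R : realType} (n : nat) (lam : {sigma_finite_measure set 'rV[R]_n -> \bar R}).
Hypothesis lamP : is_lebesgue lam.
Local Notation E := 'rV[R]_n.
Implicit Types (g h f : E -> R) (x y z : E).

(** An integrable kernel is always paired with a bounded measurable function: the convolution then
    converges at every point, and its algebraic laws are equalities of functions rather than
    equalities almost everywhere. *)
Definition kernel (g : E -> R) := lam.-integrable setT (EFin \o g).

Definition bounded_measurable (f : E -> R) :=
  measurable_fun setT f /\ exists M, forall x, `|f x| <= M.

Lemma kernel_measurable g : kernel g -> measurable_fun setT g.
Proof. by move=> /integrableP[/measurable_EFinP]. Qed.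

Lemma measurable_subr d (T' : measurableType d) (u v : T' -> E) :
  measurable_fun setT u -> measurable_fun setT v -> measurable_fun setT (fun t => u t - v t).
Proof.
move=> mu mv; under eq_fun do rewrite -[X in X - _]scale1r -scaleN1r.
exact: measurable_row_affine.
Qed.

Lemma measurable_addr d (T' : measurableType d) (u v : T' -> E) :
  measurable_fun setT u -> measurable_fun setT v -> measurable_fun setT (fun t => u t + v t).
Proof.
move=> mu mv; under eq_fun do rewrite -[X in X + _]scale1r -[X in _ + X]scale1r.
exact: measurable_row_affine.
Qed.

Lemma measurable_scaler (c : R) : measurable_fun setT (fun x : E => c *: x).
Proof.
have -> : (fun x : E => c *: x) = (fun x => c *: x + 0 *: x).
  by apply/funext => x; rewrite scale0r addr0.
exact: measurable_row_affine.
Qed.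

Let mshift (a : E) : measurable_fun setT (fun x : E => x + a).
Proof. exact: measurable_addr. Qed.

Let mreflect (a : E) : measurable_fun setT (fun x : E => a - x).
Proof. exact: measurable_subr. Qed.

Lemma Rintegral_reflect (a : E) (F : E -> R) : measurable_fun setT F ->
  \int[lam]_x F (a - x) = \int[lam]_x F x.
Proof.
move=> mF; have mF' : measurable_fun setT (EFin \o F) by exact/measurable_EFinP.
rewrite /Rintegral; congr fine; rewrite [LHS]integralE [RHS]integralE.
congr (_ - _)%E.
- rewrite -[RHS](integral_reflect lamP a (measurable_funepos mF') (fun x => funepos_ge0 _ x)).
  by apply: eq_integral => x _; rewrite unlock.
- rewrite -[RHS](integral_reflect lamP a (measurable_funeneg mF') (fun x => funeneg_ge0 _ x)).
  by apply: eq_integral => x _; rewrite unlock.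
Qed.

Lemma Rintegral_shift (a : E) (F : E -> R) : measurable_fun setT F ->
  \int[lam]_x F (x + a) = \int[lam]_x F x.
Proof.
move=> mF; have mF' : measurable_fun setT (EFin \o F) by exact/measurable_EFinP.
rewrite /Rintegral; congr fine; rewrite [LHS]integralE [RHS]integralE.
congr (_ - _)%E.
- rewrite -[RHS](integral_shift lamP a (measurable_funepos mF') (fun x => funepos_ge0 _ x)).
  by apply: eq_integral => x _; rewrite unlock.
- rewrite -[RHS](integral_shift lamP a (measurable_funeneg mF') (fun x => funeneg_ge0 _ x)).
  by apply: eq_integral => x _; rewrite unlock.
Qed.

Lemma kernel_shift (a : E) g : kernel g -> kernel (fun x => g (x + a)).
Proof.
move=> /[dup] /kernel_measurable mg /integrableP[mg' ig]; apply/integrableP; split.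
  by apply/measurable_EFinP; exact: (measurableT_comp mg).
rewrite (integral_shift lamP a (F := fun x => `|(g x)%:E|%E))//.
exact: measurableT_comp.
Qed.

Lemma convolutionE g f x : measurable_fun setT g -> measurable_fun setT f ->
  convolution g f x = \int[lam]_z (g z * f (x - z)).
Proof.
move=> mg mf.
have mgf : measurable_fun setT (fun y : E => g (x - y) * f y).
  by apply: measurable_funM => //; exact: (measurableT_comp mg).
rewrite /convolution /Rintegral_Rd (lebesgue_integralE lamP); last exact/measurable_EFinP.
rewrite -/(Rintegral lam setT (fun y => g (x - y) * f y)) -(Rintegral_reflect x mgf).
by apply: eq_Rintegral => y _; rewrite subKr.
Qed.

Lemma Rintegral_RdE f : measurable_fun setT f -> Rintegral_Rd f = \int[lam]_x f x.
Proof.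
by move=> mf; rewrite /Rintegral_Rd (lebesgue_integralE lamP)//; exact/measurable_EFinP.
Qed.

Lemma kernel_mul_bounded g f : kernel g -> bounded_measurable f ->
  kernel (fun z => g z * f z).
Proof.
move=> kg [mf [M fM]]; have mg := kernel_measurable kg.
apply: (@integrable_dominated _ _ _ lam _ (fun z => M * `|g z|)).
- exact: measurable_funM.
- by move=> z; rewrite normrM mulrC ler_wpM2r.
- apply: (eq_integrable measurableT (fun z => M%:E * `|(EFin \o g) z|)%E).
    by move=> z _.
  apply: integrableZl => //; exact: integrable_abse.
Qed.

Lemma bounded_measurable_reflect f x : bounded_measurable f ->
  bounded_measurable (fun z => f (x - z)).
Proof.
move=> [mf [M fM]]; split; last by exists M => z.
exact: (measurableT_comp mf).
Qed.

Lemma kernel_conv g f x : kernel g -> bounded_measurable f ->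
  kernel (fun z => g z * f (x - z)).
Proof. by move=> kg bf; apply: kernel_mul_bounded => //; exact: bounded_measurable_reflect. Qed.

Lemma bounded_convolution g f : kernel g -> bounded_measurable f ->
  bounded_measurable (convolution g f).
Proof.
move=> kg bf; have mg := kernel_measurable kg; have [mf [M fM]] := bf.
have convE : convolution g f = fun x => \int[lam]_z (g z * f (x - z)).
  by apply/funext => x; exact: convolutionE.
split.
  rewrite convE; apply: (measurable_Rintegral lam (F := fun z : E * E => g z.2 * f (z.1 - z.2))).
  apply: measurable_funM; first exact: (measurableT_comp mg).
  by apply: (measurableT_comp mf); exact: measurable_subr.
exists (\int[lam]_z (M * `|g z|)) => x; rewrite convE.
have iMg : lam.-integrable setT (EFin \o (fun z => M * `|g z|)).
  apply: (eq_integrable measurableT (fun z => M%:E * `|(EFin \o g) z|)%E).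
    by move=> z _.
  by apply: integrableZl => //; exact: integrable_abse.
apply: (le_trans (le_normr_Rintegral measurableT (kernel_conv x kg bf))).
apply: le_Rintegral => //.
  exact: (integrable_abse (kernel_conv x kg bf)).
by move=> z _; rewrite normrM mulrC ler_wpM2r.
Qed.

Lemma bounded_measurableD f1 f2 : bounded_measurable f1 -> bounded_measurable f2 ->
  bounded_measurable (f1 + f2).
Proof.
move=> [m1 [M1 b1]] [m2 [M2 b2]]; split; first exact: measurable_funD.
by exists (M1 + M2) => x; apply: (le_trans (ler_normD _ _)); exact: lerD.
Qed.

Lemma bounded_measurableZ (c : R) f : bounded_measurable f ->
  bounded_measurable (c *: f).
Proof.
move=> [mf [M fM]]; split; first exact: measurable_funM.
by exists (`|c| * M) => x; rewrite normrM ler_wpM2l.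
Qed.

Lemma convolutionDr g f1 f2 : kernel g -> bounded_measurable f1 -> bounded_measurable f2 ->
  convolution g (f1 + f2) = convolution g f1 + convolution g f2.
Proof.
move=> kg b1 b2; have mg := kernel_measurable kg.
apply/funext => x; rewrite /GRing.add/=.
rewrite !convolutionE//; [|exact: b2.1|exact: b1.1|exact: (bounded_measurableD b1 b2).1].
rewrite -RintegralD//; [|exact: kernel_conv|exact: kernel_conv].
by apply: eq_Rintegral => z _; rewrite -mulrDr.
Qed.

Lemma convolutionZr g (c : R) f : kernel g -> bounded_measurable f ->
  convolution g (c *: f) = c *: convolution g f.
Proof.
move=> kg bf; have mg := kernel_measurable kg.
apply/funext => x; rewrite [RHS](_ : _ = c * convolution g f x)//.
rewrite !convolutionE//; [|exact: bf.1|exact: (bounded_measurableZ c bf).1].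
rewrite -RintegralZl//; last exact: kernel_conv.
by apply: eq_Rintegral => z _; rewrite mulrCA.
Qed.

Lemma kernelD g1 g2 : kernel g1 -> kernel g2 -> kernel (g1 + g2).
Proof. by move=> k1 k2; exact: (integrableD measurableT k1 k2). Qed.

Lemma kernelZ (c : R) g : kernel g -> kernel (c *: g).
Proof. by move=> kg; exact: (integrableZl measurableT c kg). Qed.

Lemma convolutionDl g1 g2 f : kernel g1 -> kernel g2 -> bounded_measurable f ->
  convolution (g1 + g2) f = convolution g1 f + convolution g2 f.
Proof.
move=> k1 k2 bf; have [m1 m2] := (kernel_measurable k1, kernel_measurable k2).
have m12 := kernel_measurable (kernelD k1 k2).
apply/funext => x; rewrite [RHS]/GRing.add/= !convolutionE//; try exact: bf.1.
rewrite -RintegralD//; [|exact: kernel_conv|exact: kernel_conv].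
by apply: eq_Rintegral => z _; rewrite -mulrDl.
Qed.

Lemma convolutionZl (c : R) g f : kernel g -> bounded_measurable f ->
  convolution (c *: g) f = c *: convolution g f.
Proof.
move=> kg bf; have mg := kernel_measurable kg.
have mcg := kernel_measurable (kernelZ c kg).
apply/funext => x; rewrite [RHS](_ : _ = c * convolution g f x)// !convolutionE//; try exact: bf.1.
rewrite -RintegralZl//; last exact: kernel_conv.
by apply: eq_Rintegral => z _; rewrite mulrA.
Qed.

Lemma integrable_convolution2 g h f x : kernel g -> kernel h -> bounded_measurable f ->
  (lam \x lam)%E.-integrable setT
    (EFin \o (fun z : E * E => g z.1 * (h z.2 * f (x - z.1 - z.2)))).
Proof.
move=> kg kh [mf [M fM]]; have [mg mh] := (kernel_measurable kg, kernel_measurable kh).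
have iG : (lam \x lam)%E.-integrable setT
    (EFin \o (fun z : E * E => M * (`|g z.1| * `|h z.2|))).
  apply: (integrableZl measurableT M (f := EFin \o (fun z : E * E => `|g z.1| * `|h z.2|))).
  apply: (integrable_tensor (g := fun z => `|g z|) (h := fun z => `|h z|)).
    exact: (integrable_abse kg).
  exact: (integrable_abse kh).
apply: (@integrable_dominated _ (E * E)%type R (lam \x lam)%E _ _ _ _ iG).
  apply: measurable_funM; first exact: (measurableT_comp mg).
  apply: measurable_funM; first exact: (measurableT_comp mh).
  apply: (measurableT_comp mf); apply: measurable_subr => //.
  by apply: measurable_subr.
by move=> z; rewrite !normrM mulrA mulrC ler_wpM2r// mulr_ge0.
Qed.

(** Two kernels are exchanged without forming their convolution, so both may be unbounded, as the
    wave kernel is in dimension 2. *)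
Lemma convolutionAC g h f : kernel g -> kernel h -> bounded_measurable f ->
  convolution g (convolution h f) = convolution h (convolution g f).
Proof.
move=> kg kh bf; have [mg mh] := (kernel_measurable kg, kernel_measurable kh).
apply/funext => x.
have bgf := bounded_convolution kg bf; have bhf := bounded_convolution kh bf.
rewrite (convolutionE x mg bhf.1) (convolutionE x mh bgf.1).
transitivity (\int[lam]_z (\int[lam]_w (g z * (h w * f (x - z - w))))).
  apply: eq_Rintegral => z _; rewrite (convolutionE _ mh bf.1) RintegralZl//.
  exact: kernel_conv.
rewrite (Rintegral_fubini (F := fun z : E * E => g z.1 * (h z.2 * f (x - z.1 - z.2)))).
- apply: eq_Rintegral => w _; rewrite (convolutionE _ mg bf.1) -RintegralZl//; last exact: kernel_conv.
  by apply: eq_Rintegral => z _ /=; rewrite mulrCA addrAC.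
- exact: integrable_convolution2.
- move=> z; have := kernel_conv (x - z) kh bf => /(kernelZ (g z)).
  exact: (eq_integrable measurableT).
- move=> w; have := kernel_conv (x - w) kg bf => /(kernelZ (h w)).
  apply: (eq_integrable measurableT) => z _.
  by rewrite /= /GRing.scale/= mulrCA addrAC.
Qed.

(** Boundedness of [h] makes the convolution of the two kernels finite at every point; in the
    application [h] is a low-pass filter. *)
Lemma kernel_convolution g h : kernel g -> kernel h -> bounded_measurable h ->
  kernel (convolution g h) /\
  (\int[lam]_x `|(convolution g h x)%:E| <=
   (\int[lam]_x `|(g x)%:E|) * (\int[lam]_x `|(h x)%:E|))%E.
Proof.
move=> kg kh bh; have [mg mh] := (kernel_measurable kg, kernel_measurable kh).
have mgh := (bounded_convolution kg bh).1.
pose F (z : E * E) := (`|(g z.2 * h (z.1 - z.2))%:E|)%E.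
have F0 (z : E * E) : (0 <= F z)%E by exact: abse_ge0.
have mF : measurable_fun setT F.
  apply: measurableT_comp => //; apply/measurable_EFinP; apply: measurable_funM.
    exact: (measurableT_comp mg).
  by apply: (measurableT_comp mh); exact: measurable_subr.
have i0 (u : E -> R) : (0 <= \int[lam]_x `|(u x)%:E|)%E by exact: integral_ge0.
have mabs := measurable_abs_EFin mgh.
have le1 : (\int[lam]_x `|(convolution g h x)%:E| <=
   (\int[lam]_x `|(g x)%:E|) * (\int[lam]_x `|(h x)%:E|))%E.
  apply: (@le_trans _ _ (\int[lam]_x \int[lam]_z F (x, z))%E).
    apply: ge0_le_integral => //.
    - exact: (measurable_fun_fubini_tonelli_F F).
    move=> x _; rewrite (convolutionE x mg mh).
    have kc := kernel_conv x kg bh.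
    rewrite [X in (X <= _)%E](EFin_normr_Rintegral measurableT kc).
    by apply: le_abse_integral => //; exact: (measurable_int lam kc).
  rewrite (fubini_tonelli F)// -ge0_integralZr//; last exact: measurable_abs_EFin.
  apply: ge0_le_integral => //.
  - by move=> z _; exact: integral_ge0.
  - exact: (measurable_fun_fubini_tonelli_G F).
  - by apply: emeasurable_funM => //; exact: measurable_abs_EFin.
  move=> z _; rewrite -(integral_shift lamP (- z) (F := fun x => `|(h x)%:E|%E))//; last first.
    exact: measurable_abs_EFin.
  rewrite -ge0_integralZl//; last first.
    exact: measurable_abs_EFin (kernel_measurable (kernel_shift (- z) kh)).
  rewrite le_eqVlt; apply/orP; left; apply/eqP; apply: eq_integral => x _.
  by rewrite /F/= normrM EFinM.
split => //; apply/integrableP; split; first exact/measurable_EFinP.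
apply: le_lt_trans le1 _.
have /integrableP[_ ig] := kg; have /integrableP[_ ih] := kh.
by rewrite lte_mul_pinfty// ge0_fin_numE.
Qed.

(** Supplies the dominating function for Fubini in [convolutionA]. *)
Lemma integrable_shear g h : kernel g -> kernel h ->
  (lam \x lam)%E.-integrable setT (EFin \o (fun z : E * E => g z.1 * h (z.2 - z.1))).
Proof.
move=> kg kh; have [mg mh] := (kernel_measurable kg, kernel_measurable kh).
apply/integrable12ltyP.
  apply/measurable_EFinP; apply: measurable_funM; first exact: (measurableT_comp mg).
  by apply: (measurableT_comp mh); exact: measurable_subr.
have i0 : (0 <= \int[lam]_x `|(h x)%:E|)%E by exact: integral_ge0.
have E1 x : (\int[lam]_y `|(EFin \o (fun z : E * E => g z.1 * h (z.2 - z.1))%R) (x, y)| =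
    `|(g x)%:E| * \int[lam]_y `|(h y)%:E|)%E.
  rewrite -(integral_shift lamP (- x) (F := fun x => `|(h x)%:E|%E))//; last first.
    exact: measurable_abs_EFin.
  rewrite -ge0_integralZl//; last first.
    exact: measurable_abs_EFin (kernel_measurable (kernel_shift (- x) kh)).
  by apply: eq_integral => y _ /=; rewrite normrM EFinM.
under eq_integral do rewrite E1.
have /integrableP[_ ig] := kg; have /integrableP[_ ih] := kh.
rewrite ge0_integralZr//; last exact: measurable_abs_EFin.
by rewrite lte_mul_pinfty ?integral_ge0// ge0_fin_numE ?integral_ge0.
Qed.

Lemma convolutionA g h f : kernel g -> kernel h -> bounded_measurable h -> bounded_measurable f ->
  convolution g (convolution h f) = convolution (convolution g h) f.
Proof.
move=> kg kh bh bf; have [mg mh] := (kernel_measurable kg, kernel_measurable kh).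
have [kgh _] := kernel_convolution kg kh bh.
apply/funext => x.
have bhf := bounded_convolution kh bf.
rewrite (convolutionE x mg bhf.1) (convolutionE x (kernel_measurable kgh) bf.1).
have mf := bf.1.
transitivity (\int[lam]_z (\int[lam]_u (g z * (h (u - z) * f (x - u))))).
  apply: eq_Rintegral => z _; rewrite (convolutionE _ mh bf.1).
  have khz : kernel (fun u => h (u - z) * f (x - u)).
    by apply: kernel_mul_bounded (bounded_measurable_reflect x bf); exact: kernel_shift.
  rewrite RintegralZl//; congr (_ * _).
  rewrite -(Rintegral_shift (- z)); last exact: kernel_measurable (kernel_conv (x - z) kh bf).
  by apply: eq_Rintegral => u _; rewrite opprB addrA subrK.
rewrite (Rintegral_fubini (F := fun z : E * E => g z.1 * (h (z.2 - z.1) * f (x - z.2)))).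
- apply: eq_Rintegral => u _; rewrite (convolutionE _ mg mh) -RintegralZr//; last exact: kernel_conv.
  by apply: eq_Rintegral => z _ /=; rewrite mulrA.
- have [_ [M fM]] := bf.
  have iG := integrable_abse (integrable_shear kg kh).
  have := integrableZl measurableT M iG.
  apply: (@integrable_dominated _ (E * E)%type R (lam \x lam)%E).
    apply: measurable_funM; first exact: (measurableT_comp mg).
    apply: measurable_funM; first by apply: (measurableT_comp mh); exact: measurable_subr.
    by apply: (measurableT_comp mf); exact: measurable_subr.
  by move=> z /=; rewrite !normrM mulrA mulrC ler_wpM2r// mulr_ge0.
- move=> z.
  have khz : kernel (fun u => h (u - z) * f (x - u)).
    by apply: kernel_mul_bounded (bounded_measurable_reflect x bf); exact: kernel_shift.
  have := kernelZ (g z) khz; exact: (eq_integrable measurableT).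
- move=> u; have := kernelZ (f (x - u)) (kernel_conv u kg bh).
  apply: (eq_integrable measurableT) => z _; congr (_%:E).
  by rewrite [LHS](_ : _ = f (x - u) * (g z * h (u - z)))// mulrC mulrA.
Qed.

End convolution.

(** * Young's inequality and the smoothing estimate for kernels *)

Section kernel_bounds.
Context {R : realType} (n : nat) (lam : {sigma_finite_measure set 'rV[R]_n -> \bar R}).
Hypothesis lamP : is_lebesgue lam.
Local Notation E := 'rV[R]_n.
Implicit Types (g h f a : E -> R) (x y z : E).
Local Notation kernel := (kernel lam).

Lemma normr_Rintegral_le d (T : measurableType d) (m : {measure set T -> \bar R}) (u : T -> R) :
  m.-integrable setT (EFin \o u) ->
  (`|\int[m]_x u x|%:E <= \int[m]_x `|u x|%:E)%E.
Proof.
move=> iu; rewrite (EFin_normr_Rintegral measurableT iu).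
exact: (le_abse_integral m measurableT (measurable_int m iu)).
Qed.

Lemma young_convolution (mu p r : R) g f : 1 < p -> 0 <= mu -> 0 <= r ->
  kernel g -> bounded_measurable f -> (forall z, g z != 0 -> enorm z <= r) ->
  (weighted_Lp_norm mu p (convolution g f) <=
   (expR (mu * r))%:E * (\int[lam]_z `|g z|%:E) * weighted_Lp_norm mu p f)%E.
Proof.
move=> p1 mu0 r0 kg bf gr; have mg := kernel_measurable kg.
apply: (@weighted_young _ _ _ lamP _ E lam (fun z => `|g z|) id) => //.
- exact: measurableT_comp.
- exact: bf.1.
- exact: (bounded_convolution lamP kg bf).1.
- by move=> z; rewrite normr_eq0; exact: gr.
move=> x; rewrite (convolutionE lamP x mg bf.1).
apply: (le_trans (normr_Rintegral_le (kernel_conv x kg bf))).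
rewrite le_eqVlt; apply/orP; left; apply/eqP.
by apply: eq_integral => z _; rewrite normrM.
Qed.

(** [G * Th * a - (int Th) G * a] is a superposition of the functions
    [(tau_y G - G) * a], so that the L^1 modulus of continuity of [G] controls it. *)
Lemma smoothing_convolution (mu p r t A s : R) (G Th : E -> R) a :
  1 < p -> 0 <= mu -> 0 <= r -> 0 <= t -> 0 <= A -> 0 <= s ->
  kernel G -> (forall z, G z != 0 -> enorm z <= t) ->
  (forall y, (\int[lam]_z `|G (z - y)%R - G z|%:E <= (A * enorm y `^ s)%:E)%E) ->
  kernel Th -> (forall y, Th y != 0 -> enorm y <= r) -> bounded_measurable a ->
  (weighted_Lp_norm mu p
     (convolution G (convolution Th a) - (\int[lam]_y Th y) *: convolution G a)%R <=
   (expR (mu * (t + r)))%:E * ((A * r `^ s)%:E * \int[lam]_y `|Th y|%:E) *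
   weighted_Lp_norm mu p a)%E.
Proof.
move=> p1 mu0 r0 t0 A0 s0 kG Gt modG kTh Thr ba.
have [mG mTh] := (kernel_measurable kG, kernel_measurable kTh).
have bGa := bounded_convolution lamP kG ba.
have bTa := bounded_convolution lamP kTh ba.
have ma := ba.1.
set c := (X in weighted_Lp_norm _ _ X).
have mc : measurable_fun setT c.
  apply: measurable_funB; first exact: (bounded_convolution lamP kG bTa).1.
  by apply: measurable_funM => //; exact: bGa.1.
(* The translates are indexed by pairs (y, z): [c] is bounded by a superposition of the a(x - z)
   with weight |Th y| |G (z - y) - G z|, which vanishes unless |z| <= t + r. Integrating the weight
   in z first brings in the modulus of [G]. *)
pose nu : {sigma_finite_measure set (E * E)%type -> \bar R} := sigma_finite_product lam lam.
pose K (z : E * E) := `|Th z.1| * `|G (z.2 - z.1) - G z.2|.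
have mDG : measurable_fun setT (fun z : E * E => G (z.2 - z.1) - G z.2).
  apply: measurable_funB; last exact: (measurableT_comp mG).
  by apply: (measurableT_comp mG); exact: measurable_subr.
have mK : measurable_fun setT K.
  apply: measurable_funM; last exact: measurableT_comp.
  by apply: measurableT_comp => //; exact: (measurableT_comp mTh).
have K0 (z : E * E) : 0 <= K z by rewrite mulr_ge0.
have Kt (z : E * E) : K z != 0 -> enorm z.2 <= t + r.
  rewrite mulf_eq0 !normr_eq0 negb_or => /andP[/Thr yr dG].
  have [G0|/Gt] := eqVneq (G z.2) 0; last by move=> /le_trans; apply; rewrite lerDl.
  move: dG; rewrite G0 subr0 => /Gt zt.
  by rewrite -(subrK z.1 z.2) (le_trans (ler_enormD _ _))// lerD.
have mabsa x : measurable_fun setT (fun z : E * E => K z * `|a (x - z.2)|).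
  apply: measurable_funM => //; apply: measurableT_comp => //.
  by apply: (measurableT_comp ma); exact: measurable_subr.
have diff x y : convolution G a (x - y) - convolution G a x =
    \int[lam]_z ((G (z - y) - G z) * a (x - z)).
  rewrite !(convolutionE lamP _ mG ma).
  have k1 := kernel_conv (x - y) kG ba.
  rewrite -(Rintegral_shift lamP (- y) (kernel_measurable k1)).
  have k2 := kernel_shift lamP (- y) k1.
  rewrite -RintegralB//; last exact: kernel_conv.
  apply: eq_Rintegral => z _; rewrite mulrBl; congr (_ * a _ - _).
  by rewrite opprB addrA subrK.
have kdiff x y : kernel (fun z => (G (z - y) - G z) * a (x - z)).
  apply: kernel_mul_bounded; last exact: bounded_measurable_reflect.
  exact: (integrableB measurableT (kernel_shift lamP (- y) kG) kG).
have cE x : c x = \int[lam]_y (Th y * (convolution G a (x - y) - convolution G a x)).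
  rewrite /c (convolutionAC lamP kG kTh ba) [LHS](_ : _ = convolution Th (convolution G a) x -
    (\int[lam]_y Th y) * convolution G a x)//.
  rewrite (convolutionE lamP x mTh bGa.1) -RintegralZr//.
  rewrite -RintegralB//.
  - by apply: eq_Rintegral => y _; rewrite mulrBr.
  - exact: (kernel_conv x kTh bGa).
  - have := integrableZl measurableT (convolution G a x) kTh.
    by apply: (eq_integrable measurableT) => y _ /=; rewrite mulrC.
have kc x : kernel (fun y => Th y * (convolution G a (x - y) - convolution G a x)).
  apply: kernel_mul_bounded => //.
  apply: (bounded_measurableD (f1 := fun y => convolution G a (x - y))).
    exact: bounded_measurable_reflect.
  by split; [exact: measurable_cst|exists `|convolution G a x| => y; rewrite normrN].
have cle x : (`|c x|%:E <= \int[nu]_o (K o * `|a (x - o.2)|)%:E)%E.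
  rewrite cE; apply: (le_trans (normr_Rintegral_le (kc x))).
  have mF : measurable_fun setT (EFin \o (fun z : E * E => K z * `|a (x - z.2)|)).
    exact/measurable_EFinP.
  have F0 (z : E * E) : (0 <= (EFin \o (fun z : E * E => K z * `|a (x - z.2)|)%R) z)%E.
    by rewrite lee_fin mulr_ge0.
  rewrite /nu/= /sigma_finite_product (fubini_tonelli1 _ mF F0).
  apply: ge0_le_integral.
  - exact: measurableT.
  - by move=> y _; rewrite lee_fin.
  - by apply/measurable_EFinP; apply: measurableT_comp => //; exact: kernel_measurable (kc x).
  - exact: (measurable_fun_fubini_tonelli_F _ mF F0).
  move=> y _; rewrite diff normrM EFinM.
  apply: (@le_trans _ _ (`|Th y|%:E * \int[lam]_z `|(G (z - y) - G z) * a (x - z)|%:E)%E).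
    by apply: lee_wpmul2l; [rewrite lee_fin|exact: normr_Rintegral_le (kdiff x y)].
  rewrite -ge0_integralZl//; last first.
    by apply/measurable_EFinP; apply: measurableT_comp => //; exact: kernel_measurable (kdiff x y).
  rewrite le_eqVlt; apply/orP; left; apply/eqP.
  by apply: eq_integral => z _; rewrite /K/= -EFinM normrM mulrA.
have intK : (\int[nu]_o (K o)%:E <= (A * r `^ s)%:E * \int[lam]_y `|Th y|%:E)%E.
  have mF : measurable_fun setT (EFin \o K) by exact/measurable_EFinP.
  have F0 (z : E * E) : (0 <= (EFin \o K) z)%E by rewrite lee_fin.
  rewrite /nu/= /sigma_finite_product (fubini_tonelli1 _ mF F0).
  have As0 : 0 <= A * r `^ s by rewrite mulr_ge0// powR_ge0.
  have mT : measurable_fun setT (fun y => `|Th y|%:E).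
    by apply/measurable_EFinP; exact: measurableT_comp.
  have T0 y : setT y -> (0 <= `|Th y|%:E)%E by move=> _; rewrite lee_fin.
  rewrite -(ge0_integralZl_EFin lam measurableT T0 mT As0).
  apply: ge0_le_integral.
  - exact: measurableT.
  - by move=> y _; apply: integral_ge0 => z _; rewrite lee_fin.
  - exact: (measurable_fun_fubini_tonelli_F _ mF F0).
  - exact: (measurable_funeM _ mT).
  move=> y _; rewrite /fubini_F; have [Ty|Ty] := eqVneq (Th y) 0.
    rewrite integral0_eq ?Ty ?normr0 ?mule0// => z _.
    by rewrite /K/= Ty normr0 mul0r.
  apply: (@le_trans _ _ (`|Th y|%:E * \int[lam]_z `|G (z - y)%R - G z|%:E)%E).
    rewrite -ge0_integralZl//; last first.
      by apply/measurable_EFinP; apply: measurableT_comp => //; exact: (measurable_fun_pair2 y mDG).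
  rewrite muleC lee_wpmul2r ?lee_fin//; apply: (le_trans (modG y)).
  by rewrite lee_fin ler_wpM2l// ge0_ler_powR ?nnegrE ?enorm_ge0// Thr.
apply: (@le_trans _ _ ((expR (mu * (t + r)))%:E * (\int[nu]_o (K o)%:E) *
    weighted_Lp_norm mu p a)%E).
  apply: (@weighted_young _ _ _ lamP _ (E * E)%type nu K snd) => //.
  by rewrite addr_ge0.
apply: lee_wpmul2r; first exact: poweR_ge0.
by apply: lee_wpmul2l; rewrite ?lee_fin ?expR_ge0.
Qed.

End kernel_bounds.

(** * Test functions *)

Section differentiability.
Context {R : realType} (n : nat).
Local Notation E := 'rV[R]_n.
Local Notation "''d_' i f" := ('D_(delta_mx 0 i) f) (at level 10, i at next level, f at next level).
Implicit Types (f : E -> R) (x h : E).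

Lemma ler_enorm_norm x : enorm x <= n%:R * `|x|.
Proof.
have xi i : `|x 0 i| <= `|x|.
  by rewrite [leRHS]/Num.norm/= mx_normrE; exact: (le_bigmax _ (fun ij => `|x ij.1 ij.2|) (0, i)).
have [n0|n0] := posnP n.
  by rewrite /enorm big1 ?sqrtr0 ?mulr_ge0// => i _; have := ltn_ord i; rewrite {2}n0.
rewrite -(@ler_pXn2r _ 2) ?nnegrE ?enorm_ge0 ?mulr_ge0// sqr_enorm.
apply: (@le_trans _ _ (\sum_(i < n) `|x| ^+ 2)).
  by apply: ler_sum => i _; rewrite -real_normK ?num_real// lerXn2r ?nnegrE.
rewrite sumr_const card_ord -[leLHS]mulr_natl exprMn ler_wpM2r ?sqr_ge0//.
by rewrite -natrX ler_nat -{1}(expn1 n) leq_pexp2l.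
Qed.

Lemma derive_rowE f x h : differentiable f x ->
  'D_h f x = \sum_(i < n) h 0 i * 'd_i f x.
Proof.
move=> df; rewrite deriveE// {1}(row_sum_delta h) linear_sum.
by apply: eq_bigr => i _; rewrite linearZ/= deriveE.
Qed.

Lemma line_is_derive f x h (s : R) : differentiable f (x + s *: h) ->
  is_derive s 1 (fun s => f (x + s *: h)) (\sum_(i < n) h 0 i * 'd_i f (x + s *: h)).
Proof.
move=> df; rewrite -derive_rowE//.
have E1 : (fun k : R => k^-1 *: (((fun s => f (x + s *: h)) \o shift s) (k *: 1) - f (x + s *: h))) =
    (fun k => k^-1 *: ((f \o shift (x + s *: h)) (k *: h) - f (x + s *: h))).
  apply/funext => k /=; congr (_ *: (f _ - _)).
  by rewrite [k *: 1]mulr1 scalerDl addrCA.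
have dv : derivable f (x + s *: h) h by exact: diff_derivable.
by split; rewrite /derivable/derive E1.
Qed.

Lemma line_MVT f x h : (forall y, differentiable f y) ->
  exists2 s : R, 0 <= s <= 1 & f (x + h) - f x = \sum_(i < n) h 0 i * 'd_i f (x + s *: h).
Proof.
move=> df; pose g (s : R) := f (x + s *: h).
have dg (s : R) : is_derive s 1 g (\sum_(i < n) h 0 i * 'd_i f (x + s *: h)).
  exact: line_is_derive.
have cg : {within `[0, 1], continuous g}.
  apply: continuous_subspaceT => s; apply: differentiable_continuous.
  by apply/derivable1_diffP; have [] := dg s.
have [s s01] := MVT ltr01 (fun s _ => dg s) cg.
rewrite /g scale1r scale0r addr0 subr0 mulr1 => ->; exists s => //.
by move: s01; rewrite in_itv/= => /andP[/ltW -> /ltW ->].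
Qed.

(** A linear approximation with quadratic error identifies the differential. For convolutions this
    replaces differentiation under the integral sign. *)
Lemma quadratic_differentiable f x (c : 'I_n -> R) (C : R) :
  (forall h, `|f (x + h) - f x - \sum_(i < n) h 0 i * c i| <= C * enorm h ^+ 2) ->
  differentiable f x /\ forall i, 'd_i f x = c i.
Proof.
move=> fC; pose d (h : E) : R := \sum_(i < n) h 0 i * c i.
have lind : linear d.
  move=> k u v; rewrite /d scaler_sumr -big_split/=; apply: eq_bigr => i _.
  by rewrite !mxE mulrDl -mulrA.
pose dM := GRing.isLinear.Build _ _ _ _ _ lind.
pose dL : {linear _ -> _} := HB.pack d dM.
have dc : continuous dL.
  apply: (@continuous_big R 'I_n +%R 0 xpredT _ E _ (fun i h => h 0 i * c i)) => [|i _ u].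
    exact: add_continuous.
  apply: (@continuousM R E (fun h : E => h 0 i) (fun=> c i) u).
    exact: (@coord_continuous R 1 n 0 i u).
  exact: cst_continuous.
have dE := @diff_unique R E R f dL x dc.
match type of dE with ?P -> _ => have o : P end.
  apply/eqaddoP => _/posnumP[e].
  (* The factor n^2 converts the Euclidean norm into the sup norm of the library; adding 1 allows
     division by [D]. *)
  pose D := `|C| * n%:R ^+ 2 + 1; have D0 : 0 < D by rewrite ltr_wpDl// mulr_ge0 ?sqr_ge0.
  near=> h; rewrite -[X in `|X|]/(f (h + x) - (f x + d h)) opprD addrA (addrC h).
  apply: (le_trans (fC h)); apply: (@le_trans _ _ (D * `|h| ^+ 2)).
    apply: (@le_trans _ _ (`|C| * (n%:R * `|h|) ^+ 2)).
      apply: (@le_trans _ _ (`|C| * enorm h ^+ 2)).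
        by rewrite ler_wpM2r ?sqr_ge0// ler_norm.
      by rewrite ler_wpM2l// lerXn2r ?nnegrE ?enorm_ge0 ?mulr_ge0// ler_enorm_norm.
    by rewrite exprMn mulrA ler_wpM2r ?sqr_ge0// lerDl.
  rewrite expr2 mulrA ler_wpM2r// mulrC -ler_pdivlMr//.
  near: h; apply/nbhs_ballP; exists (e%:num / D) => /=; first by rewrite divr_gt0.
  by move=> h; rewrite mx_norm_ball /ball_/= sub0r normrN => /ltW.
have {}dE := dE o; have df : differentiable f x by apply/diff_locallyP; rewrite dE.
split=> // i; rewrite deriveE// dE /dL/= /d (bigD1 i)//= mxE !eqxx mul1r.
rewrite big1 ?addr0// => j ji; rewrite mxE (negbTE ji) andbF mul0r//.
Unshelve. all: by end_near. Qed.

End differentiability.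

Section test_functions.
Context {R : realType} (n : nat).
Local Notation E := 'rV[R]_n.
Local Notation "''d_' i f" := ('D_(delta_mx 0 i) f) (at level 10, i at next level, f at next level).
Implicit Types (f g : E -> R) (x h : E).

Lemma compact_support f : (exists A : R, forall x, f x != 0 -> enorm x <= A) ->
  compact (closure [set x | f x != 0]).
Proof.
move=> [A fA].
have c : compact [set x : E | forall i, `[- A, A]%classic (x 0 i)].
  apply: (@rV_compact R n (fun=> `[- A, A]%classic)) => i; exact: segment_compact.
apply: (subclosed_compact _ c); first exact: closed_closure.
have cl := compact_closed (@norm_hausdorff R E) c.
rewrite [X in _ `<=` X]((closure_id _).1 cl).
apply: closureS => x /fA xA i /=; rewrite in_itv/= -ler_norml.
exact: le_trans (ler_enorm_coord x i) xA.
Qed.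

Lemma test_function_support f : test_function f ->
  exists2 A : R, 0 <= A & forall x, f x != 0 -> enorm x <= A.
Proof.
move=> [_ /compact_bounded[M [Mr fM]]].
exists (n%:R * (`|M| + 1)); first by rewrite mulr_ge0// addr_ge0.
move=> x fx; apply: (le_trans (ler_enorm_norm x)); rewrite ler_wpM2l//.
apply: (fM (`|M| + 1)); first by rewrite (le_lt_trans (ler_norm M))// ltrDl.
exact: subset_closure.
Qed.

Lemma test_function_differentiable f : test_function f -> forall x, differentiable f x.
Proof. by move=> [sf _] x; exact: (sf [::]). Qed.

Lemma test_function_continuous f : test_function f -> continuous f.
Proof. by move=> tf x; apply/differentiable_continuous/test_function_differentiable. Qed.

Lemma test_function_derive f i : test_function f -> test_function ('d_i f).
Proof.
move=> [sf cf]; split.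
  by move=> s x; have := sf (s ++ [:: i]) x; rewrite /partials foldr_cat.
apply: (subclosed_compact _ cf); first exact: closed_closure.
rewrite [X in _ `<=` X]((closure_id _).1 (@closed_closure _ _)).
apply: closureS => x /=; apply: contra_neqP => xf.
rewrite (near_eq_derive (g := cst 0)) ?derive_cst//.
have := open_nbhs_nbhs (conj (closed_openC (@closed_closure _ [set x | f x != 0])) xf).
apply: filterS => y yf; apply/eqP; apply: contra_notT yf => fy.
exact: subset_closure.
Qed.

Lemma test_function_bounded f : test_function f -> exists2 M : R, 0 <= M & forall x, `|f x| <= M.
Proof.
move=> tf; have [sf cf] := tf.
have := continuous_compact (continuous_subspaceT (test_function_continuous tf)) cf.
move=> /compact_bounded[M [Mr fM]]; exists (`|M| + 1); first by rewrite addr_ge0.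
move=> x; have [->|fx] := eqVneq (f x) 0; first by rewrite normr0 addr_ge0.
apply: (fM (`|M| + 1)); first by rewrite (le_lt_trans (ler_norm M))// ltrDl.
by exists x => //; exact: subset_closure.
Qed.

Lemma test_function_lipschitz f : test_function f ->
  exists2 L : R, 0 <= L & forall x h, `|f (x + h) - f x| <= L * enorm h.
Proof.
move=> tf.
have /choice[M MP] : forall i : 'I_n, exists M : R, 0 <= M /\ forall x, `|'d_i f x| <= M.
  by move=> i; have [M ? ?] := test_function_bounded (test_function_derive i tf); exists M.
exists (\sum_i M i); first by apply: sumr_ge0 => i _; have [] := MP i.
move=> x h; have [s _ ->] := line_MVT x h (test_function_differentiable tf).
rewrite mulr_suml; apply: (le_trans (ler_norm_sum _ _ _)); apply: ler_sum => i _.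
rewrite normrM mulrC; apply: ler_pM => //; first by have [_] := MP i; exact.
exact: ler_enorm_coord.
Qed.

(** The mean value theorem along the segment expresses the increment through partial derivatives at
    an intermediate point, and these are Lipschitz. *)
Lemma test_function_taylor f : test_function f ->
  exists2 C : R, 0 <= C & forall x h,
    `|f (x + h) - f x - \sum_(i < n) h 0 i * 'd_i f x| <= C * enorm h ^+ 2.
Proof.
move=> tf.
have /choice[L LP] : forall i : 'I_n, exists L : R, 0 <= L /\
    forall x h, `|'d_i f (x + h) - 'd_i f x| <= L * enorm h.
  by move=> i; have [L ? ?] := test_function_lipschitz (test_function_derive i tf); exists L.
exists (\sum_i L i); first by apply: sumr_ge0 => i _; have [] := LP i.
move=> x h; have [s /andP[s0 s1] ->] := line_MVT x h (test_function_differentiable tf).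
rewrite -sumrB mulr_suml; apply: (le_trans (ler_norm_sum _ _ _)); apply: ler_sum => i _.
rewrite -mulrBr normrM mulrC expr2 mulrA; apply: ler_pM => //; last exact: ler_enorm_coord.
have [L0 Li] := LP i; apply: (le_trans (Li x (s *: h))); rewrite ler_wpM2l// enormZ ger0_norm//.
by rewrite ler_piMl// enorm_ge0.
Qed.

Lemma test_function0 : test_function (0 : E -> R).
Proof.
have p0 s : partials s (0 : E -> R) = 0.
  elim: s => //= i s ->; apply/funext => x; exact: derive_cst.
split.
  by move=> s x; rewrite p0; exact: differentiable_cst.
by apply: compact_support; exists 0 => x; rewrite eqxx.
Qed.

Lemma test_functionB f g : test_function f -> test_function g -> test_function (f - g).
Proof.
move=> tf tg; have [[sf _] [sg _]] := (tf, tg).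
have pB s : partials s (f - g) = partials s f - partials s g.
  elim: s => //= i s ->; apply/funext => x.
  by rewrite deriveB//; apply: diff_derivable; [exact: sf|exact: sg].
split; first by move=> s x; rewrite pB; apply: differentiableB; [exact: sf|exact: sg].
have [A A0 fA] := test_function_support tf; have [B B0 gB] := test_function_support tg.
apply: compact_support; exists (A + B) => x.
have [fx|/fA fx _] := eqVneq (f x) 0; last by rewrite (le_trans fx)// lerDl.
rewrite [(f - g) x](_ : _ = f x - g x)// fx sub0r oppr_eq0 => /gB xB.
by rewrite (le_trans xB)// lerDr.
Qed.

Lemma test_function_bounded_measurable f : test_function f -> bounded_measurable f.
Proof.
move=> tf; split; first by apply: continuous_measurable_row; exact: test_function_continuous.
by have [M _ fM] := test_function_bounded tf; exists M.
Qed.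

End test_functions.

(** * Convolution of a kernel with a test function *)

Section convolution_test_function.
Context {R : realType} (n : nat) (lam : {sigma_finite_measure set 'rV[R]_n -> \bar R}).
Hypothesis lamP : is_lebesgue lam.
Local Notation E := 'rV[R]_n.
Local Notation "''d_' i f" := ('D_(delta_mx 0 i) f) (at level 10, i at next level, f at next level).
Implicit Types (f g : E -> R) (x h : E).
Local Notation kernel := (kernel lam).

Lemma bounded_measurable_shift f h : bounded_measurable f ->
  bounded_measurable (fun y => f (y + h)).
Proof.
move=> [mf [M fM]]; split; last by exists M.
have m : measurable_fun setT (fun y : E => y + h) by exact: measurable_addr.
exact: (measurableT_comp mf m).
Qed.

Lemma normr_convolution_le g f (M : R) x : kernel g -> measurable_fun setT f ->
  (forall y, `|f y| <= M) -> `|convolution g f x| <= M * \int[lam]_z `|g z|.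
Proof.
move=> kg mf fM; have mg := kernel_measurable kg.
have bf : bounded_measurable f by split=> //; exists M.
rewrite (convolutionE lamP x mg mf).
have kabs : lam.-integrable setT (EFin \o (fun z => `|g z|)) by exact: (integrable_abse kg).
rewrite -RintegralZl//.
apply: (le_trans (le_normr_Rintegral measurableT (kernel_conv x kg bf))).
apply: le_Rintegral => //.
- exact: (integrable_abse (kernel_conv x kg bf)).
- exact: (integrableZl measurableT M kabs).
by move=> z _; rewrite normrM mulrC ler_wpM2r.
Qed.

Lemma convolution_sum (I : Type) (r : seq I) g (c : I -> R) (F : I -> E -> R) : kernel g ->
  (forall i, bounded_measurable (F i)) ->
  bounded_measurable (\sum_(i <- r) c i *: F i) /\
  convolution g (\sum_(i <- r) c i *: F i) = \sum_(i <- r) c i *: convolution g (F i).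
Proof.
move=> kg bF; elim: r => [|i r [bI IH]].
  rewrite !big_nil; split.
    by split; [exact: measurable_cst|exists 0 => x; rewrite normr0].
  have b0 : bounded_measurable (0 : E -> R).
    by split; [exact: measurable_cst|exists 0 => x; rewrite normr0].
  by have := convolutionZr lamP 0 kg b0; rewrite !scale0r.
have bZ := bounded_measurableZ (c i) (bF i).
rewrite !big_cons; split; first exact: bounded_measurableD.
by rewrite (convolutionDr lamP)// IH (convolutionZr lamP).
Qed.

Lemma convolution_shift g f x h : kernel g -> bounded_measurable f ->
  convolution g f (x + h) = convolution g (fun y => f (y + h)) x.
Proof.
move=> kg bf; have mg := kernel_measurable kg.
have [mfh _] := bounded_measurable_shift h bf.
rewrite (convolutionE lamP _ mg bf.1) (convolutionE lamP _ mg mfh).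
by apply: eq_Rintegral => z _; rewrite addrAC.
Qed.

(** By linearity the Taylor remainder of g * f is the convolution of [g] with the Taylor remainder
    of [f], which is O(|h|^2) uniformly in its base point. *)
Lemma convolution_quadratic g f : kernel g -> test_function f ->
  exists C : R, forall x h, `|convolution g f (x + h) - convolution g f x -
    \sum_(i < n) h 0 i * convolution g ('d_i f) x| <= C * enorm h ^+ 2.
Proof.
move=> kg tf; have [C C0 fC] := test_function_taylor tf.
exists (C * \int[lam]_z `|g z|) => x h.
have bf := test_function_bounded_measurable tf.
have bd i := test_function_bounded_measurable (test_function_derive i tf).
have [bS cS] := convolution_sum (index_enum 'I_n) (fun i => h 0 i) kg bd.
pose fh y := f (y + h).
have bfh : bounded_measurable fh by exact: bounded_measurable_shift.
have bNf := bounded_measurableZ (-1) bf.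
have bNS := bounded_measurableZ (-1) bS.
pose F : E -> R := fh + (-1) *: f + (-1) *: (\sum_(i < n) h 0 i *: ('d_i f)).
have bF : bounded_measurable F.
  by apply: bounded_measurableD => //; exact: bounded_measurableD.
have sumE (G : 'I_n -> E -> R) y : (\sum_(i < n) h 0 i *: G i) y = \sum_(i < n) h 0 i * G i y.
  by rewrite fct_sumE; apply: eq_bigr.
have -> : convolution g f (x + h) - convolution g f x -
    \sum_(i < n) h 0 i * convolution g ('d_i f) x = convolution g F x.
  rewrite /F (convolutionDr lamP)//; last exact: bounded_measurableD.
  rewrite (convolutionDr lamP)// !(convolutionZr lamP)// cS !scaleN1r.
  by rewrite (convolution_shift x h kg bf) -(sumE (fun i => convolution g ('d_i f)) x).
rewrite mulrAC; apply: normr_convolution_le => //; first exact: bF.1.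
move=> y; apply: le_trans (fC y h); rewrite le_eqVlt; apply/orP; left; apply/eqP.
by congr `|_|; rewrite /F !scaleN1r -(sumE (fun i => 'd_i f) y).
Qed.

(** All derivatives fall on [f], which lets [g] be singular. *)
Lemma partials_convolution g f s : kernel g -> test_function f ->
  (forall x, differentiable (partials s (convolution g f)) x) /\
  partials s (convolution g f) = convolution g (partials s f).
Proof.
move=> kg tf.
have tp : forall s, test_function (partials s f).
  by elim=> //= i s' IH; exact: test_function_derive.
have dc (h : E -> R) : test_function h -> forall x, differentiable (convolution g h) x /\
    forall i, 'd_i (convolution g h) x = convolution g ('d_i h) x.
  move=> th x; have [C hC] := convolution_quadratic kg th.
  exact: quadratic_differentiable (hC x).
elim: s => [|i s [_ IH]]; first by split=> // x; have [] := dc _ tf x.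
have E1 : partials (i :: s) (convolution g f) = convolution g (partials (i :: s) f).
  by rewrite /= IH; apply/funext => x; have [_ ->] := dc _ (tp s) x.
by split=> // x; rewrite E1; have [] := dc _ (tp (i :: s)) x.
Qed.

Lemma test_function_convolution g f (t : R) : kernel g ->
  (forall z, g z != 0 -> enorm z <= t) -> test_function f -> test_function (convolution g f).
Proof.
move=> kg gt tf; split; first by move=> s x; have [] := partials_convolution s kg tf.
have [A A0 fA] := test_function_support tf.
apply: compact_support; exists (t + A) => x; apply: contra_neqT; rewrite -ltNge => xA.
rewrite (convolutionE lamP x (kernel_measurable kg) (test_function_bounded_measurable tf).1).
rewrite /Rintegral integral0_eq// => z _; congr EFin.
have [->|/gt zt] := eqVneq (g z) 0; first by rewrite mul0r.
have [->|/fA xzA] := eqVneq (f (x - z)) 0; first by rewrite mulr0.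
have := ler_enormD (x - z) z; rewrite subrK => h.
by have := lt_le_trans xA (le_trans h (lerD xzA zt)); rewrite addrC ltxx.
Qed.

Lemma test_function_kernel f : test_function f -> kernel f.
Proof.
move=> tf; have [A A0 fA] := test_function_support tf.
have [M M0 fM] := test_function_bounded tf.
have [mf _] := test_function_bounded_measurable tf.
pose Q := [set x : E | forall i, `|x 0 i| <= A].
have mQ : measurable Q by exact: measurable_cube.
apply: (@integrable_dominated _ _ _ lam _ (fun x => M * \1_Q x)) => //.
  move=> x; have [->|/fA xA] := eqVneq (f x) 0; first by rewrite normr0 mulr_ge0.
  rewrite indicE mem_set ?mulr1// => i; exact: le_trans (ler_enorm_coord x i) xA.
apply: (eq_integrable measurableT (fun x => M%:E * (\1_Q x)%:E)%E); first by [].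
apply: (integrableZl measurableT); apply/integrableP; split.
  by apply/measurable_EFinP; exact: measurable_indic.
rewrite (_ : \int[lam]_x _ = \int[lam]_x (\1_Q x)%:E)%E; last first.
  by apply: eq_integral => x _; rewrite gee0_abs// lee_fin.
rewrite integral_indic// setIT.
by apply: (le_lt_trans (lebesgue_cube lamP A0)); rewrite ltry.
Qed.

End convolution_test_function.

(** * Littlewood-Paley blocks *)

Section supported_kernels.
Context {R : realType} (n : nat) (lam : {sigma_finite_measure set 'rV[R]_n -> \bar R}).
Hypothesis lamP : is_lebesgue lam.
Local Notation E := 'rV[R]_n.
Implicit Types (f g : E -> R) (x y z : E).
Local Notation kernel := (kernel lam).

Lemma kernel_supported g (M r : R) : measurable_fun setT g -> 0 <= r -> 0 <= M ->
  (forall x, `|g x| <= M) -> (forall x, g x != 0 -> enorm x <= r) ->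
  kernel g /\ (\int[lam]_x `|g x|%:E <= (M * (2 * r) ^+ n)%:E)%E.
Proof.
move=> mg r0 M0 gM gr.
pose Q := [set x : E | forall i, `|x 0 i| <= r].
have mQ : measurable Q by exact: measurable_cube.
have gQ x : `|g x| <= M * \1_Q x.
  have [->|/gr xr] := eqVneq (g x) 0; first by rewrite normr0 mulr_ge0.
  by rewrite indicE mem_set ?mulr1// => i; exact: le_trans (ler_enorm_coord x i) xr.
have mMQ : measurable_fun setT (fun x : E => M * \1_Q x).
  by apply: measurable_funM => //; exact: measurable_indic.
have intQ : (\int[lam]_x (M * \1_Q x)%:E <= (M * (2 * r) ^+ n)%:E)%E.
  under eq_integral do rewrite EFinM.
  rewrite ge0_integralZl//; last by apply/measurable_EFinP; exact: measurable_indic.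
  rewrite integral_indic// setIT EFinM; apply: lee_wpmul2l; first by rewrite lee_fin.
  by apply: (le_trans (lebesgue_cube lamP r0)).
have le1 : (\int[lam]_x `|g x|%:E <= (M * (2 * r) ^+ n)%:E)%E.
  apply: le_trans intQ; apply: ge0_le_integral => //.
  - by apply/measurable_EFinP; exact: measurableT_comp.
  - exact/measurable_EFinP.
  - by move=> x _; rewrite lee_fin.
split=> //; apply/integrableP; split; first exact/measurable_EFinP.
by apply: le_lt_trans le1 _; rewrite ltry.
Qed.

Lemma Rintegral_scale (c : R) f : 0 < c -> measurable_fun setT f ->
  \int[lam]_x f (c *: x) = c ^- n * \int[lam]_x f x.
Proof.
move=> c0 mf; have mf' : measurable_fun setT (EFin \o f) by exact/measurable_EFinP.
have cN : c != 0 by rewrite gt_eqF.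
have cn : 0 <= c ^- n by rewrite invr_ge0 exprn_ge0// ltW.
rewrite /Rintegral [X in fine X = _]integralE [in RHS]integralE.
have E1 (F : E -> \bar R) : measurable_fun setT F -> (forall x, (0 <= F x)%E) ->
    (\int[lam]_x F (c *: x)%R = (c ^- n)%:E * \int[lam]_x F x)%E.
  move=> mF F0; have := integral_affine lamP 0 cN mF F0; rewrite gtr0_norm// => <-.
  by apply: eq_integral => x _; rewrite addr0.
have pE : (\int[lam]_x (fun x => (f (c *: x))%:E)^\+%E x =
    (c ^- n)%:E * \int[lam]_x (fun x => (f x)%:E)^\+%E x)%E.
  rewrite -(E1 (fun x => (f x)%:E)^\+%E)//; last exact: measurable_funepos.
  by apply: eq_integral => x _; rewrite unlock.
have nE : (\int[lam]_x (fun x => (f (c *: x))%:E)^\-%E x =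
    (c ^- n)%:E * \int[lam]_x (fun x => (f x)%:E)^\-%E x)%E.
  rewrite -(E1 (fun x => (f x)%:E)^\-%E)//; last exact: measurable_funeneg.
  by apply: eq_integral => x _; rewrite unlock.
have cn0 : 0 < c ^- n by rewrite invr_gt0 exprn_gt0.
have aux (a b : \bar R) : (0 <= a)%E -> (0 <= b)%E ->
    fine ((c ^- n)%:E * a - (c ^- n)%:E * b)%E = c ^- n * fine (a - b)%E.
  move: a b => [a| |] [b| |]//= _ _; rewrite ?mulrBr// gt0_muley ?lte_fin//= mulr0//.
by rewrite pE nE aux//; apply: integral_ge0.
Qed.

Lemma Rintegral_sum (I : Type) (r : seq I) (F : I -> E -> R) :
  (forall i, kernel (F i)) ->
  kernel (fun x => \sum_(i <- r) F i x) /\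
  \int[lam]_x (\sum_(i <- r) F i x) = \sum_(i <- r) \int[lam]_x F i x.
Proof.
move=> kF; elim: r => [|i r [kI IH]].
  rewrite big_nil; have -> : (fun x : E => \sum_(i <- [::]) F i x) = cst 0.
    by apply/funext => x; rewrite big_nil.
  by split; [exact: integrable0|rewrite /Rintegral integral0].
have -> : (fun x : E => \sum_(j <- i :: r) F j x) = (fun x => F i x + \sum_(j <- r) F j x).
  by apply/funext => x; rewrite big_cons.
split; first exact: (kernelD (kF i) kI).
by rewrite (RintegralD measurableT (kF i) kI) big_cons; congr (_ + _).
Qed.

End supported_kernels.

Section lowpass.
Context {R : realType} (n : nat) (lam : {sigma_finite_measure set 'rV[R]_n -> \bar R}).
Hypothesis lamP : is_lebesgue lam.
Local Notation E := 'rV[R]_n.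
Implicit Types (f g : E -> R) (x y z u : E).
Local Notation kernel := (kernel lam).
Variable phi0 : E -> R.
Hypothesis tphi : test_function phi0.
Let c0 := \int[lam]_x phi0 x.
Hypothesis c0N : c0 != 0.
Hypothesis moment1 : forall i, \int[lam]_x (x 0 i * mother phi0 x) = 0.

Let mphi : measurable_fun setT phi0 := (test_function_bounded_measurable tphi).1.
Let mphiZ (c : R) : measurable_fun setT (fun x : E => phi0 (c *: x)).
Proof. exact: (measurableT_comp mphi (measurable_scaler c)). Qed.

Lemma measurable_mother : measurable_fun setT (mother phi0).
Proof. by apply: measurable_funB => //; apply: measurable_funM => //; exact: mphiZ. Qed.

Let p2 (k : nat) : 0 < 2 ^+ k :> R. Proof. by rewrite exprn_gt0. Qed.
Let p2N (k : nat) : 2 ^+ k != 0 :> R. Proof. by rewrite gt_eqF. Qed.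

(** The dilate [2^{nk} phi0(2^k x)], normalized to have integral 1; the blocks
    are the successive differences of these low-pass filters. *)
Definition lowpass (k : nat) : E -> R :=
  fun x => c0^-1 * (2 ^+ (n * k) * phi0 (2 ^+ k *: x)).

Lemma measurable_lowpass k : measurable_fun setT (lowpass k).
Proof. by do 2 (apply: measurable_funM => //); exact: mphiZ. Qed.

Lemma block0E : block phi0 0 = c0 *: lowpass 0.
Proof.
apply/funext => x; rewrite [RHS](_ : _ = c0 * lowpass 0 x)//.
by rewrite /lowpass muln0 !expr0 scale1r mul1r mulrA divff// mul1r.
Qed.

Lemma blockSE j : block phi0 j.+1 = c0 *: (lowpass j.+1 - lowpass j).
Proof.
apply/funext => x; rewrite [RHS](_ : _ = c0 * (lowpass j.+1 x - lowpass j x))//.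
rewrite /lowpass /= /mother -mulrBr mulrA divff// mul1r mulrBr; congr (_ - _).
rewrite mulrA scalerA exprS mulKf// mulnS exprD; congr (_ * _).
by rewrite mulrAC divff ?mul1r.
Qed.

(** The height 2^{nk} of a dilate compensates the volume 2^{-nk} of the cube that contains its
    support; hence L^1 bounds independent of the scale. *)
Let scale_cancel (M A : R) (k : nat) :
  (M * 2 ^+ (n * k)) * (2 * (A * 2 ^- k)) ^+ n = M * (2 * A) ^+ n.
Proof.
rewrite mulnC exprM -mulrA -exprMn; congr (_ * _ ^+ _).
by field; rewrite p2N.
Qed.

Lemma lowpass_bounds : exists MA : R * R, [/\ 0 <= MA.1, 0 <= MA.2 &
  forall k, [/\ kernel (lowpass k), bounded_measurable (lowpass k),
    forall x, lowpass k x != 0 -> enorm x <= MA.2 * 2 ^- k &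
    (\int[lam]_x `|lowpass k x|%:E <= MA.1%:E)%E]].
Proof.
have [A A0 phiA] := test_function_support tphi.
have [M M0 phiM] := test_function_bounded tphi.
pose M1 := `|c0^-1| * M; have M10 : 0 <= M1 by rewrite mulr_ge0.
exists (M1 * (2 * A) ^+ n, A) => /=; split=> // [|k].
  by rewrite mulr_ge0// exprn_ge0// mulr_ge0.
have b x : `|lowpass k x| <= M1 * 2 ^+ (n * k).
  rewrite !normrM (ger0_norm (ltW (p2 _))) mulrA mulrAC /M1.
  by rewrite ler_wpM2r ?(ltW (p2 _))// ler_wpM2l.
have s x : lowpass k x != 0 -> enorm x <= A * 2 ^- k.
  rewrite !mulf_eq0 !negb_or => /and3P[_ _ /phiA].
  by rewrite enormZ gtr0_norm// ler_pdivlMr// mulrC.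
have Ak0 : 0 <= A * 2 ^- k by rewrite mulr_ge0// invr_ge0 ltW.
have Mk0 : 0 <= M1 * 2 ^+ (n * k) by rewrite mulr_ge0// ltW.
have [kg] := kernel_supported lamP (measurable_lowpass k) Ak0 Mk0 b s.
rewrite scale_cancel => ig; split=> //.
by split; [exact: measurable_lowpass|exists (M1 * 2 ^+ (n * k))].
Qed.

Lemma block_bounds : exists MA : R * R, [/\ 0 <= MA.1, 0 <= MA.2 &
  forall j, [/\ kernel (block phi0 j), bounded_measurable (block phi0 j),
    forall x, block phi0 j x != 0 -> enorm x <= MA.2 * 2 ^- j &
    (\int[lam]_x `|block phi0 j x|%:E <= MA.1%:E)%E]].
Proof.
have [MA [M0 A0 lowP]] := lowpass_bounds.
pose B := `|c0| * (MA.1 + MA.1).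
(* The radius is doubled because block j+1 contains the filter of the coarser scale j, and 2^-j = 2
   * 2^-(j+1). *)
exists (B, 2 * MA.2) => /=; split=> [||j]; rewrite ?mulr_ge0 ?addr_ge0//.
case: j => [|j].
  have [k0 b0 s0 i0] := lowP 0%N; rewrite block0E; split.
  - exact: kernelZ.
  - exact: bounded_measurableZ.
  - move=> x; rewrite mulf_eq0 negb_or => /andP[_ /s0]; rewrite expr0 invr1 !mulr1.
    by move=> /le_trans; apply; rewrite ler_peMl// ler1n.
  - rewrite (eq_integral (fun x => `|c0|%:E * `|lowpass 0 x|%:E)%E); last first.
      by move=> x _; rewrite -EFinM -normrM.
    rewrite ge0_integralZl//; last first.
      by apply/measurable_EFinP; apply: measurableT_comp => //; exact: measurable_lowpass.
    rewrite /B EFinM; apply: lee_wpmul2l; first by rewrite lee_fin.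
    by apply: (le_trans i0); rewrite lee_fin lerDl.
have [k1 b1 s1 i1] := lowP j.+1; have [k0 b0 s0 i0] := lowP j.
rewrite blockSE.
have kD : kernel (lowpass j.+1 - lowpass j) by exact: (integrableB measurableT k1 k0).
have bN : bounded_measurable (- lowpass j).
  by have := bounded_measurableZ (-1) b0; rewrite scaleN1r.
have bD : bounded_measurable (lowpass j.+1 - lowpass j) by exact: bounded_measurableD.
split.
- exact: kernelZ.
- exact: bounded_measurableZ.
- move=> x; rewrite mulf_eq0 negb_or => /andP[_].
  rewrite [(lowpass j.+1 - lowpass j) x](_ : _ = lowpass j.+1 x - lowpass j x)//.
  have [->|/s1 h _] := eqVneq (lowpass j.+1 x) 0.
    rewrite sub0r oppr_eq0 => /s0 h; apply: (le_trans h).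
    by rewrite exprS invfM mulrACA mulfV// mul1r.
  by apply: (le_trans h); rewrite -mulrA ler_peMl ?ler1n// mulr_ge0// invr_ge0 ltW.
- apply: (@le_trans _ _ (\int[lam]_x (`|c0|%:E * (`|lowpass j.+1 x|%:E + `|lowpass j x|%:E)))%E).
    apply: ge0_le_integral => //.
    + apply/measurable_EFinP; apply: measurableT_comp => //.
      by apply: measurable_funM => //; exact: bD.1.
    + apply: measurable_funeM; apply: emeasurable_funD;
        by apply/measurable_EFinP; apply: measurableT_comp => //; exact: measurable_lowpass.
    + move=> x _; rewrite -EFinD -EFinM lee_fin [X in `|X|](_ : _ = c0 * (lowpass j.+1 x - lowpass j x))//.
      by rewrite normrM ler_wpM2l// ler_normB.
  rewrite ge0_integralZl//; last 2 first.
  + by apply: emeasurable_funD;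
        apply/measurable_EFinP; apply: measurableT_comp => //; exact: measurable_lowpass.
  + by move=> x _; rewrite -EFinD lee_fin addr_ge0.
  rewrite ge0_integralD//; last 2 first.
  + by apply/measurable_EFinP; apply: measurableT_comp => //; exact: measurable_lowpass.
  + by apply/measurable_EFinP; apply: measurableT_comp => //; exact: measurable_lowpass.
  rewrite /B EFinM; apply: lee_wpmul2l; first by rewrite lee_fin.
  by rewrite EFinD; exact: leeD.
Qed.

Lemma integral_lowpass k : \int[lam]_x lowpass k x = 1.
Proof.
have [_ [_ _ /(_ k)[kk _ _ _]]] := lowpass_bounds.
have kphi := test_function_kernel lamP tphi.
pose F x := c0^-1 * (2 ^+ (n * k) * phi0 x).
have mF : measurable_fun setT F by do 2 apply: measurable_funM => //.
rewrite (Rintegral_scale lamP (p2 k) mF).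
have kphi2 : lam.-integrable setT (EFin \o (fun x => 2 ^+ (n * k) * phi0 x)).
  exact: (kernelZ (2 ^+ (n * k)) kphi).
rewrite RintegralZl// RintegralZl// -/c0 mulnC exprM; field.
by rewrite c0N expf_neq0 ?p2N.
Qed.

(** The mean vanishes because two filters of integral 1 are subtracted. The index starts at 1: block
    0 is [phi0] itself, whose integral is nonzero. *)
Lemma integral_block j : \int[lam]_x block phi0 j.+1 x = 0.
Proof.
have [MA [_ _ lowP]] := lowpass_bounds.
have [k1 _ _ _] := lowP j.+1; have [k0 _ _ _] := lowP j.
have kD : lam.-integrable setT (EFin \o (fun x => lowpass j.+1 x - lowpass j x)).
  exact: (integrableB measurableT k1 k0).
rewrite blockSE.
rewrite (@eq_Rintegral _ _ _ lam setT (fun x => c0 * (lowpass j.+1 x - lowpass j x)))//.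
by rewrite RintegralZl// RintegralB// !integral_lowpass subrr mulr0.
Qed.

Lemma moment_block j i : \int[lam]_x (x 0 i * block phi0 j.+1 x) = 0.
Proof.
(* In the scaled variable the moment of the block is a multiple of the first moment of
   [mother phi0]; the factor 2^-(j+1) restores the coordinate. *)
pose F x := 2 ^- j.+1 * 2 ^+ (n * j.+1) * (x 0 i * mother phi0 x).
have mF : measurable_fun setT F.
  do 2 apply: measurable_funM => //; first exact: measurable_coord.
  exact: measurable_mother.
rewrite (@eq_Rintegral _ _ _ lam setT (fun x => F (2 ^+ j.+1 *: x))); last first.
  by move=> x _; rewrite /F/= mxE; field; rewrite p2N.
rewrite (Rintegral_scale lamP (p2 _) mF).
have [MA [M0 A0 /(_ 1%N)[kb [mb [M bM]] s _]]] := block_bounds.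
have kmom : lam.-integrable setT (EFin \o (fun x : E => x 0 i * mother phi0 x)).
  have [A A1 phiA] := test_function_support tphi.
  have [B B0 phiB] := test_function_bounded tphi.
  have mo x : `|mother phi0 x| <= 2 * B.
    rewrite /mother (le_trans (ler_normB _ _))// mulr2n mulrDl mul1r lerD//.
    have q : 0 <= 2 ^- n :> R by rewrite invr_ge0 exprn_ge0.
    have q1 : 2 ^- n <= 1 :> R by rewrite invf_le1 ?exprn_gt0// exprn_ege1// ler1n.
    by rewrite normrM (ger0_norm q) -[B]mul1r; apply: ler_pM.
  have ms x : mother phi0 x != 0 -> enorm x <= 2 * A.
    rewrite /mother; have [->|/phiA h _] := eqVneq (phi0 x) 0.
      rewrite sub0r oppr_eq0 mulf_eq0 negb_or => /andP[_ /phiA].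
      by rewrite enormZ ger0_norm ?invr_ge0// ler_pdivrMl.
    by apply: (le_trans h); rewrite ler_peMl// ler1n.
  apply: (kernel_supported lamP (M := 2 * A * (2 * B)) (r := 2 * A) _ _ _ _ _).1.
  - by apply: measurable_funM; [exact: measurable_coord|exact: measurable_mother].
  - by rewrite mulr_ge0.
  - by rewrite !mulr_ge0.
  - move=> x; have [->|/ms h] := eqVneq (mother phi0 x) 0.
      by rewrite mulr0 normr0 !mulr_ge0.
    by rewrite normrM ler_pM// (le_trans (ler_enorm_coord x i)).
  - by move=> x; rewrite mulf_eq0 negb_or => /andP[_ /ms].
by rewrite RintegralZl// moment1 !mulr0.
Qed.

End lowpass.

(** * Convolution of a block with a coarser low-pass filter *)

Section theta.
Context {R : realType} (n : nat) (lam : {sigma_finite_measure set 'rV[R]_n -> \bar R}).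
Hypothesis lamP : is_lebesgue lam.
Local Notation E := 'rV[R]_n.
Local Notation "''d_' i f" := ('D_(delta_mx 0 i) f) (at level 10, i at next level, f at next level).
Implicit Types (f g : E -> R) (x y z u : E).
Local Notation kernel := (kernel lam).
Variable phi0 : E -> R.
Hypothesis tphi : test_function phi0.
Hypothesis c0N : \int[lam]_x phi0 x != 0.
Hypothesis moment1 : forall i, \int[lam]_x (x 0 i * mother phi0 x) = 0.
Local Notation lowpass := (lowpass lam phi0).

Let p2 (k : nat) : 0 < 2 ^+ k :> R. Proof. by rewrite exprn_gt0. Qed.
Let p2N (k : nat) : 2 ^+ k != 0 :> R. Proof. by rewrite gt_eqF. Qed.

(** Taylor expansion of [phi0] at 2^k u with increment - 2^k z. The linear form [l] may depend on
    [k] and [u] without any bound, since the first moments of a block annihilate every linear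
    form. *)
Lemma lowpass_taylor : exists2 C : R, 0 <= C & forall k u, exists l : 'I_n -> R, forall z,
  `|lowpass k (u - z) - lowpass k u - \sum_i l i * z 0 i| <=
  C * 2 ^+ (n * k) * (2 ^+ k * enorm z) ^+ 2.
Proof.
have [C C0 phiC] := test_function_taylor tphi.
pose a : R := (\int[lam]_x phi0 x)^-1.
exists (`|a| * C) => [|k u]; first by rewrite mulr_ge0.
exists (fun i => - (a * (2 ^+ (n * k) * (2 ^+ k * 'd_i phi0 (2 ^+ k *: u))))) => z.
have := phiC (2 ^+ k *: u) (- (2 ^+ k *: z)).
rewrite enormN enormZ (gtr0_norm (p2 k)) => h.
rewrite [X in `|X|](_ : _ = a * (2 ^+ (n * k) * (phi0 (2 ^+ k *: u - 2 ^+ k *: z) -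
    phi0 (2 ^+ k *: u) - \sum_(i < n) (- (2 ^+ k *: z)) 0 i * 'd_i phi0 (2 ^+ k *: u)))); last first.
  rewrite [X in _ - _ - X = _](_ : _ = a * (2 ^+ (n * k) *
      \sum_(i < n) (- (2 ^+ k *: z)) 0 i * 'd_i phi0 (2 ^+ k *: u))).
    by rewrite /lowpass /= -/a -(scalerBr (2 ^+ k) u z); ring.
  by rewrite !mulr_sumr; apply: eq_bigr => i _; rewrite !mxE; ring.
rewrite !normrM (gtr0_norm (p2 (n * k))) -!mulrA ler_wpM2l// mulrCA ler_wpM2l ?(ltW (p2 _))//.
Qed.

(** The Taylor polynomial of degree 1 of [lowpass k] is annihilated by [block phi0 j];
    the remainder on the support of the block is [O(4^{-(j-k)})]. *)
Definition theta j k := convolution (block phi0 j) (lowpass k).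

Lemma theta_bounds : exists DA : R * R, [/\ 0 <= DA.1, 0 <= DA.2 &
  forall j k, (0 < j)%N -> (k <= j)%N -> [/\ kernel (theta j k),
    forall u, theta j k u != 0 -> enorm u <= DA.2 * 2 ^- k,
    (\int[lam]_u `|theta j k u|%:E <= (DA.1 * (2 ^- (j - k)) ^+ 2)%:E)%E &
    \int[lam]_u theta j k u = 0]].
Proof.
have [[MS AS] [/= MS0 AS0 lowP]] := lowpass_bounds lamP tphi.
have [[MB AB] [/= MB0 AB0 blkP]] := block_bounds lamP tphi c0N.
have [C C0 taylor] := lowpass_taylor.
pose A := AB + AS; have A0 : 0 <= A by rewrite addr_ge0.
(* Sup bound of [theta] times the volume of the cube of half-side A 2^-k; the powers 2^{nk}
   cancel. *)
pose D := C * AB ^+ 2 * MB * (2 * A) ^+ n.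
have D0 : 0 <= D by rewrite !mulr_ge0// exprn_ge0// mulr_ge0.
exists (D, A) => /=; split=> // j k j0 kj.
have [kb bb sb ib] := blkP j; have [kS bS sS iS] := lowP k.
have [mb mS] := (kernel_measurable kb, kernel_measurable kS).
have [kt _] := kernel_convolution lamP kb kS bS.
have mt : measurable_fun setT (theta j k) := kernel_measurable kt.
have thetaE u : theta j k u = \int[lam]_z (block phi0 j z * lowpass k (u - z)).
  exact: convolutionE.
have le2 : 2 ^- j <= 2 ^- k :> R by rewrite lef_pV2 ?posrE// ler_weXn2l// ler1n.
have supp u : theta j k u != 0 -> enorm u <= A * 2 ^- k.
  apply: contra_neqT; rewrite -ltNge => uA.
  rewrite thetaE /Rintegral integral0_eq// => z _; congr EFin.
  have [->|/sb zb] := eqVneq (block phi0 j z) 0; first by rewrite mul0r.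
  have [->|/sS zS] := eqVneq (lowpass k (u - z)) 0; first by rewrite mulr0.
  have := ler_enormD (u - z) z; rewrite subrK => h.
  have zb' : enorm z <= AB * 2 ^- k by rewrite (le_trans zb)// ler_wpM2l.
  have := lt_le_trans uA (le_trans h (lerD zS zb')).
  by rewrite -mulrDl addrC ltxx.
have ib0 : \int[lam]_z block phi0 j z = 0.
  by case: j j0 {kj kb bb sb ib mb kt mt thetaE le2 supp} => // j _; exact: integral_block.
have momb i : \int[lam]_z (z 0 i * block phi0 j z) = 0.
  by case: j j0 {kj kb bb sb ib mb kt mt thetaE le2 supp ib0} => // j _; exact: moment_block.
have kmom i : kernel (fun z => z 0 i * block phi0 j z).
  have [_ [M bM]] := bb.
  have M0 : 0 <= M := le_trans (normr_ge0 _) (bM 0).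
  apply: (kernel_supported lamP (M := AB * 2 ^- j * M) (r := AB * 2 ^- j) _ _ _ _ _).1.
  - by apply: measurable_funM => //; exact: measurable_coord.
  - by rewrite mulr_ge0// invr_ge0 ltW.
  - by rewrite !mulr_ge0// invr_ge0 ltW.
  - move=> z; have [->|/sb h] := eqVneq (block phi0 j z) 0.
      by rewrite mulr0 normr0 !mulr_ge0// invr_ge0 ltW.
    by rewrite normrM ler_pM// (le_trans (ler_enorm_coord z i)).
  - by move=> z; rewrite mulf_eq0 negb_or => /andP[_ /sb].
have bound u : `|theta j k u| <=
    C * 2 ^+ (n * k) * (2 ^+ k * (AB * 2 ^- j)) ^+ 2 * MB.
  have [l lP] := taylor k u.
  set Q := C * 2 ^+ (n * k) * (2 ^+ k * (AB * 2 ^- j)) ^+ 2.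
  have Q0 : 0 <= Q by rewrite !mulr_ge0 ?sqr_ge0// ltW.
  (* Subtracting the affine part does not change the integral, because the mean and the first
     moments of the block vanish. *)
  pose rem z := block phi0 j z * (lowpass k (u - z) - lowpass k u - \sum_i l i * z 0 i).
  have k1 := kernel_conv u kb bS.
  have k2 : kernel (fun z => lowpass k u * block phi0 j z) by exact: (kernelZ (lowpass k u) kb).
  have klz i : kernel (fun z => l i * (z 0 i * block phi0 j z)) by exact: (kernelZ (l i) (kmom i)).
  have [k3 int3] := Rintegral_sum (index_enum 'I_n) klz.
  have k12 : kernel (fun z => block phi0 j z * lowpass k (u - z) - lowpass k u * block phi0 j z).
    exact: (integrableB measurableT k1 k2).
  have remE z : rem z = block phi0 j z * lowpass k (u - z) - lowpass k u * block phi0 j z -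
      \sum_i l i * (z 0 i * block phi0 j z).
    rewrite /rem !mulrBr (mulrC _ (lowpass k u)) mulr_sumr; congr (_ - _).
    by apply: eq_bigr => i _; ring.
  have krem : kernel rem.
    apply: (eq_integrable measurableT _ _ _ (integrableB measurableT k12 k3)) => z _.
    by rewrite /= remE.
  have -> : theta j k u = \int[lam]_z rem z.
    rewrite (@eq_Rintegral _ _ _ lam setT (fun z => block phi0 j z * lowpass k (u - z) -
      lowpass k u * block phi0 j z - \sum_i l i * (z 0 i * block phi0 j z))); last first.
      by move=> z _; rewrite remE.
    rewrite (RintegralB measurableT k12 k3) (RintegralB measurableT k1 k2) int3.
    rewrite RintegralZl// ib0 mulr0 subr0 -thetaE big1 ?subr0// => i _.
    by rewrite RintegralZl ?momb ?mulr0//; exact: kmom.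
  rewrite -lee_fin; apply: (le_trans (normr_Rintegral_le krem)).
  apply: (@le_trans _ _ (\int[lam]_z (Q%:E * `|block phi0 j z|%:E))%E).
    apply: ge0_le_integral.
    - exact: measurableT.
    - by move=> z _; rewrite lee_fin.
    - by apply/measurable_EFinP; apply: measurableT_comp => //; exact: kernel_measurable krem.
    - by apply: measurable_funeM; apply/measurable_EFinP; exact: measurableT_comp.
    move=> z _; rewrite -EFinM lee_fin /rem normrM mulrC.
    have [->|/sb zb] := eqVneq (block phi0 j z) 0; first by rewrite normr0 !mulr0.
    rewrite ler_wpM2r//; apply: (le_trans (lP z)); rewrite /Q ler_wpM2l//.
      by rewrite mulr_ge0// ltW.
    rewrite lerXn2r ?nnegrE ?mulr_ge0 ?enorm_ge0 ?invr_ge0 ?(ltW (p2 _))//.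
    by rewrite ler_wpM2l// ltW.
  rewrite ge0_integralZl//; last by apply/measurable_EFinP; exact: measurableT_comp.
  by rewrite [leRHS]EFinM; apply: lee_wpmul2l; rewrite ?lee_fin.
split=> //.
- have rk0 : 0 <= A * 2 ^- k by rewrite mulr_ge0// invr_ge0 ltW.
  have Mk0 : 0 <= C * 2 ^+ (n * k) * (2 ^+ k * (AB * 2 ^- j)) ^+ 2 * MB.
    by rewrite !mulr_ge0 ?sqr_ge0// ltW.
  apply: (le_trans (kernel_supported lamP mt rk0 Mk0 bound supp).2).
  rewrite lee_fin le_eqVlt; apply/orP; left; apply/eqP.
  have -> : 2 ^- (j - k) = 2 ^+ k * 2 ^- j :> R.
    by rewrite -{2}(subnK kj) exprD; field; rewrite !p2N.
  have e1 : 2 ^+ (n * k) * (2 * (A * 2 ^- k)) ^+ n = (2 * A) ^+ n.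
    by rewrite mulnC exprM -exprMn; congr (_ ^+ _); field; rewrite p2N.
  rewrite /D -e1; ring.
(* Convolution with the constant 1 computes the integral of a kernel. By associativity [theta]
   convolved with 1 is the block convolved with 1, that is, 0. *)
- have b1 : bounded_measurable (cst 1 : E -> R).
    by split; [exact: measurable_cst|exists 1 => x; rewrite normr1].
  have m1 := b1.1.
  have conv1 g x : kernel g -> convolution g (cst 1) x = \int[lam]_z g z.
    move=> kg; rewrite (convolutionE lamP x (kernel_measurable kg) m1).
    by apply: eq_Rintegral => z _; rewrite mulr1.
  have := congr1 (fun h => h 0) (convolutionA lamP kb kS bS b1).
  rewrite (conv1 (convolution _ _))// => <-.
  have -> : convolution (lowpass k) (cst 1) = cst 1.
    by apply/funext => x; rewrite conv1// (integral_lowpass lamP tphi c0N).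
  by rewrite conv1// ib0.
Qed.

End theta.

(** * The weighted norm as a norm *)

Section weighted_norm.
Local Open Scope ereal_scope.
Context {R : realType} (n : nat) (lam : {sigma_finite_measure set 'rV[R]_n -> \bar R}).
Hypothesis lamP : is_lebesgue lam.
Local Notation E := 'rV[R]_n.
Implicit Types (f g : E -> R).
Variables (mu p : R).
Hypothesis p1 : (1 < p)%R.
Let p0 : (0 < p)%R := lt_trans ltr01 p1.
Local Notation W := (weighted_Lp_norm mu p).

Lemma weighted_Lp_norm_ge0 f : 0 <= W f. Proof. exact: poweR_ge0. Qed.

(** The p-th root of the weight: the weighted norm of [f] is the plain L^p norm of [f \* w], to
    which Minkowski's inequality applies. *)
Let w (x : E) : R := expR (- (mu * enorm x) / p).

Let mw : measurable_fun setT w.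
Proof.
apply: (measurableT_comp (f := expR)) => //; apply: measurable_funM => //.
by apply: measurableT_comp => //; apply: measurable_funM => //; exact: measurable_enorm.
Qed.

Lemma weighted_Lp_norm_Lnorm f : measurable_fun setT f ->
  W f = Lnorm lam p%:E (EFin \o (f \* w)%R).
Proof.
move=> mf; rewrite (weighted_Lp_normE lamP)// unlock; congr (_ `^ _).
apply: eq_integral => x _ /=; congr EFin.
by rewrite normrM powRM// (ger0_norm (expR_ge0 _)) -expRM divfK// gt_eqF.
Qed.

Lemma weighted_Lp_normD f g : measurable_fun setT f -> measurable_fun setT g ->
  W (f + g)%R <= W f + W g.
Proof.
move=> mf mg; rewrite !weighted_Lp_norm_Lnorm//; last exact: measurable_funD.
have mfw : measurable_fun setT (f \* w)%R by exact: measurable_funM.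
have mgw : measurable_fun setT (g \* w)%R by exact: measurable_funM.
apply: le_trans (minkowski_EFin lam mfw mgw (ltW p1)).
rewrite le_eqVlt; apply/orP; left; apply/eqP; congr Lnorm.
by apply/funext => x /=; rewrite mulrDl.
Qed.

Lemma weighted_Lp_normZ (c : R) f : measurable_fun setT f ->
  W (c *: f)%R = `|c|%:E * W f.
Proof.
move=> mf; have mcf : measurable_fun setT (c *: f)%R by exact: measurable_funM.
rewrite !(weighted_Lp_normE lamP)//.
pose F x := (`|f x| `^ p * expR (- (mu * enorm x)))%:E.
have F0 x : setT x -> 0 <= F x by move=> _; rewrite lee_fin mulr_ge0 ?powR_ge0 ?expR_ge0.
have mF : measurable_fun setT F.
  apply/measurable_EFinP; apply: measurable_funM.
    apply: (measurableT_comp (measurable_powR _)); exact: measurableT_comp.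
  apply: measurableT_comp => //; apply: measurableT_comp => //.
  by apply: measurable_funM => //; exact: measurable_enorm.
have cp : (0 <= `|c| `^ p)%R by exact: powR_ge0.
rewrite (eq_integral (fun x => (`|c| `^ p)%:E * F x)); last first.
  move=> x _; rewrite /F -EFinM; congr EFin.
  by rewrite [(c *: f)%R x](_ : _ = c * f x)%R// normrM powRM// mulrA.
rewrite (ge0_integralZl_EFin lam measurableT F0 mF cp) poweRM//.
- by rewrite poweR_EFin -powRrM divff ?gt_eqF// powRr1.
- by apply: integral_ge0 => x; exact: F0.
Qed.

Lemma weighted_Lp_norm0 : W (0 : E -> R)%R = 0.
Proof.
have m0 : measurable_fun setT (0 : E -> R)%R by exact: measurable_cst.
by have := weighted_Lp_normZ 0 m0; rewrite scale0r normr0 mul0e.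
Qed.

End weighted_norm.

(** * The estimate of a single block *)

Section block_estimate.
Local Open Scope ereal_scope.
Context {R : realType} (n : nat) (lam : {sigma_finite_measure set 'rV[R]_n -> \bar R}).
Hypothesis lamP : is_lebesgue lam.
Local Notation E := 'rV[R]_n.
Implicit Types (f g : E -> R) (x y z u : E).
Local Notation kernel := (kernel lam).
Variable phi0 : E -> R.
Hypothesis tphi : test_function phi0.
Local Notation c0 := (\int[lam]_x phi0 x)%R.
Hypothesis c0N : c0 != 0%R.
Hypothesis moment1 : forall i, (\int[lam]_x (x 0 i * mother phi0 x))%R = 0%R.
Local Notation S := (lowpass lam phi0).
Local Notation B := (block phi0).

(** All that is used of the wave kernel. The unit ball contains the supports for all t <= 1, and one
    [A] serves for all these t. *)
Record hoelder_kernel (A s : R) (G : E -> R) : Prop := {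
  hk_kernel : kernel G;
  hk_supp : forall z, (G z != 0 -> enorm z <= 1)%R;
  hk_norm : \int[lam]_z `|G z|%:E <= A%:E;
  hk_modulus : forall y, \int[lam]_z `|G (z - y)%R - G z|%:E <= (A * enorm y `^ s)%:E }.

(** One of the two factors 2^-(j-k) is spent on improving the gain from scale k to scale j, which is
    possible because s <= 1; the other one remains for Schur's test. *)
Let pow2_powR (s : R) (j k : nat) : (0 <= s <= 1)%R -> (k <= j)%N ->
  ((2 ^- k) `^ s * (2 ^- (j - k)) ^+ 2 <= (2 ^- j) `^ s * 2 ^- (j - k) :> R)%R.
Proof.
move=> /andP[s0 s1] kj; set h : R := (2 ^- (j - k))%R.
have h0 : (0 < h)%R by rewrite invr_gt0 exprn_gt0.
have h1 : (h <= 1)%R by rewrite invf_le1 ?exprn_gt0// exprn_ege1// ler1n.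
have -> : (2 ^- j = 2 ^- k * h :> R)%R.
  by rewrite /h -{1}(subnKC kj) exprD invfM.
rewrite powRM ?(ltW h0) ?invr_ge0 ?exprn_ge0// -mulrA ler_wpM2l ?powR_ge0//.
rewrite expr2 ler_wpM2r ?(ltW h0)//.
rewrite -{1}(powRr1 (ltW h0)); apply: ger_powR => //; exact/andP.
Qed.

(** The factorization 1 - S S = (1 - S) (1 + S), with x = G a, y = G S a and z = G S S a. It reduces
    the square to the single filter of [smoothing_convolution], applied to a + S a. *)
Let telescope (V : lmodType R) (x y z u v : V) : (u = y + z -> v = x + y ->
  x - z = (-1) *: (u - 1 *: v))%R.
Proof. by move=> -> ->; rewrite scale1r scaleN1r opprB addrKA. Qed.

(** The bottom term of the telescoping sum: block 0 is itself a multiple of the filter S_0. *)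
Let c0V_block0 f : bounded_measurable f ->
  convolution (S 0) (convolution (S 0) f) =
  convolution (S 0) (c0^-1 *: convolution (B 0) f)%R.
Proof.
move=> bf; have [MA [_ _ /(_ 0%N)[kS _ _ _]]] := lowpass_bounds lamP tphi.
rewrite (block0E c0N) (convolutionZl lamP _ kS bf) scalerA mulVf//.
by congr convolution; rewrite scale1r.
Qed.

(** A difference of squares, the filters commuting by [convolutionAC]; S_{N+1} f - S_N f is
    recognized as the normalized block N+1. *)
Let lowpass_square_succ N f : bounded_measurable f ->
  let h := (c0^-1 *: convolution (B N.+1) f)%R in
  convolution (S N.+1) (convolution (S N.+1) f) =
  (convolution (S N) (convolution (S N) f) +
   (convolution (S N.+1) h + convolution (S N) h))%R.
Proof.
move=> bf h; have [MA [_ _ lowP]] := lowpass_bounds lamP tphi.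
have [k1 _ _ _] := lowP N.+1; have [k0 _ _ _] := lowP N.
pose x1 := convolution (S N.+1) f; pose x0 := convolution (S N) f.
have b1 : bounded_measurable x1 := bounded_convolution lamP k1 bf.
have b0 : bounded_measurable x0 := bounded_convolution lamP k0 bf.
have b0N : bounded_measurable ((-1) *: x0)%R := bounded_measurableZ (-1)%R b0.
have hE : h = (x1 + (-1) *: x0)%R.
  have kN : kernel ((-1) *: S N)%R := kernelZ (-1)%R k0.
  have kD : kernel (S N.+1 + (-1) *: S N)%R := kernelD k1 kN.
  rewrite /h (blockSE c0N) -scaleN1r (convolutionZl lamP _ kD bf) scalerA mulVf// scale1r.
  by rewrite (convolutionDl lamP k1 kN bf) (convolutionZl lamP _ k0 bf).
rewrite hE (convolutionDr lamP k1 b1 b0N) (convolutionDr lamP k0 b1 b0N).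
rewrite (convolutionZr lamP _ k1 b0) (convolutionZr lamP _ k0 b0).
rewrite (convolutionAC lamP k0 k1 bf) -/x0 -/x1 !scaleN1r.
by rewrite subrKA [RHS]addrC subrK.
Qed.

Let pow2_ge0 (c : R) k : (0 <= c -> 0 <= c * 2 ^- k)%R.
Proof. by move=> c0'; rewrite mulr_ge0// invr_ge0 exprn_ge0. Qed.

Let pow2_le (c : R) k : (0 <= c -> c * 2 ^- k <= c)%R.
Proof. by move=> c0'; rewrite ler_piMr// invf_le1 ?exprn_gt0// exprn_ege1// ler1n. Qed.

Let powR_pow2 (c s : R) k : (0 <= c)%R -> ((c * 2 ^- k) `^ s = c `^ s * (2 ^- k) `^ s)%R.
Proof. by move=> c0'; rewrite powRM// invr_ge0 exprn_ge0. Qed.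

Let theta_const (A DA D s : R) (j k : nat) : (0 <= s <= 1)%R -> (k <= j)%N ->
  (0 <= A)%R -> (0 <= DA)%R -> (0 <= D)%R ->
  (A * (DA * 2 ^- k) `^ s * (D * (2 ^- (j - k)) ^+ 2) <=
   A * DA `^ s * D * (2 ^- j) `^ s * 2 ^- (j - k))%R.
Proof.
move=> s01 kj A0 DA0 D0; rewrite powR_pow2//.
have -> : (A * (DA `^ s * (2 ^- k) `^ s) * (D * (2 ^- (j - k)) ^+ 2) =
  (A * DA `^ s * D) * ((2 ^- k) `^ s * (2 ^- (j - k)) ^+ 2))%R by ring.
by rewrite -[leRHS]mulrA ler_wpM2l ?pow2_powR// !mulr_ge0 ?powR_ge0.
Qed.

Let lowpass_const (ms A AS MS s L : R) (j : nat) : (0 <= ms)%R -> (0 <= A)%R -> (0 <= AS)%R -> (0 <= MS)%R ->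
  (0 <= L)%R ->
  (expR (ms * (1 + AS * 2 ^- j)) * (A * (AS * 2 ^- j) `^ s * MS) * L <=
   expR (ms * (1 + AS)) * (A * AS `^ s * MS) * L * (2 ^- j) `^ s)%R.
Proof.
move=> ms0 A0 AS0 MS0 L0; rewrite powR_pow2//.
rewrite (_ : A * (AS `^ s * (2 ^- j) `^ s) * MS = A * AS `^ s * MS * (2 ^- j) `^ s)%R; last by ring.
rewrite -[leRHS]mulrA (mulrC L) [leRHS]mulrA ler_wpM2r// -[leRHS]mulrA.
rewrite ler_wpM2r ?mulr_ge0 ?powR_ge0// ler_expR ler_wpM2l// lerD2l; exact: pow2_le.
Qed.

Let block_const0 (b K u w : R) : (0 <= K)%R -> (0 <= u)%R -> (0 <= w)%R -> (0 <= b)%R ->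
  (K * u * w * b <= b * (K + K) * u * w)%R.
Proof.
move=> K0 u0 w0 b0; rewrite (_ : b * (K + K) * u * w = K * u * w * b + K * u * w * b)%R; last by ring.
by rewrite lerDl !mulr_ge0.
Qed.

(** Block N+1 is met with the filters of scales N+1 and N; the smaller weight 2^-(j-N) of the second
    is enlarged to that of the first, whence the sum K + K. *)
Let block_constS (b K u : R) (j N : nat) : (0 <= K)%R -> (0 <= u)%R -> (0 <= b)%R ->
  ((K * u * 2 ^- (j - N.+1) + K * u * 2 ^- (j - N)) * b <= b * (K + K) * u * 2 ^- (j - N.+1))%R.
Proof.
move=> K0 u0 b0; set w : R := (2 ^- (j - N.+1))%R; set w' : R := (2 ^- (j - N))%R.
have h : (w' <= w)%R by rewrite lef_pV2 ?posrE ?exprn_gt0// ler_weXn2l ?ler1n// leq_sub2l.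
rewrite (_ : b * (K + K) * u * w = (K * u * w + K * u * w) * b)%R; last by ring.
by rewrite ler_wpM2r// lerD2l ler_wpM2l// mulr_ge0.
Qed.

Let young_le (mu mu_star p r M : R) g f : (1 < p)%R -> (0 <= mu <= mu_star)%R -> (0 <= r)%R ->
  kernel g -> bounded_measurable f -> (forall z, (g z != 0 -> enorm z <= r)%R) ->
  \int[lam]_z `|g z|%:E <= M%:E ->
  weighted_Lp_norm mu p (convolution g f) <=
    (expR (mu_star * r) * M)%:E * weighted_Lp_norm mu p f.
Proof.
move=> p1 /andP[mu0 mu1] r0 kg bf gr gM.
apply: (le_trans (young_convolution lamP p1 mu0 r0 kg bf gr)).
apply: (lee_wpmul2r (weighted_Lp_norm_ge0 _ _ _)); rewrite EFinM; apply: (lee_pmul _ _ _ gM).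
- by rewrite lee_fin expR_ge0.
- by apply: integral_ge0 => z _; rewrite lee_fin normr_ge0.
- by rewrite lee_fin ler_expR; apply: ler_wpM2r.
Qed.

Let smoothing_le (mu mu_star p r M A s : R) (G Th : E -> R) a :
  (1 < p)%R -> (0 <= mu <= mu_star)%R -> (0 <= r)%R -> (0 <= A)%R -> (0 <= s)%R ->
  hoelder_kernel A s G -> kernel Th -> (forall y, (Th y != 0 -> enorm y <= r)%R) ->
  bounded_measurable a -> \int[lam]_z `|Th z|%:E <= M%:E ->
  weighted_Lp_norm mu p
    (convolution G (convolution Th a) - (\int[lam]_y Th y)%R *: convolution G a)%R <=
  (expR (mu_star * (1 + r)) * (A * r `^ s * M))%:E * weighted_Lp_norm mu p a.
Proof.
move=> p1 /andP[mu0 mu1] r0 A0 s0 [kG Gs GA Gm] kT Ts ba TM.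
apply: (le_trans (smoothing_convolution lamP p1 mu0 r0 ler01 A0 s0 kG Gs Gm kT Ts ba)).
apply: (lee_wpmul2r (weighted_Lp_norm_ge0 _ _ _)); rewrite [leRHS]EFinM.
have Ar : 0 <= (A * r `^ s)%:E by rewrite lee_fin mulr_ge0 ?powR_ge0.
have iT : 0 <= \int[lam]_y `|Th y|%:E by apply: integral_ge0 => z _; rewrite lee_fin normr_ge0.
apply: lee_pmul.
- by rewrite lee_fin expR_ge0.
- exact: mule_ge0.
- by rewrite lee_fin ler_expR; apply: ler_wpM2r => //; rewrite addr_ge0.
- by rewrite [leRHS]EFinM; exact: lee_wpmul2l.
Qed.

Let weighted_sum (x : nat -> \bar R) j : (forall k, 0 <= x k) ->
  [/\ 0 <= \sum_(0 <= k <oo) (geometric_weight j k)%:E * x k,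
    forall N, \sum_(0 <= k < N) (geometric_weight j k)%:E * x k <=
      \sum_(0 <= k <oo) (geometric_weight j k)%:E * x k &
    x j <= \sum_(0 <= k <oo) (geometric_weight j k)%:E * x k].
Proof.
move=> x0; have t0 i : 0 <= (geometric_weight j i)%:E * x i.
  by rewrite mule_ge0// lee_fin geometric_weight_ge0.
have le N : \sum_(0 <= k < N) (geometric_weight j k)%:E * x k <=
      \sum_(0 <= k <oo) (geometric_weight j k)%:E * x k.
  by apply: nneseries_lim_ge => i _ _; exact: t0.
split=> //; first by apply: nneseries_ge0 => i _ _; exact: t0.
apply: le_trans (le j.+1); rewrite big_nat_recr//=.
have -> : geometric_weight j j = 1%R :> R.
  by rewrite /geometric_weight leqnn subnn expr0 invr1.
by rewrite mul1e; apply: leeDr; apply: sume_ge0 => i _; exact: t0.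
Qed.

(** The weights 2^{j alpha} are kept out, so that [C] cannot depend on [alpha]; they are restored in
    [besov_convolution_le]. *)
Lemma block_estimate (s A mu_star p : R) : (1 < p)%R -> (0 <= s <= 1)%R -> (0 <= A)%R ->
  (0 <= mu_star)%R ->
  exists2 C : R, (0 < C)%R & forall mu, (0 <= mu <= mu_star)%R -> forall G,
    hoelder_kernel A s G -> forall f, test_function f -> forall j,
    weighted_Lp_norm mu p (convolution (B j) (convolution G f)) <=
    (C * (2 ^- j) `^ s)%:E *
      \sum_(0 <= k <oo) (geometric_weight j k)%:E * weighted_Lp_norm mu p (convolution (B k) f).
Proof.
move=> p1 s01 A0 ms0; have /andP[s0 s1] := s01.
have [[MS AS] [/= MS0 AS0 lowP]] := lowpass_bounds lamP tphi.
have [[MB AB] [/= MB0 AB0 blkP]] := block_bounds lamP tphi c0N.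
have [[D DA] [/= D0 DA0 thP]] := theta_bounds lamP tphi c0N moment1.
(* [K1] is for G * (a_j - S_j S_j a_j), its last factor being the cost of passing from a_j to a_j +
   S_j a_j; [K2] is for one kernel [theta], [K3] for two of them with the normalization of the
   block, and [K4] for the block j = 0. *)
pose K1 := (expR (mu_star * (1 + AS)) * (A * AS `^ s * MS) * (1 + expR (mu_star * AS) * MS))%R.
pose K2 := (expR (mu_star * (1 + DA)) * (A * DA `^ s * D))%R.
have K10 : (0 <= K1)%R by rewrite !mulr_ge0 ?expR_ge0 ?powR_ge0// addr_ge0// mulr_ge0 ?expR_ge0.
have K20 : (0 <= K2)%R by rewrite !mulr_ge0 ?expR_ge0 ?powR_ge0.
pose K3 := (`|c0^-1| * (K2 + K2))%R.
have K30 : (0 <= K3)%R by rewrite mulr_ge0// addr_ge0.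
pose K4 := (expR (mu_star * 1) * A)%R.
have K40 : (0 <= K4)%R by rewrite mulr_ge0 ?expR_ge0.
exists (K1 + K3 + K4 + 1)%R; first by rewrite ltr_wpDl// !addr_ge0.
move=> mu mu01 G hG f tf j; have /andP[mu0 mu1] := mu01.
set W := weighted_Lp_norm mu p.
have W0 h : 0 <= W h := weighted_Lp_norm_ge0 mu p h.
have [kG Gsupp GA Gmod] := hG.
have bf := test_function_bounded_measurable tf.
pose a k := convolution (B k) f.
have kB k : kernel (B k) by have [] := blkP k.
have kS k : kernel (S k) by have [] := lowP k.
have bc g h : kernel g -> bounded_measurable h -> bounded_measurable (convolution g h).
  exact: bounded_convolution.
have ba k : bounded_measurable (a k) by exact: bc.
have w0 i k : (0 <= geometric_weight i k :> R)%R := geometric_weight_ge0 i k.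
have CjE : convolution (B j) (convolution G f) = convolution G (a j).
  by rewrite (convolutionAC lamP).
rewrite CjE.
have [SW0 SWN SWj] := weighted_sum j (fun k => W0 (a k)).
set SW := \sum_(0 <= i <oo) _ in SW0 SWN SWj.
have -> : \sum_(0 <= k <oo) (geometric_weight j k)%:E * W (convolution (B k) f) = SW by [].
clearbody SW.
(* Block 0 has no vanishing mean, so [theta_bounds] does not cover it; as 2^-j = 1 there is nothing
   to gain, and Young's inequality with the mass of [G] suffices. *)
have [j0|j0] := posnP j.
  have Gle := young_le p1 mu01 ler01 kG (ba j) Gsupp GA.
  apply: (le_trans Gle); apply: lee_pmul.
  - by rewrite lee_fin.
  - exact: W0.
  - by rewrite j0 expr0 invr1 powR1 mulr1 lee_fin -addrA addrCA lerDl !addr_ge0.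
  - exact: SWj.
pose uj : R := ((2 ^- j) `^ s)%R.
have uj0' : (0 <= uj)%R by exact: powR_ge0.
have e1 : W (convolution G (a j) - convolution G (convolution (S j) (convolution (S j) (a j))))%R <=
    (K1 * uj)%:E * W (a j).
  have [kSj bSj sS iS] := lowP j.
  pose Sa := convolution (S j) (a j); pose SSa := convolution (S j) Sa.
  have bSa : bounded_measurable Sa := bc _ _ kSj (ba j).
  have bSSa : bounded_measurable SSa := bc _ _ kSj bSa.
  have bb : bounded_measurable (a j + Sa)%R := bounded_measurableD (ba j) bSa.
  set X := (_ - _)%R.
  have XE : X = (-1)%R *: (convolution G (convolution (S j) (a j + Sa)%R) -
      1 *: convolution G (a j + Sa)%R)%R.
    have E1 : convolution (S j) (a j + Sa)%R = (Sa + SSa)%R := convolutionDr lamP kSj (ba j) bSa.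
    have E2 : convolution G (a j + Sa)%R = (convolution G (a j) + convolution G Sa)%R :=
      convolutionDr lamP kG (ba j) bSa.
    have E3 : convolution G (Sa + SSa)%R = (convolution G Sa + convolution G SSa)%R :=
      convolutionDr lamP kG bSa bSSa.
    have E4 := etrans (congr1 (convolution G) E1) E3.
    exact: (telescope E4 E2).
  have mX : measurable_fun setT (convolution G (convolution (S j) (a j + Sa)%R) -
      1 *: convolution G (a j + Sa)%R)%R.
    rewrite scale1r.
    have [m1 _] := bc _ _ kG (bc _ _ kSj bb).
    have [m2 _] := bc _ _ kG bb.
    exact: measurable_funB.
  rewrite XE /W (weighted_Lp_normZ lamP mu p1 _ mX) normrN normr1 mul1e -/W.
  have sm := smoothing_le p1 mu01 (pow2_ge0 j AS0) A0 s0 hG kSj sS bb iS.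
  rewrite (integral_lowpass lamP tphi c0N) in sm; apply: (le_trans sm).
  have sS' z : (S j z != 0 -> enorm z <= AS)%R.
    by move=> /sS /le_trans; apply; exact: pow2_le.
  have Wb : W (a j + Sa)%R <= (1 + expR (mu_star * AS) * MS)%:E * W (a j).
    apply: (le_trans (weighted_Lp_normD lamP mu p1 (ba j).1 bSa.1)).
    have c1 : 0 <= (expR (mu_star * AS) * MS)%:E.
      by rewrite lee_fin; exact: (mulr_ge0 (expR_ge0 _) MS0).
    rewrite EFinD (ge0_muleDl _ lee01 c1) mul1e.
    apply: leeD; first exact: lexx.
    exact: (young_le p1 mu01 AS0 kSj (ba j) sS' iS).
  apply: (@le_trans _ _ ((expR (mu_star * (1 + AS * 2 ^- j)) * (A * (AS * 2 ^- j) `^ s * MS))%:E *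
     ((1 + expR (mu_star * AS) * MS)%:E * W (a j)))).
    by apply: lee_wpmul2l Wb; rewrite lee_fin !mulr_ge0 ?powR_ge0 ?expR_ge0.
  rewrite muleA -EFinM; apply: (lee_wpmul2r (W0 (a j))); rewrite lee_fin.
  apply: (lowpass_const s j ms0 A0 AS0 MS0).
  exact: (addr_ge0 ler01 (mulr_ge0 (expR_ge0 _) MS0)).
(* Associativity gathers the block and the filter into [theta j k], whose zero mean kills the
   subtracted term of the smoothing estimate. *)
have T k h : (k <= j)%N -> bounded_measurable h ->
    W (convolution G (convolution (B j) (convolution (S k) h))) <=
    (K2 * uj * 2 ^- (j - k))%:E * W h.
  move=> kj bh; have [kSk bSk sS iS] := lowP k.
  have [kt ts it t0] := thP j k j0 kj.
  rewrite (convolutionA lamP (kB j) kSk bSk bh) -/(theta lam phi0 j k).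
  have := smoothing_le p1 mu01 (pow2_ge0 k DA0) A0 s0 hG kt ts bh it.
  rewrite t0 scale0r subr0 => /le_trans; apply.
  apply: (lee_wpmul2r (W0 h)); rewrite lee_fin /K2 -[leRHS]mulrA -[leRHS]mulrA; apply: ler_pM.
  - exact: expR_ge0.
  - apply: mulr_ge0; first exact: (mulr_ge0 A0 (powR_ge0 _ _)).
    exact: (mulr_ge0 D0 (sqr_ge0 _)).
  - rewrite ler_expR; apply: (ler_wpM2l ms0); rewrite lerD2l; exact: pow2_le.
  - rewrite [leRHS]mulrA; exact: theta_const.
pose Q N := convolution (S N) (convolution (S N) f).
have bQ N : bounded_measurable (Q N) by exact: (bc _ _ (kS N) (bc _ _ (kS N) bf)).
(* Induction on the top frequency [N] of the telescoping sum, the block j being fixed; only N = j is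
   used afterwards. *)
have e2 N : (N <= j)%N -> W (convolution G (convolution (B j) (Q N))) <=
    \sum_(0 <= k < N.+1) (K3 * uj)%:E * ((geometric_weight j k)%:E * W (a k)).
  pose h k := (c0^-1 *: a k)%R.
  have bh k : bounded_measurable (h k) := bounded_measurableZ _ (ba k).
  have Wh k : W (h k) = `|c0^-1|%:E * W (a k) := weighted_Lp_normZ lamP mu p1 c0^-1 (ba k).1.
  have bSh i k : bounded_measurable (convolution (S i) (h k)) := bc _ _ (kS i) (bh k).
  have bGB g : bounded_measurable g -> bounded_measurable (convolution G (convolution (B j) g)).
    by move=> bg; exact: (bc _ _ kG (bc _ _ (kB j) bg)).
  have GBD f1 f2 : bounded_measurable f1 -> bounded_measurable f2 ->
      W (convolution G (convolution (B j) (f1 + f2)%R)) <=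
      W (convolution G (convolution (B j) f1)) + W (convolution G (convolution (B j) f2)).
    move=> b1 b2.
    have E1 := convolutionDr lamP (kB j) b1 b2.
    have E2 := convolutionDr lamP kG (bc _ _ (kB j) b1) (bc _ _ (kB j) b2).
    rewrite (etrans (congr1 (convolution G) E1) E2).
    exact: (weighted_Lp_normD lamP mu p1 (bGB _ b1).1 (bGB _ b2).1).
  elim: N => [|N IH] Nj.
    rewrite big_nat1 /Q (c0V_block0 bf).
    apply: (le_trans (T 0%N (h 0%N) Nj (bh 0%N))); rewrite Wh.
    rewrite !muleA -!EFinM; apply: (lee_wpmul2r (W0 _)); rewrite lee_fin.
    rewrite /geometric_weight leq0n; exact: block_const0.
  have NJ := ltnW Nj.
  have QS : Q N.+1 = (Q N + (convolution (S N.+1) (h N.+1) + convolution (S N) (h N.+1)))%R :=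
    lowpass_square_succ N bf.
  rewrite (big_nat_recr _ _ _ (leq0n N.+1)) QS.
  apply: (le_trans (GBD _ _ (bQ N) (bounded_measurableD (bSh _ _) (bSh _ _)))).
  apply: (leeD (IH NJ)).
  apply: (le_trans (GBD _ _ (bSh _ _) (bSh _ _))).
  apply: (le_trans (leeD (T N.+1 (h N.+1) Nj (bh _)) (T N (h N.+1) NJ (bh _)))).
  have k1 : 0 <= (K2 * uj * 2 ^- (j - N.+1))%:E.
    by rewrite lee_fin; apply: mulr_ge0; [exact: mulr_ge0|rewrite invr_ge0 exprn_ge0].
  have k2 : 0 <= (K2 * uj * 2 ^- (j - N))%:E.
    by rewrite lee_fin; apply: mulr_ge0; [exact: mulr_ge0|rewrite invr_ge0 exprn_ge0].
  rewrite -(ge0_muleDl _ k1 k2) Wh !muleA -!EFinD -!EFinM; apply: (lee_wpmul2r (W0 _)).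
  rewrite lee_fin /geometric_weight Nj; exact: block_constS.
have QE : convolution G (convolution (S j) (convolution (S j) (a j))) =
    convolution G (convolution (B j) (Q j)).
  have E5 : convolution (S j) (a j) = convolution (B j) (convolution (S j) f) :=
    convolutionAC lamP (kS j) (kB j) bf.
  have E6 : convolution (S j) (convolution (B j) (convolution (S j) f)) = convolution (B j) (Q j) :=
    convolutionAC lamP (kS j) (kB j) (bc _ _ (kS j) bf).
  exact: (congr1 (convolution G) (etrans (congr1 (convolution (S j)) E5) E6)).
have bGa : bounded_measurable (convolution G (a j)) := bc _ _ kG (ba j).
have bGQ : bounded_measurable (convolution G (convolution (B j) (Q j))) :=
  bc _ _ kG (bc _ _ (kB j) (bQ j)).
rewrite QE in e1.
move: (e2 j (leqnn j)) bGa bGQ e1.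
move: (convolution G (a j)) (convolution G (convolution (B j) (Q j))) => u v e2j bu bv e1.
have uE : u = ((u - v) + v)%R by rewrite subrK.
have muv : measurable_fun setT (u - v)%R by apply: measurable_funB; [exact: bu.1|exact: bv.1].
rewrite uE; apply: (le_trans (weighted_Lp_normD lamP mu p1 muv bv.1)).
have K1u : 0 <= (K1 * uj)%:E by rewrite lee_fin; exact: mulr_ge0.
have K3u : 0 <= (K3 * uj)%:E by rewrite lee_fin; exact: mulr_ge0.
apply: (@le_trans _ _ ((K1 * uj)%:E * SW + (K3 * uj)%:E * SW)).
  apply: leeD.
    by apply: (le_trans e1); apply: (lee_wpmul2l K1u).
  apply: (le_trans e2j); rewrite -ge0_sume_distrr; last first.
    by move=> k _; apply: mule_ge0; [rewrite lee_fin; exact: w0|exact: W0].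
  by apply: (lee_wpmul2l K3u).
rewrite -(ge0_muleDl _ K1u K3u); apply: (lee_wpmul2r SW0).
by rewrite -EFinD lee_fin -mulrDl; apply: (ler_wpM2r uj0'); rewrite -addrA lerDl addr_ge0.
Qed.

End block_estimate.

(** * The wave kernel *)

Section layer_cake.
Local Open Scope ereal_scope.
Context {R : realType} d (T : measurableType d) (m : {sigma_finite_measure set T -> \bar R}).
Local Notation leb := (@lebesgue_measure R).
Implicit Types (F H : T -> R).

(** |F x - H x| is the length of the interval of levels that separate F x from H x; Tonelli on the
    region between the two graphs exchanges points and levels. *)
Lemma integral_dist_superlevel F H : measurable_fun setT F -> measurable_fun setT H ->
  let Psi := fun l : R => m [set x | (l < F x)%R != (l < H x)%R] in
  [/\ forall l, measurable [set x | (l < F x)%R != (l < H x)%R], measurable_fun setT Psi &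
    \int[m]_x `|F x - H x|%:E = \int[leb]_l Psi l].
Proof.
move=> mF mH Psi.
pose S := [set z : T * R | (F z.1 <= z.2)%R && (z.2 < H z.1)%R] `|`
  [set z : T * R | (H z.1 <= z.2)%R && (z.2 < F z.1)%R].
have mF1 : measurable_fun setT (fun z : T * R => F z.1) by exact: (measurableT_comp mF).
have mH1 : measurable_fun setT (fun z : T * R => H z.1) by exact: (measurableT_comp mH).
have m2 : measurable_fun setT (fun z : T * R => z.2) by exact: measurable_snd.
have mle (u v w : T * R -> R) : measurable_fun setT u -> measurable_fun setT v -> measurable_fun setT w ->
    measurable [set z | (u z <= v z)%R && (v z < w z)%R].
  move=> mu mv mw; rewrite -[X in measurable X]setTI.
  apply: (_ : measurable_fun setT (fun z => (u z <= v z)%R && (v z < w z)%R)) => //.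
  by apply: measurable_and; [exact: measurable_fun_ler|exact: measurable_fun_ltr].
have mS : measurable S by apply: measurableU; exact: mle.
have yE l : ysection S l = [set x | (l < F x)%R != (l < H x)%R].
  apply/seteqP; split=> x; rewrite /ysection/= inE/=.
    by move=> [|] /andP[a b]; rewrite b ltNge a.
  by case: ltP => h1; case: ltP => h2 //= _; [right|left]; apply/andP.
have PsiE : m \o ysection S = Psi by apply/funext => l; rewrite /= yE.
split.
- by move=> l; rewrite -yE; exact: measurable_ysection.
- by rewrite -PsiE; exact: measurable_fun_ysection.
have := indic_fubini_tonelli m leb mS.
rewrite indic_fubini_tonelli_FE// indic_fubini_tonelli_GE// PsiE => <-.
apply: eq_integral => x _ /=.
have -> : xsection S x = `[Order.min (F x) (H x), Order.max (F x) (H x)[%classic.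
  apply/seteqP; split=> l; rewrite /xsection/= inE/= in_itv/= ge_min lt_max.
    by move=> [|] /andP[-> ->]; rewrite ?orbT.
  move=> /andP[/orP[] a /orP[] b].
  - by have := le_lt_trans a b; rewrite ltxx.
  - by left; apply/andP.
  - by right; apply/andP.
  - by have := le_lt_trans a b; rewrite ltxx.
rewrite lebesgue_measure_itv/= lte_fin.
case: (ltgtP (F x) (H x)) => [h|h|->]; rewrite ?ltxx ?subrr ?normr0// ?h -EFinB.
- by rewrite distrC gtr0_norm// subr_gt0.
- by rewrite gtr0_norm// subr_gt0.
Qed.

End layer_cake.

Section inverse_square.
Local Open Scope ereal_scope.
Context {R : realType}.
Local Notation leb := (@lebesgue_measure R).

Lemma integral_inverse_square (L : R) : (0 < L)%R ->
  \int[leb]_(x in `[L, +oo[) (x ^- 2)%:E = (L^-1)%:E.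
Proof.
move=> L0; pose F x : R := (- x^-1)%R.
have dF (x : R) : (0 < x)%R -> is_derive x (1%R : R) F (x ^- 2)%R.
  move=> x0.
  apply: (is_derive_eq (is_deriveN (is_deriveV (lt0r_neq0 x0) (is_derive_id x (1%R : R))))).
  by rewrite scaleNr opprK [LHS]mulr1.
have cF (x : R) : (0 < x)%R -> {for x, continuous F}.
  by move=> x0; apply: differentiable_continuous; apply/derivable1_diffP; have [] := dF x x0.
rewrite (@ge0_continuous_FTC2y _ (fun x => (x ^- 2)%R) F L 0%R).
- by rewrite /F sub0e -EFinN opprK.
- by move=> x Lx; rewrite invr_ge0 exprn_ge0// (le_trans (ltW L0)).
- apply: continuous_in_subspaceT => x; rewrite inE/= in_itv/= andbT => Lx.
  have x0 := lt_le_trans L0 Lx.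
  by apply: (@cvgV _ _ _ _ _ (x ^+ 2)%R); [rewrite expf_neq0// gt_eqF|exact: exprn_continuous].
- rewrite -oppr0; apply: cvgN; apply/gtr0_cvgV0; last exact: cvg_id.
  exact: nbhs_pinfty_gt.
- by move=> x Lx; have [] := dF x (lt_trans L0 Lx).
- exact: (cvg_at_right_filter (cF L L0)).
- move=> x; rewrite in_itv/= andbT => Lx.
  by rewrite derive1E; have [_ ->] := dF x (lt_trans L0 Lx).
Qed.

(** The bound a is integrated over [0, L] and b / l^2 over [L, +oo[. The cut [L] is left free, to be
    chosen so as to balance the two. *)
Lemma integral_le_min_inverse_square (Psi : R -> \bar R) (a b L : R) : (0 < L)%R ->
  (0 <= a)%R -> (0 <= b)%R -> measurable_fun setT Psi -> (forall l, 0 <= Psi l) ->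
  (forall l, (l < 0)%R -> Psi l = 0) -> (forall l, (0 <= l)%R -> Psi l <= a%:E) ->
  (forall l, (0 < l)%R -> Psi l <= (b * l ^- 2)%:E) ->
  \int[leb]_l Psi l <= (a * L + b / L)%:E.
Proof.
move=> L0 a0 b0 mPsi Psi0 Psin Psia Psib.
pose g1 (l : R) := (a * \1_(`[0%R, L]%classic) l)%:E.
pose g2 (l : R) := (b * (l ^- 2 * \1_(`[L, +oo[%classic) l))%:E.
have m2 : measurable_fun setT (fun l : R => l ^- 2 * \1_(`[L, +oo[%classic) l)%R.
  apply: measurable_funM; last exact: measurable_indic.
  have -> : (fun l : R => l ^- 2)%R = (fun l => (l ^+ 2) `^ (-1))%R.
    by apply/funext => l; rewrite powR_inv1// sqr_ge0.
  by apply: (measurableT_comp (measurable_powR _)); apply: measurable_funX.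
have mg1 : measurable_fun setT g1.
  by apply/measurable_EFinP; apply: measurable_funM => //; exact: measurable_indic.
have mg2 : measurable_fun setT g2 by apply/measurable_EFinP; apply: measurable_funM.
have g10 l : setT l -> 0 <= g1 l by move=> _; rewrite lee_fin mulr_ge0// indicE ler0n.
have g20 l : setT l -> 0 <= g2 l.
  by move=> _; rewrite lee_fin !mulr_ge0// ?invr_ge0 ?sqr_ge0// indicE ler0n.
apply: (@le_trans _ _ (\int[leb]_l (g1 l + g2 l))).
  apply: ge0_le_integral.
  - exact: measurableT.
  - by move=> l _; exact: Psi0.
  - exact: mPsi.
  - exact: emeasurable_funD.
  - move=> l _; have [l0|l0] := ltP l 0%R.
      by rewrite Psin// adde_ge0// ?g10// g20.
    have [lL|lL] := leP l L.
      apply: (le_trans (Psia l l0)); rewrite -[leLHS]adde0; apply: leeD; last exact: g20.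
      by rewrite /g1 indicE mem_set ?mulr1//= in_itv/= l0.
    have l1 := lt_trans L0 lL.
    apply: (le_trans (Psib l l1)); rewrite -[leLHS]add0e; apply: leeD; first exact: g10.
    by rewrite /g2 indicE mem_set ?mulr1//= in_itv/= andbT ltW.
have -> : \int[leb]_l (g1 l + g2 l) = \int[leb]_l g1 l + \int[leb]_l g2 l.
  exact: ge0_integralD.
rewrite EFinD; apply: leeD.
  have -> : \int[leb]_l g1 l = a%:E * \int[leb]_l (\1_(`[0%R, L]%classic) l)%:E.
    rewrite -(ge0_integralZl_EFin leb measurableT _ _ a0)//.
    by apply/measurable_EFinP; exact: measurable_indic.
  have E : leb `[0%R, L]%classic = L%:E by rewrite lebesgue_measure_itv/= lte_fin L0 sube0.
  by rewrite integral_indic// setIT [X in _ * X]E -EFinM.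
have -> : \int[leb]_l g2 l = b%:E * \int[leb]_l (l ^- 2 * \1_(`[L, +oo[%classic) l)%:E.
  rewrite -(ge0_integralZl_EFin leb measurableT _ _ b0)//.
    by move=> l _; rewrite lee_fin mulr_ge0 ?invr_ge0 ?sqr_ge0// indicE ler0n.
  exact/measurable_EFinP.
rewrite EFinM; apply: lee_wpmul2l; first by rewrite lee_fin.
rewrite -(integral_inverse_square L0) [leRHS]integral_mkcond le_eqVlt; apply/orP; left.
apply/eqP; apply: eq_integral => l _; rewrite patchE indicE.
by case: ifP => _; rewrite ?mulr1 ?mulr0.
Qed.

End inverse_square.

(** * Volume of balls and of their translates *)

Section balls.
Local Open Scope ereal_scope.
Context {R : realType} (n : nat) (lam : {sigma_finite_measure set 'rV[R]_n -> \bar R}).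
Hypothesis lamP : is_lebesgue lam.
Hypothesis n12 : (0 < n <= 2)%N.
Local Notation E := 'rV[R]_n.
Implicit Types (x y z : E).

Lemma measurable_ball_le (r : R) : measurable [set x : E | (enorm x <= r)%R].
Proof.
rewrite -[X in measurable X]setTI.
apply: (_ : measurable_fun setT (fun x : E => (enorm x <= r)%R)) => //.
by apply: measurable_fun_ler => //; exact: measurable_enorm.
Qed.

Lemma measurable_ball_lt (r : R) : measurable [set x : E | (enorm x < r)%R].
Proof.
rewrite -[X in measurable X]setTI.
apply: (_ : measurable_fun setT (fun x : E => (enorm x < r)%R)) => //.
by apply: measurable_fun_ltr => //; exact: measurable_enorm.
Qed.

(** Kept as an unspecified number, finite because the ball lies in a cube; scaling gives the other
    balls. *)
Definition ball_volume : R := fine (lam [set x : E | (enorm x <= 1)%R]).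
Local Notation kap := ball_volume.

Lemma ball_volume_ge0 : (0 <= kap)%R. Proof. exact: fine_ge0. Qed.

Let ball_fin (r : R) : (0 <= r)%R ->
  lam [set x : E | (enorm x <= r)%R] <= ((2 * r) ^+ n)%:E.
Proof.
move=> r0; apply: le_trans (lebesgue_cube lamP r0).
apply: le_measure; rewrite ?inE; [exact: measurable_ball_le|exact: measurable_cube|].
by move=> x /= xr i; apply: le_trans (ler_enorm_coord x i) xr.
Qed.

Lemma lebesgue_ball (r : R) : (0 <= r)%R ->
  lam [set x : E | (enorm x <= r)%R] = (kap * r ^+ n)%:E.
Proof.
have /andP[n0 _] := n12.
rewrite le_eqVlt => /orP[/eqP<-|r0].
  apply/eqP; rewrite eq_le; apply/andP; split.
    by apply: (le_trans (ball_fin (lexx 0%R))); rewrite !mulr0 expr0n gtn_eqF// mulr0.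
  by rewrite expr0n gtn_eqF// mulr0.
have rN : (r^-1 != 0)%R by rewrite invr_eq0 gt_eqF.
have -> : [set x : E | (enorm x <= r)%R] =
    [set x : E | [set x : E | (enorm x <= 1)%R] (r^-1 *: x + 0)%R].
  apply/seteqP; split=> x /=; rewrite addr0 enormZ gtr0_norm ?invr_gt0//;
    by rewrite ler_pdivrMl// mulr1.
rewrite (lebesgue_affine lamP 0%R rN (measurable_ball_le 1)).
rewrite gtr0_norm ?invr_gt0// exprVn invrK.
rewrite -[X in _ * X]fineK; first by rewrite -EFinM mulrC.
rewrite ge0_fin_numE//; apply: (le_lt_trans (ball_fin ler01)).
exact: ltry.
Qed.

(** The inner radius is r - 2 h rather than r - h, so that points with |x| = r - h belong to the
    annulus as soon as h > 0, although a closed ball is removed. *)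
Let annulus (r h : R) := [set x : E | (enorm x <= r + h)%R] `\`
  [set x : E | (enorm x <= r - 2 * h)%R].

(** If r < 2 h, the outer ball alone has volume at most kap (3 h)^n. Otherwise the difference of
    powers is 3 h for n = 1 and 6 r h - 3 h^2 for n = 2. All are at most 9 h times kap. *)
Let annulus_volume (r h : R) : (0 <= r <= 1)%R -> (0 <= h <= 1)%R ->
  lam (annulus r h) <= (9 * kap * h)%:E.
Proof.
move=> /andP[r0 r1] /andP[h0 h1].
have k0 := ball_volume_ge0.
have [rh|rh] := ltP (r - 2 * h)%R 0%R.
  apply: (@le_trans _ _ (lam [set x : E | (enorm x <= r + h)%R])).
    apply: le_measure; rewrite ?inE.
    - by apply: measurableD; exact: measurable_ball_le.
    - exact: measurable_ball_le.
    - by move=> x [].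
  rewrite lebesgue_ball ?addr_ge0// lee_fin (mulrC 9)%R -mulrA ler_wpM2l//.
  move: n12; case: (n) => [//|[|[|//]]] _; rewrite ?expr1 ?expr2; nra.
have foo : lam [set x : E | (enorm x <= r + h)%R] < +oo.
  by apply: (le_lt_trans (ball_fin (addr_ge0 r0 h0))); exact: ltry.
have -> : lam (annulus r h) = lam [set x : E | (enorm x <= r + h)%R] -
    lam ([set x : E | (enorm x <= r + h)%R] `&` [set x : E | (enorm x <= r - 2 * h)%R]).
  exact: (measureD (measurable_ball_le _) (measurable_ball_le _) foo).
rewrite (_ : _ `&` _ = [set x : E | (enorm x <= r - 2 * h)%R]); last first.
  apply/seteqP; split=> x /=; first by case.
  by move=> xr; split=> //; apply: (le_trans xr); lra.
rewrite (lebesgue_ball (addr_ge0 r0 h0)) (lebesgue_ball rh) -EFinB lee_fin -mulrBr (mulrC 9)%R -mulrA ler_wpM2l//.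
move: n12; case: (n) => [//|[|[|//]]] _; rewrite ?expr1 ?expr2; nra.
Qed.

(** The symmetric difference of A + y and A. *)
Definition shift_diff (A : set E) y := [set z | A (z - y)%R /\ ~ A z \/ ~ A (z - y)%R /\ A z].

Lemma measurable_shift (A : set E) y : measurable A -> measurable [set z | A (z - y)%R].
Proof.
move=> mA; rewrite -[X in measurable X]setTI.
have := measurable_subr (measurable_id (D := setT) : measurable_fun setT (@id E)) (measurable_cst y).
exact.
Qed.

Lemma measurable_shift_diff (A : set E) y : measurable A -> measurable (shift_diff A y).
Proof.
move=> mA; have mAy := measurable_shift y mA.
rewrite (_ : shift_diff A y = ([set z | A (z - y)%R] `\` A) `|` (~` [set z | A (z - y)%R] `&` A))//.
apply: measurableU; first exact: measurableD.
by apply: measurableI => //; exact: measurableC.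
Qed.

Lemma lebesgue_shift (A : set E) y : measurable A -> lam [set z | A (z - y)%R] = lam A.
Proof.
move=> mA; have := lebesgue_affine lamP (- y)%R (oner_neq0 R) mA.
rewrite normr1 expr1n invr1 mul1e => <-; congr (lam _).
by apply/funext => z /=; rewrite scale1r.
Qed.

(** [A] is an open or a closed ball of radius [r]; the symmetric difference lies in an
    annulus of width [3 |y|]. *)
Lemma shift_ball_volume (A : set E) (r : R) y : (0 <= r <= 1)%R -> measurable A ->
  (forall x, (enorm x < r)%R -> A x) -> (forall x, A x -> (enorm x <= r)%R) ->
  lam (shift_diff A y) <= (9 * kap * enorm y)%:E.
Proof.
move=> r01 mA Alt Ale; have /andP[r0 r1] := r01.
have k0 := ball_volume_ge0.
have mAy := measurable_shift y mA.
have mS := measurable_shift_diff y mA.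
have y0 := enorm_ge0 y.
have [y1|y1] := leP (enorm y) 1%R.
  apply: (@le_trans _ _ (lam (annulus r (enorm y)))); last exact/annulus_volume/andP.
  (* The inclusion in the annulus needs |y| > 0, since the annulus of width 0 misses the sphere of
     radius r. *)
  have [->|yN] := eqVneq y 0%R.
    rewrite (_ : shift_diff A _ = set0) ?measure0//.
    by apply/seteqP; split=> z //=; rewrite /shift_diff/= subr0 => -[[]|[]].
  have yp : (0 < enorm y)%R by rewrite lt_neqAle enorm_ge0 eq_sym enorm_eq0 yN.
  apply: le_measure; rewrite ?inE//.
    by apply: measurableD; exact: measurable_ball_le.
  move=> z /=; have t1 := ler_enormD (z - y) y; rewrite subrK in t1.
  have t2 := ler_enormD z (- y); rewrite enormN in t2.
  have n1 : ~ A z -> (r <= enorm z)%R by rewrite leNgt => nA; apply/negP => /Alt.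
  have n2 : ~ A (z - y)%R -> (r <= enorm (z - y))%R by rewrite leNgt => nA; apply/negP => /Alt.
  move=> [[/Ale a /n1 b]|[/n2 a /Ale b]]; split=> /=; first lra.
  - by apply/negP; rewrite -ltNge; lra.
  - lra.
  - by apply/negP; rewrite -ltNge; lra.
(* For |y| > 1 the translation may be large, but the two sets together have volume at most 2 kap. *)
apply: (@le_trans _ _ (lam [set z | A (z - y)%R] + lam A)).
  apply: (@le_trans _ _ (lam ([set z | A (z - y)%R] `|` A))); last exact: measureU2.
  apply: le_measure; rewrite ?inE//; first exact: measurableU.
  by move=> z [[? _]|[_ ?]]; [left|right].
have lA : lam A <= kap%:E.
  apply: (@le_trans _ _ (lam [set x : E | (enorm x <= r)%R])).
    by apply: le_measure; rewrite ?inE//; exact: measurable_ball_le.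
  by rewrite lebesgue_ball// lee_fin ler_piMr// exprn_ile1.
rewrite (lebesgue_shift y mA).
apply: (le_trans (leeD lA lA)); rewrite -EFinD lee_fin.
by rewrite -mulr2n -mulr_natl; nra.
Qed.

End balls.

(** * The wave kernel in dimension 1 *)

Section wave_kernel1.
Local Open Scope ereal_scope.
Context {R : realType}.
Local Notation E := 'rV[R]_1.
Local Notation lam := (@lebesgue1 R).
Local Notation kap := (ball_volume lam).
Let lamP := @is_lebesgue1 R.

(** The kernel is half the indicator of a ball, so its increments are bounded by the indicator of
    the symmetric difference of the ball and its translate; 9 comes from [shift_ball_volume]. *)
Lemma hoelder_wave_kernel1 (t : R) : (0 <= t <= 1)%R ->
  hoelder_kernel lam (9 * kap)%R 1%R (wave_kernel t : E -> R).
Proof.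
move=> t01; have /andP[t0 t1] := t01.
have k0 : (0 <= kap)%R := ball_volume_ge0 lam.
pose Bt := [set x : E | (enorm x < t)%R].
have mBt : measurable Bt := measurable_ball_lt t.
have GE (x : E) : wave_kernel t x = (2^-1 * \1_Bt x)%R.
  rewrite /wave_kernel indicE; case: ifPn => h; first by rewrite mem_set// mulr1.
  by rewrite memNset ?mulr0//; exact/negP.
have mG : measurable_fun setT (wave_kernel t : E -> R).
  rewrite (funext GE); apply: measurable_funM => //; exact: measurable_indic.
have indic_le (b : R) : (0 <= b <= 1)%R -> (`|2^-1 * b| <= b)%R.
  by move=> /andP[b0 b1]; rewrite ger0_norm ?mulr_ge0// ler_piMl// invf_le1// ler1n.
have normG : \int[lam]_z `|wave_kernel t z|%:E <= (9 * kap)%:E.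
  apply: (@le_trans _ _ (\int[lam]_z (\1_Bt z)%:E)).
    apply: ge0_le_integral.
    - exact: measurableT.
    - by move=> z _; rewrite lee_fin.
    - by apply/measurable_EFinP; exact: measurableT_comp.
    - by apply/measurable_EFinP; exact: measurable_indic.
    - by move=> z _; rewrite lee_fin GE; apply: indic_le; rewrite indicE ler0n lern1 leq_b1.
  rewrite integral_indic// setIT.
  apply: (@le_trans _ _ (lam [set x : E | (enorm x <= 1)%R])).
    apply: le_measure; rewrite ?inE//; first exact: measurable_ball_le.
    by move=> x /= xt; exact: (le_trans (ltW xt)).
  by rewrite (lebesgue_ball lamP _ ler01)// expr1n mulr1 lee_fin ler_peMl// ler1n.
split.
- apply/integrableP; split; first exact/measurable_EFinP.
  exact: (le_lt_trans normG (ltry _)).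
- by move=> z; rewrite /wave_kernel; case: ifPn => [h _|]; [exact: (le_trans (ltW h))|rewrite eqxx].
- exact: normG.
move=> y.
pose S := shift_diff Bt y.
have mS : measurable S := measurable_shift_diff y mBt.
apply: (@le_trans _ _ (\int[lam]_z (\1_S z)%:E)).
  apply: ge0_le_integral.
  - exact: measurableT.
  - by move=> z _; rewrite lee_fin.
  - apply/measurable_EFinP; apply: measurableT_comp => //; apply: measurable_funB => //.
    apply: (measurableT_comp mG).
    exact: (measurable_subr (measurable_id (D := setT)) (measurable_cst y)).
  - by apply/measurable_EFinP; exact: measurable_indic.
  - move=> z _; rewrite lee_fin !GE -mulrBr; have [zS|zS] := pselect (S z).
      rewrite [in leRHS]indicE mem_set// normrM ger0_norm ?invr_ge0//.
      apply: (@le_trans _ _ (2^-1 * 1)%R); last by rewrite mulr1 invf_le1// ler1n.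
      rewrite ler_pM2l// !indicE.
      by case: (_ \in _); case: (_ \in _); rewrite ?subrr ?subr0 ?sub0r ?normrN ?normr0 ?normr1.
    rewrite [in leRHS]indicE memNset// normr_le0 mulf_eq0 subr_eq0.
    apply/orP; right; apply/eqP; rewrite !indicE; congr (_%:R); congr nat_of_bool.
    have [b1|b1] := pselect (Bt (z - y)%R); have [b2|b2] := pselect (Bt z).
    - by rewrite !mem_set.
    - by exfalso; apply: zS; left.
    - by exfalso; apply: zS; right.
    - by rewrite !memNset.
rewrite integral_indic// setIT powRr1 ?enorm_ge0//.
apply: (shift_ball_volume lamP _ _ t01 mBt) => // x /=; exact: ltW.
Qed.

End wave_kernel1.

(** * The wave kernel in dimension 2 *)

Section wave_kernel2.
Local Open Scope ereal_scope.
Context {R : realType}.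
Local Notation E := 'rV[R]_2.
Local Notation lam := (@lebesgue2 R).
Local Notation kap := (ball_volume lam).
Let lamP := @is_lebesgue2 R.

Section superlevel.
Variable t : R.
Hypothesis t01 : (0 <= t <= 1)%R.
Let t0 : (0 <= t)%R. Proof. by have /andP[] := t01. Qed.
Let t1 : (t <= 1)%R. Proof. by have /andP[] := t01. Qed.
Let G : E -> R := wave_kernel t.
(** Where |x| < t and l > 0, G x > l means |x|^2 > u l, so [K l] is the ball to be removed from the
    support. The guard 0 < l in [K] matters: the inverse of 0 being 0, u 0 = t^2, and [K 0] would be
    the whole closed ball although G > 0 on the open one. *)
Let u (l : R) : R := (t ^+ 2 - (2 * pi * l) ^- 2)%R.
Let K (l : R) := [set x : E | (0 < l)%R && (enorm x ^+ 2 <= u l)%R].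

Let superlevelE (l : R) (x : E) : (0 <= l)%R ->
  (l < G x)%R = (enorm x < t)%R && (x \notin K l).
Proof.
move=> l0; rewrite /G /wave_kernel; case: ifPn => /= [xt|_]; last by rewrite ltNge l0.
have pi2 : (0 < 2 * pi :> R)%R by rewrite mulr_gt0// pi_gt0.
have s0 : (0 < t ^+ 2 - enorm x ^+ 2)%R by rewrite subr_gt0 ltrXn2r ?nnegrE ?enorm_ge0.
have sq0 : (0 < Num.sqrt (t ^+ 2 - enorm x ^+ 2))%R by rewrite sqrtr_gt0.
move: l0; rewrite le_eqVlt => /orP[/eqP<-|l0].
  by rewrite mulr_gt0 ?invr_gt0// memNset// /K/= ltxx.
have -> : (x \notin K l) = (u l < enorm x ^+ 2)%R.
  rewrite ltNge; congr (~~ _); apply/idP/idP; rewrite inE /K/= l0//=.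
have l2 : (0 < 2 * pi * l)%R by rewrite mulr_gt0.
rewrite ltr_pdivlMl// -[X in (X < _)%R]invrK ltf_pV2 ?posrE ?invr_gt0//.
rewrite -ltr_sqr ?nnegrE ?sqrtr_ge0 ?invr_ge0 ?(ltW l2)// sqr_sqrtr ?(ltW s0)//.
by rewrite exprVn /u ltrBlDr ltrBlDr addrC.
Qed.

(** [K l] is either empty or the closed ball of radius sqrt (u l) <= t <= 1. *)
Let K_shift (l : R) (y : E) :
  measurable (K l) /\
  lam (shift_diff (K l) y) <= (9 * kap * enorm y)%:E.
Proof.
have [KE|[r [r01 KE]]] : K l = set0 \/ exists r, (0 <= r <= 1)%R /\ K l = [set x : E | (enorm x <= r)%R].
- have [l0|l0] := ltP 0%R l; last first.
    by left; apply/seteqP; split=> x //=; rewrite /K/= ltNge l0.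
  have [u0|u0] := ltP (u l) 0%R.
    left; apply/seteqP; split=> x //=; rewrite /K/= l0/= => h.
    by have := le_lt_trans h u0; rewrite ltNge sqr_ge0.
  right; exists (Num.sqrt (u l)); split.
    rewrite sqrtr_ge0/= -ler_sqr ?nnegrE ?sqrtr_ge0// (sqr_sqrtr u0) expr1n.
    by rewrite (@le_trans _ _ (t ^+ 2)%R)// ?exprn_ile1// lerBlDr lerDl invr_ge0 sqr_ge0.
  apply/seteqP; split=> x; rewrite /K/= l0/=.
    by move=> h; rewrite -ler_sqr ?nnegrE ?sqrtr_ge0 ?enorm_ge0// (sqr_sqrtr u0).
  by rewrite -ler_sqr ?nnegrE ?sqrtr_ge0 ?enorm_ge0// (sqr_sqrtr u0).
- rewrite KE; split; first exact: measurable0.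
  rewrite (_ : shift_diff _ y = set0) ?measure0; last first.
    by apply/seteqP; split=> z //= -[[]|[]].
  by rewrite lee_fin !mulr_ge0// ?ball_volume_ge0// enorm_ge0.
rewrite KE; split; first exact: measurable_ball_le.
apply: (shift_ball_volume lamP _ _ r01 (measurable_ball_le _)) => // x /=.
exact: ltW.
Qed.

(** If u l >= 0, the area is at most kap (t^2 - u l) = kap (2 pi l)^-2; if u l < 0, the full disc
    has area kap t^2 < kap (2 pi l)^-2 or 0. Since 2 pi >= 1, both are at most kap l^-2. *)
Let volume_superlevel (l : R) : (0 <= l)%R ->
  measurable [set x | (l < G x)%R] /\
  lam [set x | (l < G x)%R] <= kap%:E /\
  ((0 < l)%R -> lam [set x | (l < G x)%R] <= (kap * l ^- 2)%:E).
Proof.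
move=> l0; have [mK _] := K_shift l 0.
have SE : [set x | (l < G x)%R] = [set x : E | (enorm x < t)%R] `\` K l.
  apply/seteqP; split=> x /=; rewrite superlevelE//.
    by move=> /andP[xt]; rewrite notin_setE.
  by move=> [xt nK]; rewrite xt/= notin_setE.
have mS : measurable [set x | (l < G x)%R].
  by rewrite SE; apply: measurableD => //; exact: measurable_ball_lt.
have k0 : (0 <= kap)%R := ball_volume_ge0 lam.
split=> //; split.
  apply: (@le_trans _ _ (lam [set x : E | (enorm x <= 1)%R])).
    apply: le_measure; rewrite ?inE//; first exact: measurable_ball_le.
    by rewrite SE => x /= [xt _]; exact: (le_trans (ltW xt)).
  by rewrite (lebesgue_ball lamP _ ler01)// expr1n mulr1.
move=> lp.
have pi2 : (1 <= 2 * pi :> R)%R.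
  by have := pi_ge2 R; lra.
have le2 : ((2 * pi * l) ^- 2 <= l ^- 2)%R.
  have l2 : (0 < 2 * pi * l)%R by rewrite mulr_gt0// (lt_le_trans ltr01).
  rewrite lef_pV2 ?posrE ?exprn_gt0// lerXn2r ?nnegrE ?(ltW l2)//.
  by rewrite ler_peMl.
have [u0|u0] := ltP (u l) 0%R.
  apply: (@le_trans _ _ (lam [set x : E | (enorm x <= t)%R])).
    apply: le_measure; rewrite ?inE//; first exact: measurable_ball_le.
    by rewrite SE => x /= [xt _]; exact: ltW.
  rewrite (lebesgue_ball lamP _ t0)// lee_fin ler_wpM2l// (le_trans _ le2)//.
  by move: u0; rewrite /u subr_lt0 => /ltW.
have sub0 : [set x : E | (enorm x <= Num.sqrt (u l))%R] `<=` [set x : E | (enorm x <= t)%R].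
  move=> x /= /le_trans; apply; rewrite -ler_sqr ?nnegrE ?sqrtr_ge0// (sqr_sqrtr u0).
  by rewrite /u lerBlDr lerDl invr_ge0 sqr_ge0.
have foo : lam [set x : E | (enorm x <= t)%R] < +oo.
  by rewrite (lebesgue_ball lamP _ t0)// ltry.
apply: (@le_trans _ _ (lam ([set x : E | (enorm x <= t)%R] `\` [set x : E | (enorm x <= Num.sqrt (u l))%R]))).
  apply: le_measure; rewrite ?inE//; first by apply: measurableD; exact: measurable_ball_le.
  rewrite SE => x /= [xt nK]; split; first exact: ltW.
  move=> xu; apply: nK; rewrite /K/= lp/=.
  by rewrite -(sqr_sqrtr u0) ler_sqr ?nnegrE ?enorm_ge0 ?sqrtr_ge0.
have -> : lam ([set x : E | (enorm x <= t)%R] `\` [set x : E | (enorm x <= Num.sqrt (u l))%R]) =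
    lam [set x : E | (enorm x <= t)%R] -
    lam ([set x : E | (enorm x <= t)%R] `&` [set x : E | (enorm x <= Num.sqrt (u l))%R]).
  exact: (measureD (measurable_ball_le _) (measurable_ball_le _) foo).
rewrite (setIidr sub0) (lebesgue_ball lamP _ t0)// (lebesgue_ball lamP _ (sqrtr_ge0 _))//.
rewrite (sqr_sqrtr u0) -EFinB lee_fin -mulrBr ler_wpM2l// /u opprB addrC subrK//.
Qed.

Lemma hoelder_wave_kernel2 :
  hoelder_kernel lam (20 * kap)%R (2^-1)%R (wave_kernel t : E -> R).
Proof.
have k0 : (0 <= kap)%R := ball_volume_ge0 lam.
have G0 x : (0 <= G x)%R.
  rewrite /G /wave_kernel; case: ifPn => // _.
  by rewrite mulr_ge0 ?invr_ge0 ?sqrtr_ge0// mulr_ge0// pi_ge0.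
(* Measurability is read off the superlevel sets; those of negative level are the whole plane. *)
have mG : measurable_fun setT G.
  apply: (measurability _ (RGenOInfty.measurableE R)).
  move=> _ [_ [l ->] <-]; rewrite setTI.
  rewrite (_ : _ @^-1` _ = [set x | (l < G x)%R]); last first.
    by apply/seteqP; split=> x /=; rewrite in_itv/= andbT.
  have [l0|l0] := leP 0%R l; first by have [] := volume_superlevel l0.
  rewrite (_ : [set x | _] = setT)//; apply/seteqP; split=> x //= _.
  exact: (lt_le_trans l0).
have bound (F : E -> R) (a b L : R) : measurable_fun setT F -> (0 < L)%R -> (0 <= a)%R -> (0 <= b)%R ->
    (forall x, 0 <= F x)%R ->
    (forall l, (0 <= l)%R -> lam [set x | (l < F x)%R != (l < G x)%R] <= a%:E) ->
    (forall l, (0 < l)%R -> lam [set x | (l < F x)%R != (l < G x)%R] <= (b * l ^- 2)%:E) ->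
    \int[lam]_x `|F x - G x|%:E <= (a * L + b / L)%:E.
  move=> mF L0 a0 b0 F0 Fa Fb; have [_ mPsi ->] := integral_dist_superlevel lam mF mG.
  apply: integral_le_min_inverse_square => // l l0.
  rewrite (_ : [set x | _] = set0) ?measure0//; apply/seteqP; split=> x //=.
  by rewrite (lt_le_trans l0 (F0 x)) (lt_le_trans l0 (G0 x)).
(* The same bound, comparing [G] with 0 instead of a translate and cutting at level 1, gives 2
   kap. *)
have normG : \int[lam]_x `|G x|%:E <= (20 * kap)%:E.
  have m0 : measurable_fun setT (cst 0%R : E -> R) by exact: measurable_cst.
  have E0 l : (0 <= l)%R -> [set x : E | (l < cst 0 x)%R != (l < G x)%R] = [set x | (l < G x)%R].
    move=> l0; have nl : (l < (0 : R))%R = false by rewrite ltNge l0.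
    by apply/seteqP; split=> x /=; rewrite nl; case: (l < G x)%R.
  have := bound _ kap kap 1%R m0 ltr01 k0 k0 (fun=> lexx _).
  rewrite (eq_integral (fun x => `|G x|%:E)); last by move=> x _; rewrite /= sub0r normrN.
  rewrite divr1 mulr1 => h; apply: (le_trans (h _ _)).
  - by move=> l l0; rewrite E0//; have [_ []] := volume_superlevel l0.
  - by move=> l lp; rewrite E0 ?(ltW lp)//; have [_ [_ ]] := volume_superlevel (ltW lp); apply.
  - by rewrite lee_fin; move: k0; lra.
split.
- apply/integrableP; split; first exact/measurable_EFinP.
  exact: (le_lt_trans normG (ltry _)).
- move=> z; rewrite /wave_kernel; case: ifPn => [h _|]; last by rewrite eqxx.
  exact: (le_trans (ltW h)).
- exact: normG.
move=> y; have [->|yN] := eqVneq y 0%R.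
  rewrite (eq_integral (cst 0)); last by move=> z _; rewrite /= subr0 subrr normr0.
  by rewrite integral0 lee_fin !mulr_ge0// powR_ge0.
have h0 : (0 < enorm y)%R by rewrite lt_neqAle enorm_ge0 eq_sym enorm_eq0 yN.
set h := enorm y in h0 *.
have mGy : measurable_fun setT (fun z : E => G (z - y)%R).
  exact: (measurableT_comp mG (measurable_subr (measurable_id (D := setT)) (measurable_cst y))).
have mE l : measurable [set x | (l < G (x - y))%R != (l < G x)%R].
  by have [mE _ _] := integral_dist_superlevel lam mGy mG; exact: mE.
(* The cut L = h^{-1/2} makes both terms multiples of h^{1/2}: 18 kap h L, with 9 for the disc of
   radius t and 9 for [K l], and 2 kap / L for the two superlevel sets taken separately. Hence 20
   kap. *)
have pL : (0 < h `^ (- 2^-1))%R by rewrite powR_gt0.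
have h12 : (h * h `^ (- 2^-1) = h `^ 2^-1)%R.
  have e : (2^-1 = 1 + - 2^-1 :> R)%R by lra.
  have hN : (1 + - 2^-1 == 0 :> R)%R ==> (h != 0)%R by rewrite (gt_eqF h0) implybT.
  by rewrite [in RHS]e (powRD hN) (powRr1 (ltW h0)).
have h21 : ((h `^ (- 2^-1))^-1 = h `^ 2^-1)%R by rewrite powRN invrK.
have e12 : (18 * kap * h * h `^ (- 2^-1) = 18 * kap * h `^ 2^-1)%R by rewrite -mulrA h12.
have := bound _ (18 * kap * h)%R (2 * kap)%R _ mGy pL.
rewrite h21 e12 => /(_ _ _ (fun z => G0 _)) H.
apply: (le_trans (H _ _ _ _)).
- by rewrite !mulr_ge0// ltW.
- by rewrite mulr_ge0.
- move=> l l0; have [mK Ksh] := K_shift l y.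
  have mBt : measurable [set x : E | (enorm x < t)%R] := measurable_ball_lt t.
  apply: (@le_trans _ _ (lam (shift_diff [set x : E | (enorm x < t)%R] y `|` shift_diff (K l) y))).
    apply: le_measure; rewrite ?inE; first exact: mE.
      by apply: measurableU; exact: measurable_shift_diff.
    move=> x /=; rewrite !superlevelE// => h'.
    have [b1|b1] := boolP (enorm (x - y) < t)%R; have [b2|b2] := boolP (enorm x < t)%R;
      rewrite ?b1 ?b2 ?(negbTE b1) ?(negbTE b2)/= in h'.
    - right; move: h'; have [k1|k1] := boolP (x - y \in K l)%R; have [k2|k2] := boolP (x \in K l) => // _.
      + by left; split; [move: k1; rewrite inE|move: k2; rewrite notin_setE].
      + by right; split; [move: k1; rewrite notin_setE|move: k2; rewrite inE].
    - by left; left; split=> //; exact/negP.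
    - by left; right; split=> //; exact/negP.
    - by [].
  apply: (le_trans (measureU2 _ (measurable_shift_diff y mBt) (measurable_shift_diff y mK))).
  have Bsh : lam (shift_diff [set x : E | (enorm x < t)%R] y) <= (9 * kap * h)%:E.
    by apply: (shift_ball_volume lamP _ _ t01 mBt) => // x /=; exact: ltW.
  apply: (le_trans (leeD Bsh Ksh)); rewrite -EFinD lee_fin -!mulrDl -natrD; exact: lexx.
- move=> l lp; have [mS [_ /(_ lp) vS]] := volume_superlevel (ltW lp).
  apply: (@le_trans _ _ (lam ([set x | (l < G (x - y))%R] `|` [set x | (l < G x)%R]))).
    apply: le_measure; rewrite ?inE; first exact: mE.
      by apply: measurableU => //; exact: (measurable_shift y mS).
    by move=> x /=; case: (l < G (x - y))%R; case: (l < G x)%R => //= _; [left|right].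
  apply: (le_trans (measureU2 _ (measurable_shift y mS) mS)).
  have vSy : lam [set x | (l < G (x - y))%R] <= (kap * l ^- 2)%:E.
    by have := lebesgue_shift lamP y mS => /= ->.
  by apply: (le_trans (leeD vSy vS)); rewrite -EFinD lee_fin -(mulrA 2)%R mulr_natl mulr2n lexx.
by rewrite lee_fin -!mulrDl -natrD; exact: lexx.
Qed.

End superlevel.
End wave_kernel2.

(** * Besov norms *)

Section besov_estimate.
Local Open Scope ereal_scope.
Context {R : realType} (n : nat) (lam : {sigma_finite_measure set 'rV[R]_n -> \bar R}).
Hypothesis lamP : is_lebesgue lam.
Local Notation E := 'rV[R]_n.
Implicit Types (f g : E -> R).
Variables (L : nat) (phi0 : E -> R) (p : R) (q : \bar R).
Hypotheses (L1 : (1 <= L)%N) (hphi : admissible L phi0) (p1 : (1 < p)%R) (q1 : 1 < q).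
Local Notation B := (block phi0).

Let tphi : test_function phi0. Proof. by have [] := hphi. Qed.

Let c0N : (\int[lam]_x phi0 x != 0)%R.
Proof.
have [_ + _] := hphi; rewrite (Rintegral_RdE lamP)//.
exact: (test_function_bounded_measurable tphi).1.
Qed.

(** The moment condition for the i-th unit multi-index, of order 1; this is where 1 <= L enters. *)
Let moment1 (i : 'I_n) : (\int[lam]_x (x 0 i * mother phi0 x) = 0)%R.
Proof.
have [_ _ /(_ (fun k => (k == i : nat)))] := hphi.
have E1 (x : E) : (\prod_(k < n) x 0 k ^+ (k == i) = x 0 i)%R.
  by rewrite (bigD1 i)//= eqxx expr1 big1 ?mulr1// => k /negbTE ->.
have -> : (fun x : E => (\prod_(k < n) x 0 k ^+ (k == i)) * mother phi0 x)%R =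
    (fun x : E => x 0 i * mother phi0 x)%R by apply/funext => x; rewrite E1.
rewrite (Rintegral_RdE lamP); last first.
  by apply: measurable_funM; [exact: measurable_coord|exact: (measurable_mother tphi)].
apply; rewrite (bigD1 i)//= eqxx big1 ?addn0// => k /negbTE -> //.
Qed.

Let kB j : kernel lam (B j).
Proof. by have [MA [_ _ /(_ j)[]]] := block_bounds lamP tphi c0N. Qed.

Let a (mu : R) f j := weighted_Lp_norm mu p (convolution (B j) f).
Let a0 mu f j : 0 <= a mu f j := weighted_Lp_norm_ge0 mu p _.
Let e (s : R) (j : nat) : R := 2 `^ (j%:R * s).
Let e0 s j : (0 <= e s j)%R. Proof. exact: powR_ge0. Qed.
Let ea0 s mu f j : 0 <= (e s j)%:E * a mu f j.
Proof. by apply: mule_ge0 => //; rewrite lee_fin. Qed.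

Lemma besov_normE s mu f :
  besov_norm phi0 s mu p q f = lq_norm q (fun j => (e s j)%:E * a mu f j).
Proof.
rewrite /besov_norm /lq_norm; case: q => [r| |]//; congr (_ `^ _).
apply: eq_eseriesr => j _; rewrite poweRM ?lee_fin//.
by rewrite poweR_EFin /e -powRrM.
Qed.

Let bdd f : test_function f -> bounded_measurable f := @test_function_bounded_measurable _ _ f.
Let mconv f j : test_function f -> measurable_fun setT (convolution (B j) f).
Proof. by move=> /bdd bf; have [] := bounded_convolution lamP (kB j) bf. Qed.

Lemma seminorm_besov_norm s mu : seminorm_on test_function (besov_norm phi0 s mu p q).
Proof.
split=> [f||f tf|f g tf tg]; rewrite !besov_normE.
- exact: lq_norm_ge0.
- rewrite -[RHS](lq_norm0 q1); congr lq_norm; apply/funext => j.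
  have b0 : bounded_measurable (0%R : E -> R) by apply: bdd; exact: test_function0.
  have := convolutionZr lamP 0%R (kB j) b0; rewrite !scale0r /a => ->.
  by rewrite (weighted_Lp_norm0 lamP mu p1) mule0.
- suff -> : a mu (- f)%R = a mu f by [].
  apply/funext => j.
  have := convolutionZr lamP (-1)%R (kB j) (bdd tf); rewrite !scaleN1r /a => ->.
  have := weighted_Lp_normZ lamP mu p1 (-1)%R (mconv j tf).
  by rewrite scaleN1r normrN1 mul1e.
- apply: le_trans (lq_norm_triangle q1 (ea0 s mu f) (ea0 s mu g)).
  apply: (lq_norm_le q1 (ea0 s mu _)) => j.
  rewrite -(ge0_muleDr _ (a0 _ _ _) (a0 _ _ _)); apply: lee_wpmul2l; first by rewrite lee_fin.
  rewrite /a (convolutionDr lamP (kB j) (bdd tf) (bdd tg)).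
  exact: (weighted_Lp_normD lamP mu p1 (mconv j tf) (mconv j tg)).
Qed.

Let weight_cancel (alpha s : R) (j : nat) : (e (alpha + s) j * (2 ^- j) `^ s = e alpha j)%R.
Proof.
have h : ((2 : R) ^- j = 2 `^ (- j%:R))%R by rewrite powRN powR_mulrn.
rewrite h -powRrM /e -powRD ?pnatr_eq0 ?implybT//; congr (_ `^ _)%R; ring.
Qed.

Let weight_mono (alpha : R) (j k : nat) : (alpha <= 0)%R -> (k <= j)%N -> (e alpha j <= e alpha k)%R.
Proof.
move=> al kj; apply: ler_powR; first by rewrite ler1n.
by apply: ler_wnM2r => //; rewrite ler_nat.
Qed.

Lemma besov_convolution_le (s A mu_star : R) : (0 <= s <= 1)%R -> (0 <= A)%R -> (0 <= mu_star)%R ->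
  exists2 C : R, (0 < C)%R & forall alpha mu, (alpha <= 0)%R -> (0 <= mu <= mu_star)%R ->
    forall G, hoelder_kernel lam A s G -> forall f, test_function f ->
    besov_norm phi0 (alpha + s) mu p q (convolution G f) <= C%:E * besov_norm phi0 alpha mu p q f.
Proof.
move=> s01 A0 ms0.
have [C C0 blk] := block_estimate lamP tphi c0N moment1 p1 s01 A0 ms0.
(* [C] comes from the single blocks and 2 from Schur's test. *)
exists (C * 2)%R; first by rewrite mulr_gt0.
move=> alpha mu al mu01 G hG f tf; rewrite !besov_normE.
pose y j := (e alpha j)%:E * a mu f j.
pose z j := \sum_(0 <= k <oo) (geometric_weight j k)%:E * y k.
have w0 j k : 0 <= (geometric_weight j k)%:E :> \bar R by rewrite lee_fin geometric_weight_ge0.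
have y0 j : 0 <= y j := ea0 _ _ _ _.
have z0 j : 0 <= z j by apply: nneseries_ge0 => k _ _; exact: mule_ge0.
apply: (@le_trans _ _ (lq_norm q (fun j => C%:E * z j))); last first.
  rewrite (lq_normZ q1 (ltW C0) z0) EFinM -muleA; apply: lee_wpmul2l; first by rewrite lee_fin ltW.
  by apply: (lq_norm_geometric q1) => // j; exact: lexx.
apply: (lq_norm_le q1 (ea0 _ _ _)) => j.
have ga0 k : 0 <= (geometric_weight j k)%:E * a mu f k by exact: mule_ge0.
apply: (@le_trans _ _ ((e (alpha + s) j)%:E * ((C * (2 ^- j) `^ s)%:E *
    \sum_(0 <= k <oo) (geometric_weight j k)%:E * a mu f k))).
  by apply: lee_wpmul2l; [rewrite lee_fin|exact: blk].
rewrite muleA -EFinM mulrCA weight_cancel EFinM -muleA.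
apply: lee_wpmul2l; first by rewrite lee_fin ltW.
rewrite -nneseriesZl; last by move=> k _; exact: ga0.
apply: lee_nneseries => k _.
  by move=> _; apply: mule_ge0 => //; rewrite lee_fin.
rewrite /y !muleA -!EFinM; apply: (lee_wpmul2r (a0 _ _ _)); rewrite lee_fin /geometric_weight.
case: ifPn => [kj|_]; last by rewrite mulr0 mul0r.
by rewrite mulrC ler_wpM2l ?invr_ge0 ?exprn_ge0// weight_mono.
Qed.

Lemma besov_convolution_ext (s A mu_star : R) : (0 <= s <= 1)%R -> (0 <= A)%R -> (0 <= mu_star)%R ->
  exists C : R, forall alpha mu, (alpha <= 0)%R -> (0 <= mu <= mu_star)%R ->
    forall G, hoelder_kernel lam A s G -> forall f : set (nat -> E -> R), besov phi0 alpha mu p q f ->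
    let Gf := completion_ext test_function (besov_norm phi0 (alpha + s) mu p q) (convolution G) f in
    besov phi0 (alpha + s) mu p q Gf /\
    besov_space_norm phi0 (alpha + s) mu p q Gf <= C%:E * besov_space_norm phi0 alpha mu p q f.
Proof.
move=> s01 A0 ms0; have [C C0 le] := besov_convolution_le s01 A0 ms0.
exists C => alpha mu al mu01 G hG f hf; have [kG Gs _ _] := hG.
have GB x y : test_function x -> test_function y ->
    convolution G (x - y)%R = (convolution G x - convolution G y)%R.
  move=> /bdd bx /bdd by_; have byN := bounded_measurableZ (-1)%R by_.
  have := convolutionDr lamP kG bx byN.
  by rewrite (convolutionZr lamP (-1)%R kG by_) !scaleN1r.
have GD x : test_function x -> test_function (convolution G x).
  by move=> tx; exact: (test_function_convolution lamP kG Gs tx).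
exact: (completion_ext_bounded (@test_functionB R n)
  (seminorm_besov_norm alpha mu) (seminorm_besov_norm (alpha + s)%R mu) C0 GD GB
  (le alpha mu al mu01 G hG) hf).
Qed.

End besov_estimate.

Theorem proposition3p4 (R : realType) (d : nat) (hd : d = 1%N \/ d = 2%N)
    (L : nat) (hL : (1 <= L)%N)
    (phi0 : 'rV[R]_d -> R) (hphi0 : admissible L phi0)
    (mu_star : R) (hmu_star : 0 < mu_star)
    (p : R) (hp : 1 < p) (q : \bar R) (hq : (1%:E < q)%E) :
  exists C : R, forall (alpha mu : R),
    alpha <= 0 -> 0 <= mu <= mu_star ->
    forall t : R, 0 <= t <= 1 ->
    forall f, besov phi0 alpha mu p q f ->
      besov phi0 (alpha + rho R d) mu p q
        (wave_op phi0 (alpha + rho R d) mu p q t f) /\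
      (besov_space_norm phi0 (alpha + rho R d) mu p q
         (wave_op phi0 (alpha + rho R d) mu p q t f)
       <= C%:E * besov_space_norm phi0 alpha mu p q f)%E.
Proof.
have ms0 := ltW hmu_star.
case: hd => ?; subst d.
(* Here [rho R 1] computes to 1, the Hölder exponent of the kernel; in the other case [rho R 2]
   computes to 1/2. *)
- have k0 := ball_volume_ge0 (@lebesgue1 R).
  have A0 : 0 <= 9 * ball_volume (@lebesgue1 R) by rewrite mulr_ge0.
  have s01 : 0 <= (1 : R) <= 1 by rewrite ler01 lexx.
  have [C HC] := besov_convolution_ext is_lebesgue1 hL hphi0 hp hq s01 A0 ms0.
  exists C => alpha mu al hmu t ht f hf.
  exact: (HC alpha mu al hmu _ (hoelder_wave_kernel1 ht) f hf).
- have k0 := ball_volume_ge0 (@lebesgue2 R).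
  have A0 : 0 <= 20 * ball_volume (@lebesgue2 R) by rewrite mulr_ge0.
  have s01 : 0 <= (2^-1 : R) <= 1 by rewrite invr_ge0 ler0n invf_le1// ler1n.
  have [C HC] := besov_convolution_ext is_lebesgue2 hL hphi0 hp hq s01 A0 ms0.
  exists C => alpha mu al hmu t ht f hf.
  exact: (HC alpha mu al hmu _ (hoelder_wave_kernel2 ht) f hf).
Qed.
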